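(* In $PGL_4(\mathbb{R})$ there are precisely 15 conjugacy classes of subgroups isomorphic to $(\mathbb{R}^3,+)$. They are represented by the following 15 groups, no two of which are conjugate in $PGL_4(\mathbb{R})$, where each displayed matrix stands for the group of all such matrices as the parameters $a,b,c$ vary (parameters occurring on the diagonal range over $\mathbb{R}_{+}=(0,\infty)$, the other parameters over $\mathbb{R}$): $$C:\begin{pmatrix}a&0&0&0\\0&b&0&0\\0&0&c&0\\0&0&0&\frac1{abc}\end{pmatrix},\quad E_1:\begin{pmatrix}a&0&0&0\\0&b&c&0\\0&0&b&0\\0&0&0&\frac1{ab^2}\end{pmatrix},\quad F_0:\begin{pmatrix}a&b&0&0\\0&a&0&0\\0&0&\frac1a&c\\0&0&0&\frac1a\end{pmatrix},$$ $$F_1:\begin{pmatrix}a&b&c&0\\0&a&b&0\\0&0&a&0\\0&0&0&\frac1{a^3}\end{pmatrix},\quad F_2:\begin{pmatrix}a&b&c&0\\0&a&0&0\\0&0&a&0\\0&0&0&\frac1{a^3}\end{pmatrix},\quad F_3:\begin{pmatrix}a&0&c&0\\0&a&b&0\\0&0&a&0\\0&0&0&\frac1{a^3}\end{pmatrix},$$ $$N_1:\begin{pmatrix}1&a&b&c\\0&1&a&b\\0&0&1&a\\0&0&0&1\end{pmatrix},\quad N_2:\begin{pmatrix}1&a&b&c\\0&1&a&0\\0&0&1&0\\0&0&0&1\end{pmatrix},\quad N_3:\begin{pmatrix}1&0&0&c\\0&1&a&b\\0&0&1&a\\0&0&0&1\end{pmatrix},$$ $$N_4:\begin{pmatrix}1&a&b&c\\0&1&0&b\\0&0&1&a\\0&0&0&1\end{pmatrix},\quad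 N_4':\begin{pmatrix}1&a&b&c\\0&1&0&a\\0&0&1&b\\0&0&0&1\end{pmatrix},\quad N_5:\begin{pmatrix}1&0&b&c\\0&1&a&b\\0&0&1&0\\0&0&0&1\end{pmatrix},$$ $$N_6:\begin{pmatrix}1&a&0&c\\0&1&0&0\\0&0&1&b\\0&0&0&1\end{pmatrix},\quad N_7:\begin{pmatrix}1&0&0&c\\0&1&0&b\\0&0&1&a\\0&0&0&1\end{pmatrix},\quad N_8:\begin{pmatrix}1&a&b&c\\0&1&0&0\\0&0&1&0\\0&0&0&1\end{pmatrix}.$$
   Context: A matrix in $GL_4(\mathbb{R})$ denotes its class in $PGL_4(\mathbb{R})$. ''Subgroup isomorphic to $(\mathbb{R}^3,+)$'' means a Lie subgroup of $PGL_4(\mathbb{R})$ that is isomorphic to $(\mathbb{R}^3,+)$ as a Lie group. *)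

(* Defs.v *)
From HB Require Import structures.
From mathcomp Require Import all_boot all_order all_algebra generic_quotient.
From mathcomp Require Import all_classical all_reals all_analysis.

Set Implicit Arguments.
Unset Strict Implicit.
Unset Printing Implicit Defensive.

Import Order.TTheory GRing.Theory Num.Theory.
Import numFieldNormedType.Exports.

Local Open Scope classical_set_scope.
Local Open Scope ring_scope.
Local Open Scope quotient_scope.

Section ProjectiveLinearGroup.
Variables (R : realType) (n : nat).

Record GL := MkGL { GLmx :> 'M[R]_n; GLmxP : GLmx \in unitmx }.

HB.instance Definition _ := [isSub for GLmx].
HB.instance Definition _ := [Choice of GL by <:].

Definition GL_one : GL := MkGL (unitmx1 R n).

Lemma GL_mulP (g h : GL) : (g : 'M[R]_n) *m h \in unitmx.
Proof. by rewrite unitmx_mul !GLmxP. Qed.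

Definition GL_mul (g h : GL) : GL := MkGL (GL_mulP g h).

Lemma GL_invP (g : GL) : invmx g \in unitmx.
Proof. by rewrite unitmx_inv GLmxP. Qed.

Definition GL_inv (g : GL) : GL := MkGL (GL_invP g).

Lemma GL_mulA : associative GL_mul.
Proof. by move=> g h k; apply: val_inj; rewrite /= mulmxA. Qed.

Lemma GL_mul1g : left_id GL_one GL_mul.
Proof. by move=> g; apply: val_inj; rewrite /= mul1mx. Qed.

Lemma GL_mulg1 : right_id GL_one GL_mul.
Proof. by move=> g; apply: val_inj; rewrite /= mulmx1. Qed.

Lemma GL_mulVg : left_inverse GL_one GL_inv GL_mul.
Proof. by move=> g; apply: val_inj; rewrite /= mulVmx ?GLmxP. Qed.

Lemma GL_mulgV : right_inverse GL_one GL_inv GL_mul.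
Proof. by move=> g; apply: val_inj; rewrite /= mulmxV ?GLmxP. Qed.

HB.instance Definition _ :=
  isGroup.Build GL GL_mulA GL_mul1g GL_mulg1 GL_mulVg GL_mulgV.

Definition proj_eq (g h : GL) : bool :=
  `[< exists2 c : R, c != 0 & (h : 'M[R]_n) = c *: (g : 'M[R]_n) >].

Lemma proj_eq_refl : reflexive proj_eq.
Proof. by move=> g; apply/asboolP; exists 1; rewrite ?oner_eq0 ?scale1r. Qed.

Lemma proj_eq_sym : symmetric proj_eq.
Proof.
suff imp g h : proj_eq g h -> proj_eq h g by move=> g h; apply/idP/idP; exact: imp.
move=> /asboolP[c c0 E]; apply/asboolP; exists c^-1; first by rewrite invr_eq0.
by rewrite E scalerA mulVf // scale1r.
Qed.

Lemma proj_eq_trans : transitive proj_eq.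
Proof.
move=> h g k /asboolP[c c0 E] /asboolP[d d0 F]; apply/asboolP; exists (d * c).
  by rewrite mulf_neq0.
by rewrite F E scalerA.
Qed.

Canonical proj_eq_equiv :=
  EquivRel proj_eq proj_eq_refl proj_eq_sym proj_eq_trans.

Definition PGL : Type := {eq_quot proj_eq}.

HB.instance Definition _ := Choice.on PGL.
HB.instance Definition _ := EqQuotient.on PGL.

Definition PGL_one : PGL := \pi_PGL 1%g.
Definition PGL_mul (p q : PGL) : PGL := \pi_PGL (repr p * repr q)%g.
Definition PGL_inv (p : PGL) : PGL := \pi_PGL (repr p)^-1%g.

Lemma PGL_piP (g h : GL) :
  reflect (exists2 c : R, c != 0 & (h : 'M[R]_n) = c *: (g : 'M[R]_n))
          (\pi_PGL g == \pi_PGL h).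
Proof. by rewrite piE; apply: asboolP. Qed.

Lemma PGL_repr (g : GL) :
  exists2 c : R, c != 0 & (repr (\pi_PGL g) : 'M[R]_n) = c *: (g : 'M[R]_n).
Proof. by apply/PGL_piP; rewrite reprK. Qed.

Lemma PGL_piM (g h : GL) : PGL_mul (\pi_PGL g) (\pi_PGL h) = \pi_PGL (g * h)%g.
Proof.
apply/esym/eqP/PGL_piP.
have [c c0 E] := PGL_repr g; have [d d0 F] := PGL_repr h.
exists (c * d); first by rewrite mulf_neq0.
by rewrite /= E F -scalemxAl -scalemxAr scalerA.
Qed.

Lemma PGL_piV (g : GL) : PGL_inv (\pi_PGL g) = \pi_PGL g^-1%g.
Proof.
apply/esym/eqP/PGL_piP; have [c c0 E] := PGL_repr g.
exists c^-1; first by rewrite invr_eq0.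
by rewrite /= E invmxZ // unitmxZ ?unitfE // GLmxP.
Qed.

Lemma PGL_mulA : associative PGL_mul.
Proof.
move=> p q r; rewrite -(reprK p) -(reprK q) -(reprK r).
rewrite (PGL_piM (repr q)) (PGL_piM (repr p) (repr q)).
by rewrite (PGL_piM (repr p)) PGL_piM mulgA.
Qed.

Lemma PGL_mul1g : left_id PGL_one PGL_mul.
Proof. by move=> p; rewrite -(reprK p) PGL_piM mul1g. Qed.

Lemma PGL_mulg1 : right_id PGL_one PGL_mul.
Proof. by move=> p; rewrite -(reprK p) PGL_piM mulg1. Qed.

Lemma PGL_mulVg : left_inverse PGL_one PGL_inv PGL_mul.
Proof. by move=> p; rewrite -(reprK p) PGL_piV PGL_piM mulVg. Qed.

Lemma PGL_mulgV : right_inverse PGL_one PGL_inv PGL_mul.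
Proof. by move=> p; rewrite -(reprK p) PGL_piV PGL_piM mulgV. Qed.

HB.instance Definition _ :=
  isGroup.Build PGL PGL_mulA PGL_mul1g PGL_mulg1 PGL_mulVg PGL_mulgV.

End ProjectiveLinearGroup.

Section Smoothness.
Variable R : realType.

(* For open [A], [Ck_on k A f] says that [f] is of class C^k on [A]. *)
Fixpoint Ck_on (U W : normedModType R) (k : nat) (A : set U) (f : U -> W) :
    Prop :=
  match k with
  | 0 => forall x, A x -> {for x, continuous f}
  | k'.+1 => (forall x, A x -> differentiable f x) /\
             (forall v : U, Ck_on k' A ('D_v f))
  end.

Definition smooth_on (U W : normedModType R) (A : set U) (f : U -> W) : Prop :=
  forall k, Ck_on k A f.

(* PGL_n is an open subset of the projective space of M_n, and its manifold
   structure is given by the affine charts of that space: over the classes of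
   the matrices g with g_ij != 0, the chart maps [g] to the matrix g / g_ij,
   an invertible matrix of the affine hyperplane of matrices with (i, j) entry
   equal to 1.  Neither the domain nor the value depends on the
   representative. *)
Definition chart_dom n (i j : 'I_n) : set (PGL R n) :=
  [set p : PGL R n | GLmx (repr p) i j != 0].

Definition chart n (i j : 'I_n) (p : PGL R n) : 'M[R]_n :=
  (GLmx (repr p) i j)^-1 *: GLmx (repr p).

Lemma chart_domE n (i j : 'I_n) (g : GL R n) :
  chart_dom i j (\pi_(PGL R n) g) <-> (g : 'M[R]_n) i j != 0.
Proof.
have [c c0 E] := PGL_repr g.
by rewrite /chart_dom /= E mxE mulf_eq0 negb_or c0.
Qed.

Lemma chartE n (i j : 'I_n) (g : GL R n) :
  chart i j (\pi_(PGL R n) g) = ((g : 'M[R]_n) i j)^-1 *: (g : 'M[R]_n).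
Proof.
have [c c0 E] := PGL_repr g.
by rewrite /chart E mxE invfM scalerA mulrAC mulVf // mul1r.
Qed.

Section Maps.
Variables (U : normedModType R) (n : nat).
Implicit Type f : U -> PGL R n.+1.

(* The openness condition, together with the continuity of [f] in the charts,
   expresses the continuity of [f]. *)
Definition smooth f : Prop :=
  forall i j, open (f @^-1` chart_dom i j) /\
              smooth_on (f @^-1` chart_dom i j) (chart i j \o f).

Definition immersion f : Prop :=
  smooth f /\
  forall x i j, chart_dom i j (f x) -> injective ('d (chart i j \o f) x).

(* [H] is an immersed Lie subgroup isomorphic to (U, +) as a Lie group: the
   Lie group structure of [H] is transported to [U] by the isomorphism, and the
   inclusion of [H] becomes the injective immersive morphism [f]. *)
Definition lie_subgroup_iso (H : set (PGL R n.+1)) : Prop :=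
  exists f : U -> PGL R n.+1,
    [/\ {morph f : x y / x + y >-> (x * y)%g}, injective f, immersion f &
        H = range f].

End Maps.
End Smoothness.

Definition conjugate (G : groupType) (H K : set G) : Prop :=
  exists g : G, K = [set (h ^ g)%g | h in H].

Definition conjugacy_class (G : groupType) (H : set G) : set (set G) :=
  [set K | conjugate H K].

Section Groups.
Variable R : realType.

Definition mx4 (rows : seq (seq R)) : 'M[R]_4 :=
  \matrix_(i < 4, j < 4) (nth [::] rows i)`_j.

Inductive group_name : Type :=
  | C | E1 | F0 | F1 | F2 | F3
  | N1 | N2 | N3 | N4 | N4' | N5 | N6 | N7 | N8.

Definition group_mx (X : group_name) (a b c : R) : 'M[R]_4 :=
  match X with
  | C   => mx4 [:: [:: a; 0; 0; 0];
                   [:: 0; b; 0; 0];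
                   [:: 0; 0; c; 0];
                   [:: 0; 0; 0; 1 / (a * b * c)]]
  | E1  => mx4 [:: [:: a; 0; 0; 0];
                   [:: 0; b; c; 0];
                   [:: 0; 0; b; 0];
                   [:: 0; 0; 0; 1 / (a * b ^+ 2)]]
  | F0  => mx4 [:: [:: a; b; 0; 0];
                   [:: 0; a; 0; 0];
                   [:: 0; 0; 1 / a; c];
                   [:: 0; 0; 0; 1 / a]]
  | F1  => mx4 [:: [:: a; b; c; 0];
                   [:: 0; a; b; 0];
                   [:: 0; 0; a; 0];
                   [:: 0; 0; 0; 1 / a ^+ 3]]
  | F2  => mx4 [:: [:: a; b; c; 0];
                   [:: 0; a; 0; 0];
                   [:: 0; 0; a; 0];
                   [:: 0; 0; 0; 1 / a ^+ 3]]
  | F3  => mx4 [:: [:: a; 0; c; 0];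
                   [:: 0; a; b; 0];
                   [:: 0; 0; a; 0];
                   [:: 0; 0; 0; 1 / a ^+ 3]]
  | N1  => mx4 [:: [:: 1; a; b; c];
                   [:: 0; 1; a; b];
                   [:: 0; 0; 1; a];
                   [:: 0; 0; 0; 1]]
  | N2  => mx4 [:: [:: 1; a; b; c];
                   [:: 0; 1; a; 0];
                   [:: 0; 0; 1; 0];
                   [:: 0; 0; 0; 1]]
  | N3  => mx4 [:: [:: 1; 0; 0; c];
                   [:: 0; 1; a; b];
                   [:: 0; 0; 1; a];
                   [:: 0; 0; 0; 1]]
  | N4  => mx4 [:: [:: 1; a; b; c];
                   [:: 0; 1; 0; b];
                   [:: 0; 0; 1; a];
                   [:: 0; 0; 0; 1]]
  | N4' => mx4 [:: [:: 1; a; b; c];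
                   [:: 0; 1; 0; a];
                   [:: 0; 0; 1; b];
                   [:: 0; 0; 0; 1]]
  | N5  => mx4 [:: [:: 1; 0; b; c];
                   [:: 0; 1; a; b];
                   [:: 0; 0; 1; 0];
                   [:: 0; 0; 0; 1]]
  | N6  => mx4 [:: [:: 1; a; 0; c];
                   [:: 0; 1; 0; 0];
                   [:: 0; 0; 1; b];
                   [:: 0; 0; 0; 1]]
  | N7  => mx4 [:: [:: 1; 0; 0; c];
                   [:: 0; 1; 0; b];
                   [:: 0; 0; 1; a];
                   [:: 0; 0; 0; 1]]
  | N8  => mx4 [:: [:: 1; a; b; c];
                   [:: 0; 1; 0; 0];
                   [:: 0; 0; 1; 0];
                   [:: 0; 0; 0; 1]]
  end.

(* Parameters occurring on the diagonal are positive, the others are free. *)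
Definition group_dom (X : group_name) (a b c : R) : Prop :=
  match X with
  | C => [/\ 0 < a, 0 < b & 0 < c]
  | E1 => 0 < a /\ 0 < b
  | F0 | F1 | F2 | F3 => 0 < a
  | N1 | N2 | N3 | N4 | N4' | N5 | N6 | N7 | N8 => True
  end.

Definition std_group (X : group_name) : set (PGL R 4) :=
  [set p | exists a b c : R, group_dom X a b c /\
     exists g : GL R 4, (g : 'M[R]_4) = group_mx X a b c /\ p = \pi_(PGL R 4) g].

End Groups.
Arguments std_group : clear implicits.

(* Main.v *)
Require Import Defs.
From mathcomp Require Import all_boot all_order all_algebra generic_quotient.
From mathcomp Require Import all_classical all_reals all_analysis.
From mathcomp Require Import perm ring lra zify spectral.
From mathcomp.real_closed Require Import complex.
Import Order.TTheory GRing.Theory Num.Theory.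
Import numFieldNormedType.Exports.
Local Open Scope classical_set_scope.
Local Open Scope ring_scope.

Set Implicit Arguments.
Unset Strict Implicit.
Unset Printing Implicit Defensive.

(* A Lie group morphism f : R^3 -> PGL_4 that is an injective immersion has a
   differential A at 0, a linear map from R^3 to commuting matrices that is
   injective modulo scalars, and f(v) is the class of exp(A v).  If some A v has
   a non-real eigenvalue, its polynomials contain a J with J^3 = -J <> 0; over
   the complex numbers J and the A v lie, modulo scalars, in a conjugate of one
   of the 3-dimensional algebras, so J is some A v modulo scalars, and
   exp(2 pi J) = 1 contradicts the injectivity of f.  Hence the A v are
   simultaneously triangularizable over R.  Grouping the joint eigenvalues gives
   C, E1 and F0 to F3, unless the family is unipotent modulo scalars; then the
   commutation relations and the dimension 3 put it, by explicit conjugations,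
   in one of the forms N1 to N8.

   A conjugation in PGL_4 between two of the groups carries the nilpotent
   matrices N such that 1 + N lies in the first group to those of the second,
   and invariants of these sets of nilpotents (common kernels, nilpotency
   orders), together with unipotence modulo scalars, separate the 15 groups. *)

(** * Families of commuting matrices *)

(** The unipotent case uses real signs ([N4] against [N4']) and is carried out over R only. Over the
    complex numbers it is never reached: [J] is not scalar plus nilpotent, so the family has several
    weights, and that case is settled over any [numFieldType].

    The classification of matrix families proves only containment in a conjugate of one of the
    algebras; equality comes at the end, from a bijection between two copies of R^3.

    No general matrix exponential is constructed. The two kinds of exponential that occur, the
    elements of the fifteen groups and the rotations generated by [J], have closed forms. The
    obstacle in comparing them with f is that a class in PGL_4 has no preferred representative:
    lifts of f are known only up to a factor without any continuity. Hence only quotients of matrix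
    entries are differentiated, and only where the denominator is known not to vanish. *)

Notation i0 := (@Ordinal 4 0 isT).
Notation i1 := (@Ordinal 4 1 isT).
Notation i2 := (@Ordinal 4 2 isT).
Notation i3 := (@Ordinal 4 3 isT).

Lemma ord4P (P : 'I_4 -> Prop) : P i0 -> P i1 -> P i2 -> P i3 -> forall i, P i.
Proof.
move=> P0 P1 P2 P3 [[|[|[|[|m]]]] lti] //.
- by rewrite (_ : Ordinal lti = i0) //; exact: val_inj.
- by rewrite (_ : Ordinal lti = i1) //; exact: val_inj.
- by rewrite (_ : Ordinal lti = i2) //; exact: val_inj.
- by rewrite (_ : Ordinal lti = i3) //; exact: val_inj.
Qed.

Lemma big_ord4 (V : nmodType) (F : 'I_4 -> V) :
  \sum_(i < 4) F i = F i0 + F i1 + F i2 + F i3.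
Proof.
rewrite !big_ord_recl big_ord0 addr0 !addrA.
by congr (F _ + F _ + F _ + F _); apply: val_inj.
Qed.

(** The analogue of [mx4] over any ring, because complex matrices occur as well. *)
Definition m4 (F : pzRingType) (rows : seq (seq F)) : 'M[F]_4 :=
  \matrix_(i < 4, j < 4) (nth [::] rows i)`_j.

Lemma matrix4P (F : pzRingType) (A B : 'M[F]_4) :
  [/\ A i0 i0 = B i0 i0, A i0 i1 = B i0 i1, A i0 i2 = B i0 i2 & A i0 i3 = B i0 i3] ->
  [/\ A i1 i0 = B i1 i0, A i1 i1 = B i1 i1, A i1 i2 = B i1 i2 & A i1 i3 = B i1 i3] ->
  [/\ A i2 i0 = B i2 i0, A i2 i1 = B i2 i1, A i2 i2 = B i2 i2 & A i2 i3 = B i2 i3] ->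
  [/\ A i3 i0 = B i3 i0, A i3 i1 = B i3 i1, A i3 i2 = B i3 i2 & A i3 i3 = B i3 i3] ->
  A = B.
Proof.
by move=> [? ? ? ?] [? ? ? ?] [? ? ? ?] [? ? ? ?]; apply/matrixP;
  apply: ord4P; apply: ord4P.
Qed.

Lemma m4_eq (F : pzRingType) (a00 a01 a02 a03 a10 a11 a12 a13 a20 a21 a22 a23 a30 a31 a32 a33
 b00 b01 b02 b03 b10 b11 b12 b13 b20 b21 b22 b23 b30 b31 b32 b33 : F) :
 [/\ a00 = b00, a01 = b01, a02 = b02 & a03 = b03] ->
 [/\ a10 = b10, a11 = b11, a12 = b12 & a13 = b13] ->
 [/\ a20 = b20, a21 = b21, a22 = b22 & a23 = b23] ->
 [/\ a30 = b30, a31 = b31, a32 = b32 & a33 = b33] ->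
 m4 [:: [:: a00; a01; a02; a03]; [:: a10; a11; a12; a13];
   [:: a20; a21; a22; a23]; [:: a30; a31; a32; a33]] =
 m4 [:: [:: b00; b01; b02; b03]; [:: b10; b11; b12; b13];
   [:: b20; b21; b22; b23]; [:: b30; b31; b32; b33]].
Proof. by case=> -> -> -> ->; case=> -> -> -> ->; case=> -> -> -> ->; case=> -> -> -> ->. Qed.

Lemma m4_mul (F : pzRingType) (a00 a01 a02 a03 a10 a11 a12 a13 a20 a21 a22 a23 a30 a31 a32 a33
 b00 b01 b02 b03 b10 b11 b12 b13 b20 b21 b22 b23 b30 b31 b32 b33 : F) :
 m4 [:: [:: a00; a01; a02; a03]; [:: a10; a11; a12; a13];
   [:: a20; a21; a22; a23]; [:: a30; a31; a32; a33]] *m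
 m4 [:: [:: b00; b01; b02; b03]; [:: b10; b11; b12; b13];
   [:: b20; b21; b22; b23]; [:: b30; b31; b32; b33]] =
 m4 [:: [:: a00 * b00 + a01 * b10 + a02 * b20 + a03 * b30; a00 * b01 + a01 * b11 + a02 * b21 + a03 * b31;
            a00 * b02 + a01 * b12 + a02 * b22 + a03 * b32; a00 * b03 + a01 * b13 + a02 * b23 + a03 * b33];
        [:: a10 * b00 + a11 * b10 + a12 * b20 + a13 * b30; a10 * b01 + a11 * b11 + a12 * b21 + a13 * b31;
            a10 * b02 + a11 * b12 + a12 * b22 + a13 * b32; a10 * b03 + a11 * b13 + a12 * b23 + a13 * b33];
        [:: a20 * b00 + a21 * b10 + a22 * b20 + a23 * b30; a20 * b01 + a21 * b11 + a22 * b21 + a23 * b31;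
            a20 * b02 + a21 * b12 + a22 * b22 + a23 * b32; a20 * b03 + a21 * b13 + a22 * b23 + a23 * b33];
        [:: a30 * b00 + a31 * b10 + a32 * b20 + a33 * b30; a30 * b01 + a31 * b11 + a32 * b21 + a33 * b31;
            a30 * b02 + a31 * b12 + a32 * b22 + a33 * b32; a30 * b03 + a31 * b13 + a32 * b23 + a33 * b33]].
Proof. by apply: matrix4P; rewrite !mxE !big_ord4 !mxE /=. Qed.

Lemma scalar_m4 (F : pzRingType) (x : F) : x%:M = m4 [:: [:: x; 0; 0; 0]; [:: 0; x; 0; 0]; [:: 0; 0; x; 0]; [:: 0; 0; 0; x]].
Proof. by apply: matrix4P; rewrite !mxE. Qed.

Lemma m4_add (F : pzRingType) (a00 a01 a02 a03 a10 a11 a12 a13 a20 a21 a22 a23 a30 a31 a32 a33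
 b00 b01 b02 b03 b10 b11 b12 b13 b20 b21 b22 b23 b30 b31 b32 b33 : F) :
 m4 [:: [:: a00; a01; a02; a03]; [:: a10; a11; a12; a13];
   [:: a20; a21; a22; a23]; [:: a30; a31; a32; a33]] +
 m4 [:: [:: b00; b01; b02; b03]; [:: b10; b11; b12; b13];
   [:: b20; b21; b22; b23]; [:: b30; b31; b32; b33]] =
 m4 [:: [:: a00 + b00; a01 + b01; a02 + b02; a03 + b03]; [:: a10 + b10; a11 + b11; a12 + b12; a13 + b13];
   [:: a20 + b20; a21 + b21; a22 + b22; a23 + b23]; [:: a30 + b30; a31 + b31; a32 + b32; a33 + b33]].
Proof. by apply: matrix4P; rewrite !mxE /=. Qed.

Lemma mulmx_conj (F : pzRingType) n (P Q M N : 'M[F]_n) : Q *m P = 1%:M ->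
  P *m M *m Q *m (P *m N *m Q) = P *m (M *m N) *m Q.
Proof. by move=> QP; rewrite !mulmxA -(mulmxA (P *m M)) QP mulmx1. Qed.

Section Lie.
Variable F : numFieldType.
Implicit Types (X : group_name) (x y z d : F).

(* The traceless matrices whose classes modulo the scalars form the Lie algebra
   of the group [X] in the Lie algebra of PGL_4. *)
Definition liemx X x y z : 'M[F]_4 :=
  match X with
  | C   => m4 [:: [:: x; 0; 0; 0];
                  [:: 0; y; 0; 0];
                  [:: 0; 0; z; 0];
                  [:: 0; 0; 0; - (x + y + z)]]
  | E1  => m4 [:: [:: x; 0; 0; 0];
                  [:: 0; y; z; 0];
                  [:: 0; 0; y; 0];
                  [:: 0; 0; 0; - (x + 2 * y)]]
  | F0  => m4 [:: [:: x; y; 0; 0];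
                  [:: 0; x; 0; 0];
                  [:: 0; 0; - x; z];
                  [:: 0; 0; 0; - x]]
  | F1  => m4 [:: [:: x; y; z; 0];
                  [:: 0; x; y; 0];
                  [:: 0; 0; x; 0];
                  [:: 0; 0; 0; - (3 * x)]]
  | F2  => m4 [:: [:: x; y; z; 0];
                  [:: 0; x; 0; 0];
                  [:: 0; 0; x; 0];
                  [:: 0; 0; 0; - (3 * x)]]
  | F3  => m4 [:: [:: x; 0; z; 0];
                  [:: 0; x; y; 0];
                  [:: 0; 0; x; 0];
                  [:: 0; 0; 0; - (3 * x)]]
  | N1  => m4 [:: [:: 0; x; y; z];
                  [:: 0; 0; x; y];
                  [:: 0; 0; 0; x];
                  [:: 0; 0; 0; 0]]
  | N2  => m4 [:: [:: 0; x; y; z];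
                  [:: 0; 0; x; 0];
                  [:: 0; 0; 0; 0];
                  [:: 0; 0; 0; 0]]
  | N3  => m4 [:: [:: 0; 0; 0; z];
                  [:: 0; 0; x; y];
                  [:: 0; 0; 0; x];
                  [:: 0; 0; 0; 0]]
  | N4  => m4 [:: [:: 0; x; y; z];
                  [:: 0; 0; 0; y];
                  [:: 0; 0; 0; x];
                  [:: 0; 0; 0; 0]]
  | N4' => m4 [:: [:: 0; x; y; z];
                  [:: 0; 0; 0; x];
                  [:: 0; 0; 0; y];
                  [:: 0; 0; 0; 0]]
  | N5  => m4 [:: [:: 0; 0; y; z];
                  [:: 0; 0; x; y];
                  [:: 0; 0; 0; 0];
                  [:: 0; 0; 0; 0]]
  | N6  => m4 [:: [:: 0; x; 0; z];
                  [:: 0; 0; 0; 0];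
                  [:: 0; 0; 0; y];
                  [:: 0; 0; 0; 0]]
  | N7  => m4 [:: [:: 0; 0; 0; z];
                  [:: 0; 0; 0; y];
                  [:: 0; 0; 0; x];
                  [:: 0; 0; 0; 0]]
  | N8  => m4 [:: [:: 0; x; y; z];
                  [:: 0; 0; 0; 0];
                  [:: 0; 0; 0; 0];
                  [:: 0; 0; 0; 0]]
  end.

Definition in_lie X (M : 'M[F]_4) :=
  exists d x y z, M = d%:M + liemx X x y z.

Variable T : Type.
Implicit Types (A B : T -> 'M[F]_4).

Definition similar_fam A B :=
  exists2 P, P \in unitmx & forall t, P *m A t = B t *m P.

Definition commuting A := forall s t, A s *m A t = A t *m A s.

(** Only containment is asked: for a family of dimension 3 modulo scalars it amounts to equality.
    The index type is arbitrary because families are indexed by row vectors as well as by a finite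
    type. *)
Definition lie_conj X A := exists2 B, similar_fam A B & forall t, in_lie X (B t).

Lemma similar_fam_refl A : similar_fam A A.
Proof. by exists 1%:M; rewrite ?unitmx1 // => t; rewrite mul1mx mulmx1. Qed.

Lemma similar_fam_trans B A D : similar_fam A B -> similar_fam B D -> similar_fam A D.
Proof.
move=> [P Pu PA] [Q Qu QB]; exists (Q *m P); first by rewrite unitmx_mul Qu.
by move=> t; rewrite -mulmxA PA mulmxA QB mulmxA.
Qed.

Lemma similar_lie X A B : similar_fam A B -> lie_conj X B -> lie_conj X A.
Proof. by move=> AB [D BD LD]; exists D => //; apply: similar_fam_trans BD. Qed.

Lemma similar_commuting A B : similar_fam A B -> commuting A -> commuting B.
Proof.
move=> [P Pu PA] cA s t.
have E r : B r = P *m A r *m invmx P by rewrite PA mulmxK.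
have EM r r' : B r *m B r' = P *m (A r *m A r') *m invmx P.
  by rewrite !E !mulmxA mulmxKV.
by rewrite !EM cA.
Qed.

Lemma similar_conj A (P Q : 'M[F]_4) : Q *m P = 1%:M ->
  similar_fam A (fun t => P *m A t *m Q).
Proof.
move=> QP; exists P; first by case: (mulmx1_unit QP).
by move=> t; rewrite -!mulmxA QP mulmx1.
Qed.

Lemma similar_perm (f : 'I_4 -> 'I_4) A : injective f ->
  similar_fam A (fun t => \matrix_(i, j) A t (f i) (f j)).
Proof.
move=> f_inj; pose s := perm f_inj; exists (perm_mx s); first exact: unitmx_perm.
move=> t; apply/matrixP => i j; rewrite -row_permE -[s in perm_mx s]invgK -col_permE.
by rewrite !mxE; congr (A t _ _); rewrite -(permE f_inj) ?permKV.
Qed.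

(* [A t] conjugated by the elementary matrix [1 + c *: delta_mx i j]. *)
Definition elem_conj (i j : 'I_4) (c : F) A t : 'M[F]_4 :=
  \matrix_(k, l) (A t k l + c *+ (k == i) * A t j l - c *+ (l == j) * A t k i
     - c ^+ 2 *+ ((k == i) && (l == j)) * A t j i).

Lemma similar_elem (i j : 'I_4) c A : i != j -> similar_fam A (elem_conj i j c A).
Proof.
move=> nij.
have E (e : F) (M : 'M[F]_4) k l : ((1%:M + e *: delta_mx i j) *m M) k l =
    M k l + e *+ (k == i) * M j l.
  rewrite mulmxDl mul1mx -scalemxAl !mxE; congr (_ + _).
  rewrite (bigD1 j) //= big1 ?addr0; last first.
    by move=> m mj; rewrite !mxE (negPf mj) andbF mul0r.
  by rewrite !mxE eqxx andbT; case: (k == i); rewrite ?mulr1n ?mulr0n ?mul1r ?mul0r ?mulr0.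
have E' (e : F) (M : 'M[F]_4) k l : (M *m (1%:M + e *: delta_mx i j)) k l =
    M k l + e *+ (l == j) * M k i.
  rewrite mulmxDr mulmx1 -scalemxAr !mxE; congr (_ + _).
  rewrite (bigD1 i) //= big1 ?addr0; last first.
    by move=> m mj; rewrite !mxE (negPf mj) mulr0.
  by rewrite !mxE eqxx /=; case: (l == j); rewrite ?mulr1n ?mulr0n ?mulr1 ?mulr0 ?mul0r.
exists (1%:M + c *: delta_mx i j).
  have H : (1%:M + c *: delta_mx i j) *m (1%:M + (- c) *: delta_mx i j) = 1%:M :> 'M[F]_4.
    apply/matrixP => k l; rewrite E !mxE (eq_sym j i) (negPf nij) (eq_sym j l) /=.
    by case: (k == i); case: (l == j); rewrite /= ?mulr1n ?mulr0n ?andbF; ring.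
  by case: (mulmx1_unit H).
move=> t; apply/matrixP => k l; rewrite E E' /elem_conj !mxE (negPf nij) !andbF /=.
by case: (k == i); case: (l == j); rewrite /= ?mulr1n ?mulr0n; ring.
Qed.

End Lie.

Lemma m4Z (F : pzRingType) (k a00 a01 a02 a03 a10 a11 a12 a13 a20 a21 a22 a23 a30 a31 a32 a33 : F) :
 k *: m4 [:: [:: a00; a01; a02; a03]; [:: a10; a11; a12; a13];
   [:: a20; a21; a22; a23]; [:: a30; a31; a32; a33]] =
 m4 [:: [:: k * a00; k * a01; k * a02; k * a03]; [:: k * a10; k * a11; k * a12; k * a13];
   [:: k * a20; k * a21; k * a22; k * a23]; [:: k * a30; k * a31; k * a32; k * a33]].
Proof. by apply: matrix4P; rewrite !mxE. Qed.

Lemma liemx_linear (F : numFieldType) X (k x y z x' y' z' : F) :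
  liemx X (k * x + x') (k * y + y') (k * z + z') = k *: liemx X x y z + liemx X x' y' z'.
Proof. by case: X; rewrite /liemx m4Z m4_add; apply: m4_eq; split; ring. Qed.

Lemma liemx0 (F : numFieldType) X : liemx X 0 0 0 = 0 :> 'M[F]_4.
Proof. by case: X; apply: matrix4P; rewrite !mxE /= ?mulr0 ?addr0 ?oppr0. Qed.

Ltac m4_calc := rewrite /liemx ?scalar_m4 ?m4_add ?m4_mul ?m4_add ?m4_mul;
  apply: m4_eq; split; try ring; try by field; do ?[apply/andP; split].

(** * Separating the weights of a commuting triangular family *)

Section Tform.
Variables (F : numFieldType) (T : Type).
Implicit Types (A B : T -> 'M[F]_4).

Definition upper A := forall t (i j : 'I_4), (j < i)%N -> A t i j = 0.

Definition same_weight A i j := forall t, A t i i = A t j j.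

Definition weight_split A i j := same_weight A i j \/ forall t, A t i j = 0.

(* An entry (i, j) between distinct weights is killed by the elementary
   conjugation that kills it at one [s] with [A s i i != A s j j]:
   commutation with [A s] propagates the vanishing to the whole family. *)
Lemma weight_split_step A (i j : 'I_4) (D : 'I_4 -> 'I_4 -> Prop) :
  commuting A -> upper A -> (i < j)%N ->
  (forall k l : 'I_4, D k l -> (k < l)%N /\ (l - k <= j - i)%N) ->
  (forall k l, D k l -> weight_split A k l) ->
  (forall k : 'I_4, (i < k < j)%N -> D i k /\ D k j) ->
  exists B, [/\ similar_fam A B, upper B, weight_split B i j &
    forall k l, D k l -> weight_split B k l].
Proof.
move=> cA uA lij Dlt DA Dij.
have nij : i != j by rewrite -val_eqE neq_ltn lij.
have [wij|nwij] := pselect (same_weight A i j).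
  by exists A; split => //; [exact: similar_fam_refl | left].
have /existsNP [s /eqP ws] := nwij.
(* The solution of [A s i j + c * (A s j j - A s i i) = 0], whose left side is the new entry (i, j)
   at [s]. *)
pose c := A s i j / (A s i i - A s j j).
have sAB := similar_elem c A nij.
set B := elem_conj i j c A in sAB.
have BE t k l : B t k l = A t k l + c *+ (k == i) * A t j l - c *+ (l == j) * A t k i.
  by rewrite mxE (uA t j i lij) mulr0 subr0.
clearbody B.
have Bd t k : B t k k = A t k k.
  rewrite BE; have [->|ki] := eqVneq k i.
    by rewrite (uA t j i lij) (negPf nij) mulr0 addr0 mulr0n mul0r subr0.
  by rewrite mulr0n mul0r addr0; have [->|] := eqVneq k j;
    rewrite ?mulr0n ?mul0r ?subr0 // (uA t j i lij) mulr0 subr0.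
(* As [A] is upper triangular, above the diagonal only entries (i, l) with l >= j and (k, j) with k
   <= i change. Apart from (i, j) itself, all of these are farther from the diagonal than (i, j). *)
have BA t (k l : 'I_4) : (k < l)%N -> (l - k <= j - i)%N -> (k, l) != (i, j) -> B t k l = A t k l.
  move=> lkl lklij; rewrite xpair_eqE BE; have [kE|ki] := eqVneq k i => /=.
    subst k; move=> lj; rewrite (negPf lj) (uA t j l) ?mulr0 ?mulr0n ?mul0r ?addr0 ?subr0 //.
    by move: lj; rewrite -val_eqE /=; lia.
  move=> _; rewrite mulr0n mul0r addr0; case: eqVneq => [lj|]; last by rewrite mulr0n mul0r subr0.
  by rewrite (uA t k i) ?mulr0 ?subr0 //; move: ki; rewrite -val_eqE /=; subst l; lia.
have wB k l : same_weight B k l <-> same_weight A k l.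
  by split=> w t; move: (w t); rewrite !Bd.
have uB : upper B.
  move=> t k l lkl; rewrite BE (uA t k l lkl) add0r.
  have [kE|_] := eqVneq k i; have [lE|_] := eqVneq l j; subst; rewrite ?mulr0n ?mul0r ?subr0 //.
  - by lia.
  - by rewrite (uA t j l) ?mulr0 //; lia.
  - by rewrite (uA t k i) ?mulr0 ?subr0 //; lia.
have Bij0 : B s i j = 0.
  rewrite BE !eqxx !mulr1n -addrA -mulrBr -opprB mulrN /c divfK ?subrr //.
  by rewrite subr_eq0.
have cB := similar_commuting sAB cA.
have Bij t : B t i j = 0.
  have /matrixP/(_ i j) := cB s t; rewrite !mxE.
  (* A term with m strictly between i and j vanishes: otherwise the weights i, m and j would
     coincide, while those of i and j differ at [s]. *)
  have sum2 r r' : \sum_m B r i m * B r' m j = B r i i * B r' i j + B r i j * B r' j j.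
    rewrite (bigD1 i) //= (bigD1 j) 1?eq_sym //= big1 ?addr0 // => m /andP[mi mj].
    have [lim|] := ltnP i m; last first.
      by move=> lmi; rewrite uB ?mul0r //; move: mi; rewrite -val_eqE /=; lia.
    have [lmj|] := ltnP m j; last first.
      by move=> ljm; rewrite (uB _ m j) ?mulr0 //; move: mj; rewrite -val_eqE /=; lia.
    have [|Dim Dmj] := Dij m; first by rewrite lim lmj.
    have [ltim dim] := Dlt _ _ Dim; have [ltmj dmj] := Dlt _ _ Dmj.
    case: (DA _ _ Dim) => [wim|Aim]; last first.
      rewrite BA ?Aim ?mul0r //.
      by rewrite xpair_eqE (negPf mj) andbF.
    case: (DA _ _ Dmj) => [wmj|Amj]; last first.
      by rewrite (BA _ m j) ?Amj ?mulr0 // xpair_eqE (negPf mi).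
    by case: nwij => t'; rewrite wim wmj.
  rewrite !sum2 Bij0 mul0r mulr0 addr0 add0r mulrC !Bd => /eqP.
  by rewrite -subr_eq0 -mulrBr mulf_eq0 subr_eq0 (negPf ws) orbF => /eqP.
exists B; split=> //; first by right.
move=> k l Dkl; have [[-> ->]|kl] := eqVneq (k, l) (i, j); first by right.
have [lkl dkl] := Dlt _ _ Dkl.
case: (DA _ _ Dkl) => [w|A0]; first by left; apply/wB.
by right=> t; rewrite BA.
Qed.

Lemma weight_splitP A : commuting A -> upper A ->
  exists B, [/\ similar_fam A B, upper B & forall k l : 'I_4, (k < l)%N -> weight_split B k l].
Proof.
move=> cA uA.
pose D (s : seq ('I_4 * 'I_4)) (k l : 'I_4) : Prop := (k, l) \in s.
pose good s := exists B, [/\ similar_fam A B, upper B & forall k l, D s k l -> weight_split B k l].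
have step s (i j : 'I_4) : (i < j)%N ->
    all (fun p : 'I_4 * 'I_4 => (p.1 < p.2)%N && (p.2 - p.1 <= j - i)%N) s ->
    (forall k : 'I_4, (i < k < j)%N -> D s i k /\ D s k j) ->
    good s -> good ((i, j) :: s).
  move=> lij /allP als Dij [B [AB uB sB]].
  have Dlt k l : D s k l -> (k < l)%N /\ (l - k <= j - i)%N by move=> /als /andP[].
  have [E [BE uE ijE sE]] := weight_split_step (similar_commuting AB cA) uB lij Dlt sB Dij.
  exists E; split=> //; first exact: similar_fam_trans BE.
  by move=> k l; rewrite /D in_cons => /predU1P[[-> ->]//|]; exact: sE.
(* Read from the right, the positions come by increasing distance to the diagonal, so that no step
   spoils an earlier one. *)
have [B [AB uB sB]] : good [:: (i0, i3); (i1, i3); (i0, i2); (i2, i3); (i1, i2); (i0, i1)].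
  do 6 (apply: (@step) => //; first by apply: ord4P).
  by exists A; split=> //; exact: similar_fam_refl.
exists B; split=> // k l; move: k l; do 2 apply: ord4P => //; move=> _; exact: sB.
Qed.
End Tform.

(** * Several weights: the algebras C, E1 and F0 to F3 *)

Section Split.
Variables (F : numFieldType) (T : Type) (A : T -> 'M[F]_4).
Hypotheses (cA : commuting A) (uA : upper A).
Hypothesis sA : forall k l : 'I_4, (k < l)%N -> weight_split A k l.

Lemma same_weightC k l : same_weight A k l -> same_weight A l k.
Proof. by move=> w t. Qed.

Lemma split0 t (k l : 'I_4) : k != l -> ~ same_weight A k l -> A t k l = 0.
Proof.
rewrite -val_eqE neq_ltn => /orP[lkl|llk] nw; last exact: uA.
by case: (sA lkl).
Qed.

Let reindex (s : seq 'I_4) (us : uniq s) (s4 : size s = 4) :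
  similar_fam A (fun t => \matrix_(i, j) A t (nth i0 s i) (nth i0 s j)).
Proof.
apply: (similar_perm (f := fun i : 'I_4 => nth i0 s i)) => i j /eqP.
by rewrite nth_uniq ?s4 // => /eqP /val_inj.
Qed.

Lemma lie_conj_E1 (p q r s : 'I_4) : uniq [:: p; q; r; s] -> (q < r)%N ->
  same_weight A q r -> ~ same_weight A p q -> ~ same_weight A p s -> ~ same_weight A q s ->
  lie_conj E1 A.
Proof.
move=> us lqr wqr npq nps nqs; have AB := reindex us erefl; set B := fun t => _ in AB.
have npr : ~ same_weight A p r by move=> w; apply: npq => t; rewrite w wqr.
have nrs : ~ same_weight A r s by move=> w; apply: nqs => t; rewrite -w wqr.
exists B => // t.
have /and4P[] := us; rewrite !inE !negb_or => /and3P[pq pr ps] /andP[qr qs] rs _.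
(* A quarter of the trace, since the matrices [liemx] are traceless. *)
pose d := (A t p p + 2 * A t q q + A t s s) / 4.
exists d, (A t p p - d), (A t q q - d), (A t q r).
have Z k l : k != l -> ~ same_weight A k l -> A t k l = 0 /\ A t l k = 0.
  move=> kl nw; split; apply: split0 => //; first by rewrite eq_sym.
  by move/same_weightC.
have [? ?] := Z _ _ pq npq; have [? ?] := Z _ _ pr npr; have [? ?] := Z _ _ ps nps.
have [? ?] := Z _ _ qs nqs; have [? ?] := Z _ _ rs nrs.
have ? := uA t lqr.
by apply: matrix4P; rewrite !mxE /= -?(wqr t) ?mulr1n ?mulr0n ?add0r ?addr0; split => //; rewrite /d; field.
Qed.

Lemma lie_conj_F0 (p q r s : 'I_4) : uniq [:: p; q; r; s] -> (p < q)%N -> (r < s)%N ->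
  same_weight A p q -> same_weight A r s -> ~ same_weight A p r -> lie_conj F0 A.
Proof.
move=> us lpq lrs wpq wrs npr; have AB := reindex us erefl; set B := fun t => _ in AB.
have nps : ~ same_weight A p s by move=> w; apply: npr => t; rewrite w wrs.
have nqr : ~ same_weight A q r by move=> w; apply: npr => t; rewrite wpq w.
have nqs : ~ same_weight A q s by move=> w; apply: npr => t; rewrite wpq w wrs.
exists B => // t.
have /and4P[] := us; rewrite !inE !negb_or => /and3P[pq pr ps] /andP[qr qs] rs _.
pose d := (A t p p + A t r r) / 2.
exists d, (A t p p - d), (A t p q), (A t r s).
have Z k l : k != l -> ~ same_weight A k l -> A t k l = 0 /\ A t l k = 0.
  move=> kl nw; split; apply: split0 => //; first by rewrite eq_sym.
  by move/same_weightC.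
have [? ?] := Z _ _ pr npr; have [? ?] := Z _ _ ps nps.
have [? ?] := Z _ _ qr nqr; have [? ?] := Z _ _ qs nqs.
have ? := uA t lpq; have ? := uA t lrs.
by apply: matrix4P; rewrite !mxE /= -?(wpq t) -?(wrs t) ?mulr1n ?mulr0n ?add0r ?addr0;
  split => //; rewrite /d; field.
Qed.

(** Commutation makes all the pairs [(A t p q, A t q r)] proportional. Their common direction
    decides: [F2] if the second coordinate vanishes, [F3] if the first does, and otherwise [F1]
    after a rescaling. *)
Lemma lie_conj_F123 (p q r s : 'I_4) : uniq [:: p; q; r; s] -> (p < q)%N -> (q < r)%N ->
  same_weight A p q -> same_weight A q r -> ~ same_weight A p s -> exists X, lie_conj X A.
Proof.
move=> us lpq lqr wpq wqr nps; have AB := reindex us erefl; set B := fun t => _ in AB.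
have nqs : ~ same_weight A q s by move=> w; apply: nps => t; rewrite wpq w.
have nrs : ~ same_weight A r s by move=> w; apply: nps => t; rewrite wpq wqr w.
have /and4P[] := us; rewrite !inE !negb_or => /and3P[pq pr ps] /andP[qr qs] rs _.
have Z k l : k != l -> ~ same_weight A k l -> forall t, A t k l = 0 /\ A t l k = 0.
  move=> kl nw t; split; apply: split0 => //; first by rewrite eq_sym.
  by move/same_weightC.
have Zps := Z _ _ ps nps; have Zqs := Z _ _ qs nqs; have Zrs := Z _ _ rs nrs.
have Zqp t := uA t lpq; have Zrq t := uA t lqr; have Zrp t := uA t (ltn_trans lpq lqr).
have BE t : B t = m4 [:: [:: A t p p; A t p q; A t p r; 0];
                         [:: 0; A t p p; A t q r; 0];
                         [:: 0; 0; A t p p; 0];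
                         [:: 0; 0; 0; A t s s]].
  by have [? ?] := Zps t; have [? ?] := Zqs t; have [? ?] := Zrs t;
    apply: matrix4P; rewrite !mxE /= -?(wqr t) -?(wpq t).
have cross t t' : A t p q * A t' q r = A t' p q * A t q r.
  have := similar_commuting AB cA t t'; rewrite !BE => /matrixP/(_ i0 i2).
  rewrite !mxE !big_ord4 !mxE /= !mulr0 !addr0 => E.
  have : A t p p * A t' p r + A t p q * A t' q r + A t p r * A t' p p -
    (A t' p p * A t p r + A t' p q * A t q r + A t' p r * A t p p) = 0 by rewrite E subrr.
  by move=> E'; apply/eqP; rewrite -subr_eq0 -E'; apply/eqP; ring.
have [|/existsNP[t0 nz]] := pselect (forall t, A t p q = 0 /\ A t q r = 0).
  move=> z; exists F2, B => // t; have [zp zq] := z t; rewrite BE zp zq.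
  pose d := (3 * A t p p + A t s s) / 4.
  exists d, (A t p p - d), 0, (A t p r).
  by rewrite /d; m4_calc.
have [q0|q0] := eqVneq (A t0 q r) 0.
  have p0 : A t0 p q != 0 by apply/eqP => p0; apply: nz.
  exists F2, B => // t; rewrite BE; pose d := (3 * A t p p + A t s s) / 4.
  exists d, (A t p p - d), (A t p q), (A t p r).
  have -> : A t q r = 0.
    have := cross t0 t; rewrite q0 mulr0 => /eqP.
    by rewrite mulf_eq0 (negPf p0) => /eqP.
  by rewrite /d; m4_calc.
have [p0|p0] := eqVneq (A t0 p q) 0.
  exists F3, B => // t; rewrite BE; pose d := (3 * A t p p + A t s s) / 4.
  exists d, (A t p p - d), (A t q r), (A t p r).
  have -> : A t p q = 0.
    have := cross t0 t; rewrite p0 mul0r => /esym/eqP.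
    by rewrite mulf_eq0 (negPf q0) orbF => /eqP.
  by rewrite /d; m4_calc.
(* Multiplying the first row by [k] makes the two superdiagonal entries of the block equal. *)
pose k := A t0 q r / A t0 p q.
have k0 : k != 0 by rewrite mulf_neq0 ?invr_eq0.
pose D := m4 [:: [:: k; 0; 0; 0]; [:: 0; 1; 0; 0]; [:: 0; 0; 1; 0]; [:: 0; 0; 0; 1]] : 'M[F]_4.
pose E := m4 [:: [:: k^-1; 0; 0; 0]; [:: 0; 1; 0; 0]; [:: 0; 0; 1; 0]; [:: 0; 0; 0; 1]] : 'M[F]_4.
have ED : E *m D = 1%:M.
  by rewrite /E /D; m4_calc.
exists F1, (fun t => D *m B t *m E); first by apply: similar_fam_trans AB _; apply: similar_conj.
move=> t; rewrite BE; pose d := (3 * A t p p + A t s s) / 4.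
exists d, (A t p p - d), (A t q r), (k * A t p r).
have kE : k * A t p q = A t q r by rewrite /k mulrAC mulrC (mulrC (A t0 q r)) -cross mulrA mulVf ?mul1r.
by rewrite /d -kE /D /E; m4_calc.
Qed.

Lemma lie_conj_C : (forall k l : 'I_4, (k < l)%N -> ~ same_weight A k l) -> lie_conj C A.
Proof.
move=> nw; exists A; first exact: similar_fam_refl.
move=> t; have Z (k l : 'I_4) : k != l -> A t k l = 0.
  move=> kl; apply: split0 => //; move: kl; rewrite -val_eqE neq_ltn => /orP[/nw//|/nw n w].
  by apply: n; apply: same_weightC.
pose d := (A t i0 i0 + A t i1 i1 + A t i2 i2 + A t i3 i3) / 4.
exists d, (A t i0 i0 - d), (A t i1 i1 - d), (A t i2 i2 - d).
by apply: matrix4P; rewrite !mxE /= ?mulr1n ?mulr0n ?add0r ?addr0;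
  split; (try by apply: Z); rewrite /d; field.
Qed.

(** The partition of the four indices by weight has type 3+1 ([F1], [F2], [F3]), 2+2 ([F0]), 2+1+1
    ([E1]) or 1+1+1+1 ([C]). *)
Lemma lie_conj_split : ~ (forall k l, same_weight A k l) -> exists X, lie_conj X A.
Proof.
move=> nw; pose w := same_weight A.
have symN k l : ~ w k l -> ~ w l k by move=> n /same_weightC.
have wtr k l m : w k l -> w k m -> w l m by move=> a b t; rewrite -a b.
have [w01|n01] := pselect (w i0 i1).
  have [w02|n02] := pselect (w i0 i2).
    apply: (@lie_conj_F123 i0 i1 i2 i3) => //; first exact: wtr w01 w02.
    move=> w03; apply: nw; suff w0 : forall k, w i0 k by move=> k l; apply: wtr (w0 k) (w0 l).
    by apply: ord4P.
  have [w03|n03] := pselect (w i0 i3).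
    by apply: (@lie_conj_F123 i0 i1 i3 i2) => //; exact: wtr w01 w03.
  have [w23|n23] := pselect (w i2 i3); first by exists F0; apply: (@lie_conj_F0 i0 i1 i2 i3).
  by exists E1; apply: (@lie_conj_E1 i2 i0 i1 i3) => //; exact: symN.
have [w02|n02] := pselect (w i0 i2).
  have [w03|n03] := pselect (w i0 i3).
    by apply: (@lie_conj_F123 i0 i2 i3 i1) => //; exact: wtr w02 w03.
  have [w13|n13] := pselect (w i1 i3); first by exists F0; apply: (@lie_conj_F0 i0 i2 i1 i3).
  by exists E1; apply: (@lie_conj_E1 i1 i0 i2 i3) => //; exact: symN.
have [w03|n03] := pselect (w i0 i3).
  have [w12|n12] := pselect (w i1 i2); first by exists F0; apply: (@lie_conj_F0 i0 i3 i1 i2).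
  by exists E1; apply: (@lie_conj_E1 i1 i0 i3 i2) => //; exact: symN.
have [w12|n12] := pselect (w i1 i2).
  have [w13|n13] := pselect (w i1 i3).
    by apply: (@lie_conj_F123 i1 i2 i3 i0) => //; [exact: wtr w12 w13|exact: symN].
  by exists E1; apply: (@lie_conj_E1 i0 i1 i2 i3).
have [w13|n13] := pselect (w i1 i3); first by exists E1; apply: (@lie_conj_E1 i0 i1 i3 i2).
have [w23|n23] := pselect (w i2 i3).
  by exists E1; apply: (@lie_conj_E1 i0 i2 i3 i1) => //; exact: symN.
by exists C; apply: lie_conj_C; do 2 apply: ord4P.
Qed.
End Split.

(** * A single weight: explicit conjugations to N1 up to N8 *)

Definition ut (R : pzRingType) (d a b c e f g : R) : 'M[R]_4 :=
  m4 [:: [:: d; a; b; c]; [:: 0; d; e; f]; [:: 0; 0; d; g]; [:: 0; 0; 0; d]].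

(** The scalar diagonals drop out; what remains are the entries (0, 2), (1, 3) and (0, 3) of the
    commutator of the strictly upper parts. *)
Lemma ut_comm (F : comPzRingType) (d a b c e f g d' a' b' c' e' f' g' : F) :
  ut d a b c e f g *m ut d' a' b' c' e' f' g' =
  ut d' a' b' c' e' f' g' *m ut d a b c e f g ->
  [/\ a * e' = a' * e, e * g' = e' * g & a * f' + b * g' = a' * f + b' * g].
Proof.
have cancel (x y u v w z : F) : x * u + y + v * z = z * v + w + u * x -> y = w.
  move=> E; have : x * u + y + v * z - (x * u + v * z) = z * v + w + u * x - (x * u + v * z).
    by rewrite E.
  by rewrite (_ : _ - _ = y); [move=> ->|]; ring.
move=> /matrixP E; split.
- move: (E i0 i2); rewrite !mxE !big_ord4 !mxE /= !mulr0 !addr0; exact: cancel.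
- move: (E i1 i3); rewrite !mxE !big_ord4 !mxE /= !mul0r !add0r; exact: cancel.
- by move: (E i0 i3); rewrite !mxE !big_ord4 !mxE /= -[X in X + _ = _]addrA -[X in _ = X + _]addrA; exact: cancel.
Qed.

Lemma lie_leaf (F : numFieldType) (T : Type) (A : T -> 'M[F]_4) X (P Q : 'M[F]_4)
    (d x y z : T -> F) :
  Q *m P = 1%:M -> (forall t, P *m A t = ((d t)%:M + liemx X (x t) (y t) (z t)) *m P) ->
  exists Y, lie_conj Y A.
Proof.
move=> QP PA; exists X, (fun t => (d t)%:M + liemx X (x t) (y t) (z t)).
  by exists P => //; case: (mulmx1_unit QP).
by move=> t; exists (d t), (x t), (y t), (z t).
Qed.

Section Block.
Variables (R : realType) (T : Type) (d b c e f : T -> R).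
Let A t := ut (d t) 0 (b t) (c t) (e t) (f t) 0.

(** [P] multiplies the upper right block on the left by an invertible matrix made from the
    coefficients of the relation. The relation then says that the entries (0, 2) and (1, 3) of the
    new block agree, as in [N5]. *)
Lemma lie_conj_N5 (l13 l14 l23 l24 : R) : l13 * l24 - l14 * l23 != 0 ->
  (forall t, l13 * b t + l14 * c t + l23 * e t + l24 * f t = 0) -> exists X, lie_conj X A.
Proof.
move=> nz rel; pose P : 'M[R]_4 := m4 [:: [:: l13; l23; 0; 0]; [:: - l14; - l24; 0; 0]; [:: 0; 0; 1; 0]; [:: 0; 0; 0; 1]].
pose Q : 'M[R]_4 := m4 [:: [:: l24 / (l13 * l24 - l14 * l23); l23 / (l13 * l24 - l14 * l23); 0; 0];
  [:: - l14 / (l13 * l24 - l14 * l23); - l13 / (l13 * l24 - l14 * l23); 0; 0];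
  [:: 0; 0; 1; 0]; [:: 0; 0; 0; 1]].
apply: (@lie_leaf _ _ _ N5 P Q d (fun t => - (l14 * b t + l24 * e t))
  (fun t => - (l14 * c t + l24 * f t)) (fun t => l13 * c t + l23 * f t)).
  by rewrite /P /Q; m4_calc.
move=> t; have E : l13 * b t + l23 * e t = - (l14 * c t + l24 * f t).
  by apply/eqP; rewrite -addr_eq0 -(rel t); apply/eqP; ring.
rewrite /P /A /ut; m4_calc.
by rewrite E; ring.
Qed.

(** The relation reads u B v = 0 for the upper right block B. In a basis adapted to u on the left
    and to v and its orthogonal on the right it kills one entry of B; the pair g is any complement
    of u. Interleaving the two bases gives the shape of [N6]. *)
Lemma lie_conj_N6 (g1 g2 u1 u2 v1 v2 : R) : g1 * u2 - g2 * u1 != 0 ->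
  v1 ^+ 2 + v2 ^+ 2 != 0 ->
  (forall t, u1 * v1 * b t + u1 * v2 * c t + u2 * v1 * e t + u2 * v2 * f t = 0) ->
  exists X, lie_conj X A.
Proof.
move=> nD nn rel; pose P : 'M[R]_4 := m4 [:: [:: g1; g2; 0; 0]; [:: 0; 0; v1; v2]; [:: u1; u2; 0; 0]; [:: 0; 0; - v2; v1]].
pose Q : 'M[R]_4 := m4 [:: [:: u2 / (g1 * u2 - g2 * u1); 0; - g2 / (g1 * u2 - g2 * u1); 0];
  [:: - u1 / (g1 * u2 - g2 * u1); 0; g1 / (g1 * u2 - g2 * u1); 0];
  [:: 0; v1 / (v1 ^+ 2 + v2 ^+ 2); 0; - v2 / (v1 ^+ 2 + v2 ^+ 2)]; [:: 0; v2 / (v1 ^+ 2 + v2 ^+ 2); 0; v1 / (v1 ^+ 2 + v2 ^+ 2)]].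
pose x t := ((g1 * b t + g2 * e t) * v1 + (g1 * c t + g2 * f t) * v2) / (v1 ^+ 2 + v2 ^+ 2).
pose z t := (- (g1 * b t + g2 * e t) * v2 + (g1 * c t + g2 * f t) * v1) / (v1 ^+ 2 + v2 ^+ 2).
pose y t := (- (u1 * b t + u2 * e t) * v2 + (u1 * c t + u2 * f t) * v1) / (v1 ^+ 2 + v2 ^+ 2).
apply: (@lie_leaf _ _ _ N6 P Q d x y z).
  by rewrite /P /Q; m4_calc.
move=> t; have E : (u1 * b t + u2 * e t) * v1 = - (u1 * c t + u2 * f t) * v2.
  by apply/eqP; rewrite -subr_eq0 -(rel t); apply/eqP; ring.
have EU : u1 * b t + u2 * e t = - y t * v2.
  rewrite /y; set U := _ + u2 * e t in E *; set W := u1 * c t + _ in E *.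
  apply: (@eq_trans _ _ ((U * v2 ^+ 2 + - W * v2 * v1) / (v1 ^+ 2 + v2 ^+ 2))).
    by rewrite -E; field.
  by field.
have EW : u1 * c t + u2 * f t = y t * v1.
  rewrite /y; set U := _ + u2 * e t in E *; set W := u1 * c t + _ in E *.
  apply: (@eq_trans _ _ ((W * v1 ^+ 2 - U * v1 * v2) / (v1 ^+ 2 + v2 ^+ 2))).
    by rewrite E; field.
  by field.
rewrite /P /A /ut; m4_calc.
- by rewrite /x /z; field.
- by rewrite /x /z; field.
- by rewrite EU; ring.
- by rewrite EW; ring.
Qed.

End Block.

Section Chain.
Variables (F : numFieldType) (T : Type) (d a b c e f g : T -> F).
Let A t := ut (d t) (a t) (b t) (c t) (e t) (f t) (g t).

Lemma lie_conj_N1 (p q k : F) : p != 0 -> q != 0 ->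
  (forall t, [/\ a t = p * e t, g t = q * e t & p * f t = q * (b t + p * k * e t)]) ->
  exists X, lie_conj X A.
Proof.
move=> p0 q0 rel.
(* The diagonal makes the three superdiagonal entries equal to [e], and the shear [k] makes the
   entries (0, 2) and (1, 3) agree. *)
pose P : 'M[F]_4 := m4 [:: [:: p^-1; k; 0; 0]; [:: 0; 1; 0; 0]; [:: 0; 0; 1; 0]; [:: 0; 0; 0; q]].
pose Q : 'M[F]_4 := m4 [:: [:: p; - p * k; 0; 0]; [:: 0; 1; 0; 0]; [:: 0; 0; 1; 0]; [:: 0; 0; 0; q^-1]].
apply: (@lie_leaf _ _ _ N1 P Q d e (fun t => f t / q) (fun t => (c t / p + k * f t) / q)).
  by rewrite /P /Q; m4_calc.
move=> t; rewrite /A; have [-> -> rf] := rel t.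
have -> : b t = p * f t / q - p * k * e t by rewrite rf; field.
by rewrite /P /ut; m4_calc; field; rewrite ?p0 ?q0.
Qed.

Lemma lie_conj_N2 (p k : F) : p != 0 ->
  (forall t, [/\ a t = p * e t, g t = 0 & f t = k * e t]) -> exists X, lie_conj X A.
Proof.
move=> p0 rel.
pose P : 'M[F]_4 := m4 [:: [:: p^-1; 0; 0; 0]; [:: 0; 1; 0; 0]; [:: 0; 0; 1; k]; [:: 0; 0; 0; 1]].
pose Q : 'M[F]_4 := m4 [:: [:: p; 0; 0; 0]; [:: 0; 1; 0; 0]; [:: 0; 0; 1; - k]; [:: 0; 0; 0; 1]].
apply: (@lie_leaf _ _ _ N2 P Q d e (fun t => b t / p) (fun t => (c t - k * b t) / p)).
  by rewrite /P /Q; m4_calc.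
by move=> t; rewrite /A; have [-> -> ->] := rel t; rewrite /P /ut; m4_calc.
Qed.

Lemma lie_conj_N3 (q k : F) : q != 0 ->
  (forall t, [/\ a t = 0, g t = q * e t & b t = k * e t]) -> exists X, lie_conj X A.
Proof.
move=> q0 rel.
pose P : 'M[F]_4 := m4 [:: [:: 1; - k; 0; 0]; [:: 0; 1; 0; 0]; [:: 0; 0; 1; 0]; [:: 0; 0; 0; q]].
pose Q : 'M[F]_4 := m4 [:: [:: 1; k; 0; 0]; [:: 0; 1; 0; 0]; [:: 0; 0; 1; 0]; [:: 0; 0; 0; q^-1]].
apply: (@lie_leaf _ _ _ N3 P Q d e (fun t => f t / q) (fun t => (c t - k * f t) / q)).
  by rewrite /P /Q; m4_calc.
by move=> t; rewrite /A; have [-> -> ->] := rel t; rewrite /P /ut; m4_calc.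
Qed.

Hypothesis cA : commuting A.

(** Commuting with the member at [t0] forces [a = p * e] and [g = q * e], together with one relation
    between [b], [e] and [f]. Then [N1] arises for p and q nonzero, [N2] for q = 0, [N3] for p = 0;
    if both vanish, only the upper right block is left. *)
Lemma lie_conj_chain t0 : e t0 != 0 ->
  (exists X, lie_conj X A) \/ (forall t, a t = 0 /\ g t = 0).
Proof.
move=> e0; pose p := a t0 / e t0; pose q := g t0 / e t0.
have aE t : a t = p * e t.
  have [E _ _] := ut_comm (cA t t0).
  by apply: (mulIf e0); rewrite E /p; field.
have gE t : g t = q * e t.
  have [_ E _] := ut_comm (cA t t0).
  by apply: (mulfI e0); rewrite -E /q; field.
have fE t : p * (f t - f t0 / e t0 * e t) = q * (b t - b t0 / e t0 * e t).
  have [_ _ E] := ut_comm (cA t t0).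
  apply: (mulfI e0); apply/eqP; rewrite -subr_eq0; apply/eqP.
  move: E; rewrite !aE !gE => E.
  rewrite (_ : _ - _ = p * e t0 * f t + b t0 * (q * e t) - (p * e t * f t0 + b t * (q * e t0))).
    by rewrite E subrr.
  by field.
have [p0|p0] := eqVneq p 0; last first.
  left; have [q0|q0] := eqVneq q 0.
    apply: (@lie_conj_N2 p (f t0 / e t0) p0) => t; split; rewrite ?gE ?q0 ?mul0r //.
    apply/eqP; rewrite -subr_eq0; apply/eqP/(mulfI p0).
    by rewrite fE q0 mul0r mulr0.
  (* This shear absorbs the multiples of [e] on both sides of [fE]. *)
  apply: (@lie_conj_N1 p q (f t0 / e t0 / q - b t0 / e t0 / p)) => // t; split => //.
  have := fE t; rewrite mulrBr => /eqP; rewrite subr_eq => /eqP ->.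
  by field; rewrite ?p0 ?q0 ?e0.
have [q0|q0] := eqVneq q 0.
  by right => t; rewrite aE gE p0 q0 !mul0r.
left; apply: (@lie_conj_N3 q (b t0 / e t0) q0) => t; split; rewrite ?aE ?p0 ?mul0r //.
apply/eqP; rewrite -subr_eq0; apply/eqP/(mulfI q0).
by rewrite -fE p0 mul0r mulr0.
Qed.

End Chain.

Section Heisenberg.
Variables (R : realType) (T : Type).
Implicit Types (d a b c f g : T -> R).

(** The quadratic form is r a^2 + s b^2, and rescaling the last basis vector multiplies it by a
    constant, so only the sign of r / s matters. The degenerate form gives [N2] and the definite one
    [N4']; the indefinite one is a product in the coordinates a + b / p and a - b / p, which gives
    [N4]. *)
Lemma lie_conj_sum_squares d a b c f g (r s : R) : r != 0 ->
  (forall t, f t = r * a t /\ g t = s * b t) ->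
  exists X, lie_conj X (fun t => ut (d t) (a t) (b t) (c t) 0 (f t) (g t)).
Proof.
move=> r0 rel; have [s0|s0] := eqVneq s 0.
  pose P : 'M[R]_4 := m4 [:: [:: 1; 0; 0; 0]; [:: 0; 1; 0; 0]; [:: 0; 0; 0; r]; [:: 0; 0; 1; 0]].
  pose Q : 'M[R]_4 := m4 [:: [:: 1; 0; 0; 0]; [:: 0; 1; 0; 0]; [:: 0; 0; 0; 1]; [:: 0; 0; r^-1; 0]].
  apply: (@lie_leaf _ _ _ N2 P Q d a (fun t => c t / r) b).
    by rewrite /P /Q; m4_calc.
  by move=> t; have [-> ->] := rel t; rewrite s0; rewrite /P /ut; m4_calc.
have [rs|rs] := ltP 0 (r / s).
  pose p := Num.sqrt (r / s); have p2 : p ^+ 2 = r / s by rewrite sqr_sqrtr ?ltW.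
  have p0 : p != 0 by rewrite gt_eqF // sqrtr_gt0.
  pose P : 'M[R]_4 := m4 [:: [:: 1; 0; 0; 0]; [:: 0; 1; 0; 0]; [:: 0; 0; p; 0]; [:: 0; 0; 0; r]].
  pose Q : 'M[R]_4 := m4 [:: [:: 1; 0; 0; 0]; [:: 0; 1; 0; 0]; [:: 0; 0; p^-1; 0]; [:: 0; 0; 0; r^-1]].
  apply: (@lie_leaf _ _ _ N4' P Q d a (fun t => b t / p) (fun t => c t / r)).
    by rewrite /P /Q; m4_calc.
  move=> t; have [-> ->] := rel t.
  have E : p * (s * b t) = b t / p * r.
    by apply: (mulIf p0); rewrite mulrC mulrA -expr2 p2; field; rewrite p0 s0.
  by rewrite /P /ut; m4_calc; rewrite ?E ?mulrDr; ring.
have rs' : 0 < - (r / s) by rewrite oppr_gt0 lt_neqAle rs andbT mulf_neq0 ?invr_eq0.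
pose p := Num.sqrt (- (r / s)); have p2 : p ^+ 2 = - (r / s) by rewrite sqr_sqrtr ?ltW.
have p0 : p != 0 by rewrite gt_eqF // sqrtr_gt0.
pose P : 'M[R]_4 := m4 [:: [:: 1; 0; 0; 0]; [:: 0; 1; p; 0]; [:: 0; 1; - p; 0]; [:: 0; 0; 0; 2 * r]].
pose Q : 'M[R]_4 := m4 [:: [:: 1; 0; 0; 0]; [:: 0; 1 / 2; 1 / 2; 0];
  [:: 0; p^-1 / 2; - p^-1 / 2; 0]; [:: 0; 0; 0; r^-1 / 2]].
apply: (@lie_leaf _ _ _ N4 P Q d (fun t => (a t + b t / p) / 2) (fun t => (a t - b t / p) / 2)
  (fun t => c t / r / 2)).
  by rewrite /P /Q; m4_calc.
move=> t; have [-> ->] := rel t.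
have E : p * (s * b t) = - (b t / p * r).
  by apply: (mulIf p0); rewrite mulrC mulrA -expr2 p2; field; rewrite p0 s0.
by rewrite /P /ut; m4_calc; rewrite ?mulNr ?E; field; rewrite ?p0 ?r0.
Qed.

(* The commuting condition makes the map (a, b) |-> (f, g) symmetric; its
   congruence class (a real quadratic form) decides between [N2], [N4], [N4']
   and [N8]. *)
Lemma lie_conj_sym d a b c f g (r s u : R) :
  (forall t, f t = r * a t + s * b t /\ g t = s * a t + u * b t) ->
  exists X, lie_conj X (fun t => ut (d t) (a t) (b t) (c t) 0 (f t) (g t)).
Proof.
(* Exchanging the two middle basis vectors exchanges [r] and [u]. *)
wlog ru : a b f g r s u / (r != 0) || (u == 0) => [wl rel|].
  have [u0|u0] := eqVneq u 0; first by apply: (wl a b f g r s u) => //; rewrite u0 eqxx orbT.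
  have [|t|X lX] := wl b a g f u s r; first by rewrite u0.
    by have [-> ->] := rel t; split; ring.
  exists X; apply: similar_lie lX.
  pose P : 'M[R]_4 := m4 [:: [:: 1; 0; 0; 0]; [:: 0; 0; 1; 0]; [:: 0; 1; 0; 0]; [:: 0; 0; 0; 1]].
  exists P; first by have /mulmx1_unit[] : P *m P = 1%:M by rewrite /P; m4_calc.
  by move=> t; rewrite /P /ut; m4_calc.
move=> rel; have [rn|rn] := eqVneq r 0; last first.
  (* Completing the square. *)
  pose k := s / r.
  pose P : 'M[R]_4 := m4 [:: [:: 1; 0; 0; 0]; [:: 0; 1; 0; 0]; [:: 0; - k; 1; 0]; [:: 0; 0; 0; 1]].
  pose Q : 'M[R]_4 := m4 [:: [:: 1; 0; 0; 0]; [:: 0; 1; 0; 0]; [:: 0; k; 1; 0]; [:: 0; 0; 0; 1]].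
  have [t|X lX] := @lie_conj_sum_squares d (fun t => a t + k * b t) b c f
      (fun t => g t - k * f t) r (u - s ^+ 2 / r) rn.
    by have [-> ->] := rel t; rewrite /k; split; field.
  exists X; apply: similar_lie lX.
  exists P; first by have /mulmx1_unit[] : P *m Q = 1%:M by rewrite /P /Q; m4_calc.
  by move=> t; rewrite /P /ut; m4_calc.
move: ru; rewrite rn eqxx /= => /eqP u0.
have {}rel t : f t = s * b t /\ g t = s * a t by have [-> ->] := rel t; rewrite rn u0; split; ring.
have [s0|s0] := eqVneq s 0.
  apply: (@lie_leaf _ _ _ N8 1%:M 1%:M d a b c); first by rewrite mulmx1.
  by move=> t; have [-> ->] := rel t; rewrite s0 mul1mx mulmx1; apply: matrix4P;
    rewrite !mxE /= ?mulr1n ?mulr0n ?(mul0r, add0r, addr0).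
pose P : 'M[R]_4 := m4 [:: [:: 1; 0; 0; 0]; [:: 0; 1; 0; 0]; [:: 0; 0; 1; 0]; [:: 0; 0; 0; s]].
pose Q : 'M[R]_4 := m4 [:: [:: 1; 0; 0; 0]; [:: 0; 1; 0; 0]; [:: 0; 0; 1; 0]; [:: 0; 0; 0; s^-1]].
apply: (@lie_leaf _ _ _ N4 P Q d a b (fun t => c t / s)).
  by rewrite /P /Q; m4_calc.
by move=> t; have [-> ->] := rel t; rewrite /P /ut; m4_calc.
Qed.

Variables (d a b c f g : T -> R).
Let A t := ut (d t) (a t) (b t) (c t) 0 (f t) (g t).
Hypothesis cA : commuting A.

Let cross s t : a s * f t + b s * g t = a t * f s + b t * g s.
Proof. by have [_ _] := ut_comm (cA s t). Qed.

(** By [cross], the vectors (a, b, f, g) span an isotropic subspace for a symplectic form on R^4. If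
    its projection to (a, b) has rank 2, it is the graph of a symmetric map; rank 0 is [N7]; rank 1
    gives [N6] or [N3]. *)
Lemma lie_conj_Heisenberg : exists X, lie_conj X A.
Proof.
have [/existsNP[t1 /existsNP[t2 /eqP D0]]|rk1] := pselect (~ forall s t, a s * b t - a t * b s = 0).
  set D := a t1 * b t2 - a t2 * b t1 in D0.
  (* Cramer's rule at [t1] and [t2]; [E12'] below is the symmetry of the resulting map. *)
  apply: (@lie_conj_sym d a b c f g ((b t2 * f t1 - b t1 * f t2) / D)
    ((a t1 * f t2 - a t2 * f t1) / D) ((a t1 * g t2 - a t2 * g t1) / D)) => t.
  have E1 := cross t1 t; have E2 := cross t2 t; have E12 := cross t1 t2.
  have E12' : a t1 * f t2 - a t2 * f t1 = b t2 * g t1 - b t1 * g t2.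
    apply/eqP; rewrite -subr_eq0; apply/eqP.
    apply: (@eq_trans _ _ (a t1 * f t2 + b t1 * g t2 - (a t2 * f t1 + b t2 * g t1))).
      by ring.
    by rewrite E12 subrr.
  split; apply: (mulIf D0).
    rewrite {1}E12'; apply: (@eq_trans _ _ (b t2 * (a t1 * f t + b t1 * g t) - b t1 * (a t2 * f t + b t2 * g t))).
      by rewrite /D; ring.
    by rewrite E1 E2; field.
  apply: (@eq_trans _ _ (a t1 * (a t2 * f t + b t2 * g t) - a t2 * (a t1 * f t + b t1 * g t))).
    by rewrite /D; ring.
  by rewrite E1 E2; field.
have {}rk1 s t : a s * b t = a t * b s by apply/eqP; rewrite -subr_eq0; move/contrapT: rk1 => ->.
have [/existsNP[t0 n0]|z] := pselect (~ forall t, a t = 0 /\ b t = 0); last first.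
  move/contrapT: z => z.
  apply: (@lie_leaf _ _ _ N7 1%:M 1%:M d g f c); first by rewrite mulmx1.
  by move=> t; rewrite /A; have [-> ->] := z t; rewrite mul1mx mulmx1; apply: matrix4P;
    rewrite !mxE /= ?mulr1n ?mulr0n ?(mul0r, add0r, addr0).
pose a0 := a t0; pose b0 := b t0; pose n := a0 ^+ 2 + b0 ^+ 2.
have nn : a0 ^+ 2 + b0 ^+ 2 != 0.
  apply/eqP => /eqP; rewrite paddr_eq0 ?sqr_ge0 // !sqrf_eq0 => /andP[/eqP ? /eqP ?].
  exact: n0.
pose l t := (a0 * a t + b0 * b t) / (a0 ^+ 2 + b0 ^+ 2).
have rk0 t : a t * b0 = a0 * b t by exact: rk1.
have aE t : a t = l t * a0.
  apply: (@eq_trans _ _ ((a0 ^+ 2 * a t + b0 * (a t * b0)) / (a0 ^+ 2 + b0 ^+ 2))).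
    by field.
  by rewrite rk0 /l; field.
have bE t : b t = l t * b0.
  apply: (@eq_trans _ _ ((a0 * (a0 * b t) + b0 ^+ 2 * b t) / (a0 ^+ 2 + b0 ^+ 2))).
    by field.
  by rewrite -rk0 /l; field.
(* The corner entry of the square of the strictly upper part at [t0]: if it is zero the family goes
   to [N6], otherwise to [N3]. *)
pose s := a0 * f t0 + b0 * g t0.
have fE t : a0 * f t + b0 * g t = s * l t.
  have := cross t0 t; rewrite -/a0 -/b0 => ->; rewrite aE bE /s; ring.
pose h t := - b0 * f t + a0 * g t.
have ffE t : f t = (a0 * (s * l t) - b0 * h t) / (a0 ^+ 2 + b0 ^+ 2) by rewrite -fE /h; field.
have ggE t : g t = (b0 * (s * l t) + a0 * h t) / (a0 ^+ 2 + b0 ^+ 2) by rewrite -fE /h; field.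
have [s0|s0] := eqVneq s 0.
  pose P : 'M[R]_4 := m4 [:: [:: 1; 0; 0; 0]; [:: 0; a0; b0; 0]; [:: 0; - b0; a0; 0]; [:: 0; 0; 0; 1]].
  pose Q : 'M[R]_4 := m4 [:: [:: 1; 0; 0; 0]; [:: 0; a0 / (a0 ^+ 2 + b0 ^+ 2); - b0 / (a0 ^+ 2 + b0 ^+ 2); 0];
     [:: 0; b0 / (a0 ^+ 2 + b0 ^+ 2); a0 / (a0 ^+ 2 + b0 ^+ 2); 0]; [:: 0; 0; 0; 1]].
  apply: (@lie_leaf _ _ _ N6 P Q d l h c).
    by rewrite /P /Q; m4_calc.
  move=> t; rewrite /A aE bE ffE ggE s0; by rewrite /P /ut; m4_calc.
pose P : 'M[R]_4 := m4 [:: [:: 0; - b0; a0; 0]; [:: 1; 0; 0; 0]; [:: 0; a0; b0; 0]; [:: 0; 0; 0; s]].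
pose Q : 'M[R]_4 := m4 [:: [:: 0; 1; 0; 0]; [:: - b0 / (a0 ^+ 2 + b0 ^+ 2); 0; a0 / (a0 ^+ 2 + b0 ^+ 2); 0];
   [:: a0 / (a0 ^+ 2 + b0 ^+ 2); 0; b0 / (a0 ^+ 2 + b0 ^+ 2); 0]; [:: 0; 0; 0; s^-1]].
apply: (@lie_leaf _ _ _ N3 P Q d l (fun t => c t / s) (fun t => h t / s)).
  by rewrite /P /Q; m4_calc.
by move=> t; rewrite /A aE bE ffE ggE; rewrite /P /ut; m4_calc; rewrite ?s0 ?nn.
Qed.

End Heisenberg.

Lemma linear_rV_eq0 (R : pzRingType) n (V : lmodType R) (h : 'rV[R]_n -> V) :
  (forall k u v, h (k *: u + v) = k *: h u + h v) -> (forall j, h (delta_mx 0 j) = 0) ->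
  forall u, h u = 0.
Proof.
move=> hl hd u; have h0 : h 0 = 0.
  have := hl 1 0 0; rewrite !scale1r addr0 => /(congr1 (fun x => x - h 0)).
  by rewrite subrr addrK.
rewrite [u]row_sum_delta; elim/big_rec: _ => [|j x _ hx]; first exact: h0.
by rewrite hl hd hx scaler0 addr0.
Qed.

Section Triangular.
Variable R : realType.
Implicit Types (A B : 'rV[R]_3 -> 'M[R]_4).

Definition linear_fam A := forall k u v, A (k *: u + v) = k *: A u + A v.

Lemma similar_linear A B : similar_fam A B -> linear_fam A -> linear_fam B.
Proof.
move=> [P Pu PA] lA k u v.
have E t : B t = P *m A t *m invmx P by rewrite PA mulmxK.
by rewrite !E lA mulmxDr mulmxDl -scalemxAr -scalemxAl.
Qed.

(** The entry (1, 2) separates the Heisenberg case from the chain case. The dimension 3 of the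
    parameter space is used only when the upper right block alone remains, since all matrices of
    that shape form a commuting family of dimension 4. *)
Lemma lie_conj_local A : linear_fam A -> commuting A -> upper A ->
  (forall k l, same_weight A k l) -> exists X, lie_conj X A.
Proof.
move=> lA cA uA wA.
have AE : A = fun t => ut (A t i0 i0) (A t i0 i1) (A t i0 i2) (A t i0 i3)
    (A t i1 i2) (A t i1 i3) (A t i2 i3).
  by apply: funext => t; apply: matrix4P; rewrite !mxE /= ?(wA i1 i0) ?(wA i2 i0) ?(wA i3 i0);
    split => //; apply: uA.
have [/existsNP[t0 /eqP e0]|] := pselect (~ forall t, A t i1 i2 = 0); last first.
  move/contrapT => e0; move: (cA); rewrite AE.
  rewrite (_ : (fun t => _) = fun t => ut (A t i0 i0) (A t i0 i1) (A t i0 i2) (A t i0 i3)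
    0 (A t i1 i3) (A t i2 i3)); last by apply: funext => t; rewrite e0.
  exact: lie_conj_Heisenberg.
move: (cA); rewrite AE => cA'.
have [//|ag0] := lie_conj_chain cA' e0.
rewrite (_ : (fun t => _) = fun t => ut (A t i0 i0) 0 (A t i0 i2) (A t i0 i3)
    (A t i1 i2) (A t i1 i3) 0); last by apply: funext => t; have [-> ->] := ag0 t.
(* The four entries of the off-diagonal block are functionals on a space of
   dimension 3, hence satisfy a linear relation [l]; as a 2 x 2 matrix, [l] has
   rank 2 for [N5] and rank 1 for [N6]. *)
pose phi (t : 'rV[R]_3) : 'rV[R]_4 := \row_k
  [:: A t i0 i2; A t i0 i3; A t i1 i2; A t i1 i3]`_k.
pose M : 'M[R]_(4, 3) := \matrix_(k, j) phi (delta_mx 0 j) 0 k.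
have [l l0 lM] : exists2 l : 'rV[R]_4, l != 0 & l *m M = 0.
  have : kermx M != 0.
    by rewrite -mxrank_eq0 mxrank_ker subn_eq0 -ltnNge (leq_ltn_trans (rank_leq_col M)).
  move=> /rowV0Pn[l /sub_kermxP lM l0]; by exists l.
have rel t : l 0 i0 * A t i0 i2 + l 0 i1 * A t i0 i3 + l 0 i2 * A t i1 i2 + l 0 i3 * A t i1 i3 = 0.
  move: t; apply: (@linear_rV_eq0 R 3 R^o).
    by move=> k u v; rewrite !lA !mxE /GRing.scale /=; ring.
  by move=> j; move/rowP/(_ j): lM; rewrite !mxE big_ord4 !mxE.
set b := fun t => A t i0 i2; set c := fun t => A t i0 i3; set e := fun t => A t i1 i2.
set f := fun t => A t i1 i3; set d := fun t => A t i0 i0.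
have [D0|D0] := eqVneq (l 0 i0 * l 0 i3 - l 0 i1 * l 0 i2) 0; last first.
  exact: (@lie_conj_N5 R _ d b c e f _ _ _ _ D0).
have [/andP[/eqP l00 /eqP l10]|l01] := boolP ((l 0 i0 == 0) && (l 0 i1 == 0)).
  apply: (@lie_conj_N6 R _ d b c e f 1 0 0 1 (l 0 i2) (l 0 i3)).
  - by rewrite mulr1 mul0r subr0 oner_eq0.
  - rewrite paddr_eq0 ?sqr_ge0 // !sqrf_eq0; apply: contraNN l0 => /andP[/eqP ? /eqP ?].
    by apply/eqP/rowP; apply: ord4P; rewrite !mxE.
  - by move=> t; have := rel t; rewrite l00 l10 !mul0r !mul1r.
have nn : l 0 i0 ^+ 2 + l 0 i1 ^+ 2 != 0 by rewrite paddr_eq0 ?sqr_ge0 // !sqrf_eq0.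
(* The relation has rank 1, so its second row is [k] times its first, with [k] given by orthogonal
   projection. *)
pose k := (l 0 i0 * l 0 i2 + l 0 i1 * l 0 i3) / (l 0 i0 ^+ 2 + l 0 i1 ^+ 2).
have D0' : l 0 i0 * l 0 i3 = l 0 i1 * l 0 i2 by apply/eqP; rewrite -subr_eq0 D0.
have k2 : l 0 i2 = k * l 0 i0.
  apply: (@eq_trans _ _ ((l 0 i0 ^+ 2 * l 0 i2 + l 0 i1 * (l 0 i1 * l 0 i2)) / (l 0 i0 ^+ 2 + l 0 i1 ^+ 2))).
    by field.
  by rewrite -D0' /k; field.
have k3 : l 0 i3 = k * l 0 i1.
  apply: (@eq_trans _ _ ((l 0 i0 * (l 0 i0 * l 0 i3) + l 0 i1 ^+ 2 * l 0 i3) / (l 0 i0 ^+ 2 + l 0 i1 ^+ 2))).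
    by field.
  by rewrite D0' /k; field.
apply: (@lie_conj_N6 R _ d b c e f 0 1 1 k (l 0 i0) (l 0 i1)) => //.
  by rewrite mul0r mulr1 sub0r oppr_eq0 oner_eq0.
by move=> t; have := rel t; rewrite k2 k3 !mul1r.
Qed.

Lemma lie_conj_triangular A : linear_fam A -> commuting A -> upper A ->
  exists X, lie_conj X A.
Proof.
move=> lA cA uA; have [B [AB uB sB]] := weight_splitP cA uA.
suff [X lX] : exists X, lie_conj X B by exists X; exact: similar_lie lX.
have cB := similar_commuting AB cA.
have [wB|nwB] := pselect (forall k l, same_weight B k l); last exact: lie_conj_split.
exact: lie_conj_local (similar_linear AB lA) cB uB wB.
Qed.
End Triangular.

(** * Reduction of real families to triangular ones *)

Section RealTriangular.
Variable R : realType.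
Local Notation CC := R[i]%C.
Local Notation cmx := (map_mx (real_complex R)).
Implicit Types (n : nat).

Definition real_spectrum n (A : 'M[R]_n) :=
  forall z : CC, root (char_poly (cmx A)) z -> complex.Im z = 0.

Lemma complex_ReD (x y : CC) : complex.Re (x + y) = complex.Re x + complex.Re y.
Proof. by case: x; case: y. Qed.

Lemma complex_ImD (x y : CC) : complex.Im (x + y) = complex.Im x + complex.Im y.
Proof. by case: x; case: y. Qed.

Lemma complex_ReMr (x : CC) (r : R) : complex.Re (x * real_complex R r) = complex.Re x * r.
Proof. by case: x => a b /=; rewrite mulr0 subr0. Qed.

Lemma complex_ImMr (x : CC) (r : R) : complex.Im (x * real_complex R r) = complex.Im x * r.
Proof. by case: x => a b /=; rewrite mulr0 add0r. Qed.

Lemma Re_mulmx m n p (v : 'M[CC]_(m, n)) (A : 'M[R]_(n, p)) :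
  map_mx (@complex.Re R) (v *m cmx A) = map_mx (@complex.Re R) v *m A.
Proof.
apply/matrixP => i j; rewrite !mxE (big_morph _ complex_ReD (erefl : complex.Re 0 = 0)).
by apply: eq_bigr => k _; rewrite !mxE complex_ReMr.
Qed.

Lemma Im_mulmx m n p (v : 'M[CC]_(m, n)) (A : 'M[R]_(n, p)) :
  map_mx (@complex.Im R) (v *m cmx A) = map_mx (@complex.Im R) v *m A.
Proof.
apply/matrixP => i j; rewrite !mxE (big_morph _ complex_ImD (erefl : complex.Im 0 = 0)).
by apply: eq_bigr => k _; rewrite !mxE complex_ImMr.
Qed.

Lemma ReIm_mx_eq0 m n (v : 'M[CC]_(m, n)) :
  map_mx (@complex.Re R) v = 0 -> map_mx (@complex.Im R) v = 0 -> v = 0.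
Proof.
move=> /matrixP re0 /matrixP im0; apply/matrixP => i j.
by move: (re0 i j) (im0 i j); rewrite !mxE; case: (v i j) => a b /= -> ->.
Qed.

(** The eigenvalues being real, the real and the imaginary part of a common complex eigenvector
    satisfy the same equations, and one of them is nonzero. *)
Lemma real_common_eigenvector n (As : seq 'M[R]_n) : (0 < n)%N ->
  {in As &, forall A B, comm_mx A B} -> {in As, forall A, real_spectrum A} ->
  exists2 u : 'rV[R]_n, u != 0 & {in As, forall A, exists r, u *m A = r *: u}.
Proof.
move=> n0 cAs rAs.
have [|v v0 /allP vP] := @common_eigenvector CC n [seq cmx A | A <- As] n0.
  by move=> _ _ /mapP[A As_A ->] /mapP[B As_B ->]; rewrite /comm_mx -!map_mxM cAs.
have eig A : A \in As -> exists r, v *m cmx A = real_complex R r *: v.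
  move=> AsA; have /sub_rVP[z vz] : (v *m cmx A <= v)%MS by apply: vP; exact: map_f.
  have : root (char_poly (cmx A)) z by rewrite -eigenvalue_root_char; apply/eigenvalueP; exists v.
  move/(rAs _ AsA) => z0; exists (complex.Re z).
  by rewrite vz; congr (_ *: _); move: z0; case: (z) => a b /= ->.
have [u0|u0] := eqVneq (map_mx (@complex.Re R) v) 0; last first.
  exists (map_mx (@complex.Re R) v) => // A /eig[r vr]; exists r.
  by rewrite -Re_mulmx vr; apply/matrixP => i j; rewrite !mxE mulrC complex_ReMr mulrC.
exists (map_mx (@complex.Im R) v).
  by apply: contraNneq v0 => w0; apply/eqP/ReIm_mx_eq0.
move=> A /eig[r vr]; exists r.
by rewrite -Im_mulmx vr; apply/matrixP => i j; rewrite !mxE mulrC complex_ImMr mulrC.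
Qed.

Lemma char_poly_similar (F : fieldType) n (P A : 'M[F]_n) : P \in unitmx ->
  char_poly (P *m A *m invmx P) = char_poly A.
Proof.
move=> Pu; rewrite /char_poly /char_poly_mx.
have E : 'X%:M - map_mx (@polyC F) (P *m A *m invmx P) =
    map_mx (@polyC F) P *m ('X%:M - map_mx (@polyC F) A) *m map_mx (@polyC F) (invmx P).
  rewrite mulmxBr mulmxBl !map_mxM; congr (_ - _).
  by rewrite scalar_mxC -mulmxA -map_mxM mulmxV // map_mx1 mulmx1.
rewrite E !det_mulmx mulrAC -det_mulmx -map_mxM mulmxV // map_mx1 det1 mul1r //.
Qed.

Lemma conj_mulmx (F : fieldType) n (A Q P : 'M[F]_n) : Q \in unitmx -> P \in unitmx ->
  Q *m P *m A *m invmx (Q *m P) = Q *m (P *m A *m invmx P) *m invmx Q.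
Proof.
move=> Qu Pu; have QPu : Q *m P \in unitmx by rewrite unitmx_mul Qu.
apply: (can_inj (mulmxK QPu)).
by rewrite mulmxKV // !mulmxA mulmxKV // mulmxKV.
Qed.

Lemma block_conj (F : fieldType) n1 n2 (A : 'M[F]_n1) (B : 'M[F]_(n2, n1)) (D P : 'M[F]_n2) :
  P \in unitmx -> block_mx 1%:M 0 0 P *m block_mx A 0 B D =
    block_mx A 0 (P *m B) (P *m D *m invmx P) *m block_mx 1%:M 0 0 P.
Proof.
by move=> Pu; rewrite !mulmx_block !(mul0mx, mulmx0, addr0, add0r, mul1mx, mulmx1) mulmxKV.
Qed.

Lemma trig_lblock (F : fieldType) n (A : 'M[F]_1) (B : 'M[F]_(n, 1)) (D : 'M[F]_n) :
  is_trig_mx D -> is_trig_mx (block_mx A 0 B D).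
Proof. by move=> tD; rewrite is_trig_block_mx // eqxx mx11_is_trig. Qed.

Lemma char_poly_lblock (F : fieldType) n1 n2 (A : 'M[F]_n1) (B : 'M[F]_(n2, n1)) (D : 'M[F]_n2) :
  char_poly (block_mx A 0 B D) = char_poly A * char_poly D.
Proof.
rewrite /char_poly /char_poly_mx map_block_mx map_mx0 scalar_mx_block.
rewrite opp_block_mx add_block_mx oppr0 addr0 /=.
by rewrite det_lblock.
Qed.

Lemma real_cotrigonalization n (As : seq 'M[R]_n) :
  {in As &, forall A B, comm_mx A B} -> {in As, forall A, real_spectrum A} ->
  exists2 P : 'M[R]_n, P \in unitmx & {in As, forall A, is_trig_mx (P *m A *m invmx P)}.
Proof.
elim: n As => [|n IHn] As cAs rAs.
  by exists 1%:M; rewrite ?unitmx1 // => A _; apply/is_trig_mxP => -[].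
have [//|u u0 uP] := real_common_eigenvector _ cAs rAs.
have Pu : row_ebase u \in unitmx by exact: row_ebase_unit.
pose P : 'M[R]_(1 + n) := row_ebase u.
pose B A : 'M[R]_(1 + n) := P *m A *m invmx P.
(* [row_ebase u] is an invertible matrix whose first row is proportional to [u], so it completes the
   eigenvector to a basis. *)
have [k k0 uE] : exists2 k, k != 0 & u = k *: usubmx P.
  have r1 : \rank u = 1 by rewrite rank_rV u0.
  have := mulmx_ebase u; rewrite r1 [col_ebase u]mx11_scalar => E.
  exists (col_ebase u 0 0).
    apply: contraNneq u0 => c0; rewrite -E c0.
    by rewrite raddf0 !mul0mx.
  rewrite -{1}E mul_scalar_mx -scalemxAl; congr (_ *: _).
  apply/rowP => j; rewrite !mxE (bigD1 0) //= big1 ?addr0 ?mxE ?eqxx ?mul1r //.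
    by congr (row_ebase u _ _); apply: val_inj.
  move=> i ni0; rewrite mxE (_ : (_ == _) = false) ?mul0r //.
  by apply/negbTE; rewrite eq_sym.
have BE A : A \in As -> exists r, B A = block_mx r%:M 0 (dlsubmx (B A)) (drsubmx (B A)).
  move=> AsA; have [r ur] := uP _ AsA.
  have uB : usubmx (B A) = r *: row_mx 1%:M 0.
    rewrite /B -mulmxA -mul_usub_mx.
    have -> : usubmx P = k^-1 *: u by rewrite uE scalerA mulVf ?scale1r.
    have uV : u *m invmx P = k *: row_mx 1%:M 0.
      rewrite uE -scalemxAl mul_usub_mx mulmxV //.
      by rewrite (scalar_mx_block 1) /block_mx col_mxKu.
    rewrite mulmxA -scalemxAl ur -!scalemxAl uV !scalerA.
    by congr (_ *: _); rewrite -mulrA mulrCA mulVf ?mulr1.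
  exists r; rewrite -{1}[B A]submxK; congr block_mx; rewrite /ulsubmx /ursubmx uB.
    by rewrite linearZ /= row_mxKl scalemx1.
  by rewrite linearZ /= row_mxKr scaler0.
have BM A A' : B A *m B A' = B (A *m A') by rewrite /B !mulmxA mulmxKV.
have [|A' /mapP[A AsA ->]|P' P'u P'P] := IHn [seq drsubmx (B A) | A <- As].
- move=> _ _ /mapP[A AsA ->] /mapP[A' AsA' ->].
  have [r Er] := BE _ AsA; have [r' Er'] := BE _ AsA'.
  have : B A *m B A' = B A' *m B A by rewrite !BM cAs.
  rewrite Er Er' !mulmx_block => /eq_block_mx[_ _ _].
  by rewrite !mulmx0 !add0r !block_mxKdr.
- move=> z zr; apply: (rAs _ AsA); have [r Er] := BE _ AsA.
  have -> : char_poly (cmx A) = char_poly (cmx (B A)).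
    by rewrite -!map_char_poly char_poly_similar.
  rewrite Er map_block_mx map_mx0 char_poly_lblock rootM.
  by rewrite zr orbT.
pose Q : 'M[R]_(1 + n) := block_mx 1%:M 0 0 P'.
have Qu : Q \in unitmx by rewrite unitmxE /Q det_lblock det1 mul1r -unitmxE.
exists (Q *m P); first by rewrite unitmx_mul Qu.
move=> A AsA; have [r Er] := BE _ AsA.
have -> : Q *m P *m A *m invmx (Q *m P) =
    block_mx r%:M 0 (P' *m dlsubmx (B A)) (P' *m drsubmx (B A) *m invmx P').
  rewrite (conj_mulmx A Qu Pu) -/(B A).
  by apply: (can_inj (mulmxK Qu)); rewrite mulmxKV // [X in _ *m X = _]Er; exact: block_conj.
by apply: trig_lblock; apply: P'P; apply: map_f.
Qed.
End RealTriangular.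

(** * From a non-real eigenvalue to a matrix with J^3 = -J *)

Section ComplexWeights.
Variable R : realType.
Local Notation CC := R[i]%C.
Local Notation cmx := (map_mx (real_complex R)).
Local Notation im := ('i%C : CC).

Lemma eigenvector_horner_mx (F : fieldType) n (A : 'M[F]_n.+1) (w : 'rV_n.+1) a (q : {poly F}) :
  w *m A = a *: w -> w *m horner_mx A q = q.[a] *: w.
Proof.
move=> wA; elim/poly_ind: q => [|q c IHq].
  by rewrite rmorph0 mulmx0 horner0 scale0r.
rewrite rmorphD rmorphM /= horner_mx_X horner_mx_C mulmxDr mulmxA IHq -scalemxAl wA.
by rewrite mul_mx_scalar scalerA -scalerDl !hornerE.
Qed.

Lemma quartic_root_i (p : {poly R}) : size p = 5 -> p \is monic ->
  (map_poly (real_complex R) p).[im] = 0 ->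
  p = ('X^2 + 1) * ('X^2 + p`_3 *: 'X + (p`_2 - 1)%:P).
Proof.
move=> sp mp; rewrite horner_coef size_map_poly sp.
under eq_bigr do rewrite coef_map /=.
have p4 : p`_4 = 1 by move/monicP: mp; rewrite lead_coefE sp.
have -> : \sum_(i < 5) real_complex R p`_i * im ^+ i =
    Complex (p`_0 - p`_2 + p`_4) (p`_1 - p`_3).
  rewrite !big_ord_recl big_ord0 /= -[bump 0 0]/1%N -[bump 0 1]/2%N -[bump 0 2]/3%N -[bump 0 3]/4%N.
  rewrite !exprS expr0 p4.
  by apply/eqP; rewrite eq_complex /=; apply/andP; split; apply/eqP; ring.
rewrite p4 => /eqP; rewrite eq_complex /= => /andP[/eqP E0 /eqP E1].
have {}E0 : p`_0 = p`_2 - 1 by lra.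
have {}E1 : p`_1 = p`_3 by lra.
rewrite -[LHS]coefK sp poly_def !big_ord_recl big_ord0 /= -[bump 0 0]/1%N -[bump 0 1]/2%N
  -[bump 0 2]/3%N -[bump 0 3]/4%N E0 E1 p4 -!mul_polyC.
by rewrite !rmorphB /= polyC1; ring.
Qed.

(* For [Y] with characteristic polynomial [p], [J := j(Y)] satisfies
   [J ^ 3 + J = 0] and is nonzero: [j] sends the roots [+-i] of [p] to [+-i] and
   the other roots to 0, or is the Newton step from 'X when [+-i] are double. *)
Lemma cubic_complement (p : {poly R}) : size p = 5 -> p \is monic ->
  (map_poly (real_complex R) p).[im] = 0 ->
  exists j k : {poly R}, j ^+ 3 + j = p * k /\ (map_poly (real_complex R) j).[im] = im.
Proof.
move=> sp mp pi; have pE := quartic_root_i sp mp pi; move: pE.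
set a := p`_3; set b := p`_2 - 1; clearbody a b => pE.
have i2 : im * im = -1 by rewrite -expr2 sqr_i.
(* The squared modulus at i of the cofactor X^2 + a X + b; it vanishes exactly when i is a double
   root. *)
pose D := (b - 1) ^+ 2 + a ^+ 2.
have [D0|D0] := eqVneq D 0.
  have /andP[/eqP b1 /eqP a0] : (b - 1 == 0) && (a == 0).
    by move/eqP: D0; rewrite paddr_eq0 ?sqr_ge0 // !sqrf_eq0.
  have {}pE : p = ('X^2 + 1) ^+ 2.
    rewrite pE a0 scale0r addr0 (_ : b = 1); last by apply/eqP; rewrite -subr_eq0 b1.
    by rewrite expr2.
  pose c : {poly R} := (1 / 2)%:P.
  have c2 : 2 * c = 1 by rewrite /c -[2]/(2%:R) -polyC_natr -polyCM -polyC1; congr _%:P; field.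
  (* The Newton step X - (X^2 + 1) / (2 X), with 1 / X replaced by -X, its value modulo X^2 + 1. *)
  exists (c * (3 * 'X + 'X^3)), ('X * ('X^2 + 3) * (c ^+ 3 * ('X^2 + 4))); split.
    have c4 : c = 4 * c ^+ 3.
      by apply: (@eq_trans _ _ (c * (2 * c) ^+ 2)); [rewrite c2 expr1n mulr1 | ring].
    by rewrite pE {2}c4; ring.
  rewrite !rmorphM rmorphD rmorphM /= map_polyC /= map_polyX map_polyXn !hornerE /=.
  rewrite rmorph_nat !hornerE /= !exprS expr0.
  by apply/eqP; rewrite eq_complex /=; apply/andP; split; apply/eqP; field.
(* The inverse of the cofactor [r] modulo X^2 + 1: at i the cofactor is (b - 1) + a i, and [s] is
   its conjugate over [D]. Thus [r * s] is idempotent modulo [p]. *)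
pose s := D^-1 *: ((b - 1)%:P - a *: 'X).
pose W : {poly R} := 'X^2 + 1.
pose r := 'X^2 + a *: 'X + b%:P.
pose h := s - (a ^+ 2 / D)%:P.
have rs : r * s = 1 + W * h.
  pose d := D^-1%:P; pose A := a%:P; pose B := (b - 1)%:P.
  have dD : d * (B ^+ 2 + A ^+ 2) = 1.
    by rewrite /d /B /A -!rmorphXn /= -polyCD -polyCM mulVf ?polyC1.
  have -> : r = W + B + A * 'X.
    by rewrite /r /W /B /A -mul_polyC polyCB polyC1; ring.
  rewrite /h; have -> : s = d * (B - A * 'X) by rewrite /s /d /B /A -!mul_polyC.
  have -> : (a ^+ 2 / D)%:P = A ^+ 2 * d by rewrite polyCM rmorphXn.
  by rewrite -dD /W; ring.
exists ('X * r * s), ('X * s * (1 + 'X^2 * (2 * h + W * h ^+ 2))); split.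
  rewrite pE -/r -/W.
  apply: (@eq_trans _ _ ('X * (r * s) * ('X^2 * (r * s) ^+ 2 + 1))); first by ring.
  apply: (@eq_trans _ _ ((r * s) * 'X * (W * (1 + 'X^2 * (2 * h + W * h ^+ 2))))); last by ring.
  by rewrite rs /W; ring.
rewrite !rmorphM !rmorphD /= map_polyX map_polyXn map_polyC /= !map_polyZ /= rmorphB /= map_polyC /= map_polyZ /= map_polyX.
rewrite !hornerE /= !exprS expr0.
by apply/eqP; rewrite eq_complex /=; apply/andP; split; apply/eqP; rewrite /D; field.
Qed.

Lemma not_real_spectrum (X : 'M[R]_4) : ~ real_spectrum X ->
  exists J : 'M[R]_4, [/\ J != 0, J *m J *m J = - J & forall Z, comm_mx Z X -> comm_mx Z J].
Proof.
move=> /existsNP[z /not_implyP[zr /eqP zi]].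
move: zr; rewrite -eigenvalue_root_char => /eigenvalueP[w wX w0].
pose al := complex.Re z; pose be := complex.Im z.
(* Normalized so that the eigenvalue z of [X] becomes the eigenvalue i of [Y]. *)
pose Y := be^-1 *: (X - al%:M).
have wY : w *m cmx Y = im *: w.
  rewrite /Y map_mxZ map_mxB map_scalar_mx /= -scalemxAr mulmxBr wX mul_mx_scalar -scalerBl scalerA.
  congr (_ *: _); rewrite /al /be; move: zi; case: (z) => x y /= y0.
  by apply/eqP; rewrite eq_complex /=; apply/andP; split; apply/eqP; field.
have pi : (map_poly (real_complex R) (char_poly Y)).[im] = 0.
  apply/eqP; rewrite map_char_poly -[_ == 0]/(root _ _) -eigenvalue_root_char.
  by apply/eigenvalueP; exists w.
have [j [k [jk ji]]] := cubic_complement (size_char_poly Y) (char_poly_monic Y) pi.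
exists (horner_mx Y j); split.
- apply: contraNneq w0 => J0.
  have := eigenvector_horner_mx (map_poly (real_complex R) j) wY.
  rewrite -map_horner_mx J0 map_mx0 mulmx0 ji => /esym/eqP.
  by rewrite scaler_eq0 => /orP[/eqP/(congr1 (@complex.Im R))/= /eqP|//]; rewrite oner_eq0.
- apply/eqP; rewrite -subr_eq0 opprK.
  have -> : horner_mx Y j *m horner_mx Y j *m horner_mx Y j + horner_mx Y j = horner_mx Y (j ^+ 3 + j).
    by rewrite rmorphD /= !exprS expr0 mulr1 !rmorphM /= -!mulmxA.
  by rewrite jk rmorphM /= Cayley_Hamilton mul0r.
- move=> Z ZX; apply: comm_mx_horner.
  rewrite /comm_mx /Y -scalemxAr -scalemxAl; congr (_ *: _).
  by apply: comm_mxB => //; apply: comm_mx_scalar.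
Qed.

(** The cube of a strictly upper matrix has only its corner entry, a product with factor [M i0 i1],
    which is one of the entries shown to vanish first. *)
Lemma upper_cube (F : numFieldType) (M : 'M[F]_4) : (forall i j : 'I_4, (j <= i)%N -> M i j = 0) ->
  M *m M *m M = - M -> M = 0.
Proof.
move=> uM; have -> : M = ut 0 (M i0 i1) (M i0 i2) (M i0 i3) (M i1 i2) (M i1 i3) (M i2 i3).
  by apply: matrix4P; rewrite !mxE /=; split => //; apply: uM.
set a := M i0 i1; set b := M i0 i2; set c := M i0 i3; set e := M i1 i2; set f := M i1 i3.
set g := M i2 i3; rewrite /ut !m4_mul !(mul0r, mulr0, add0r, addr0) => /matrixP E.
have /eqP := E i0 i1; rewrite !mxE /= eq_sym oppr_eq0 => /eqP a0.
have /eqP := E i0 i2; rewrite !mxE /= eq_sym oppr_eq0 => /eqP b0.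
have /eqP := E i1 i2; rewrite !mxE /= eq_sym oppr_eq0 => /eqP e0.
have /eqP := E i1 i3; rewrite !mxE /= eq_sym oppr_eq0 => /eqP f0.
have /eqP := E i2 i3; rewrite !mxE /= eq_sym oppr_eq0 => /eqP g0.
have /eqP := E i0 i3; rewrite !mxE /= a0 !mul0r eq_sym oppr_eq0 => /eqP c0.
rewrite b0 c0 e0 f0 g0.
by apply: matrix4P; rewrite !mxE.
Qed.

(** [is_trig_mx] means lower triangular; reversing the basis makes it upper. *)
Lemma similar_trig_upper (F : numFieldType) T (A : T -> 'M[F]_4) (P : 'M[F]_4) :
  P \in unitmx -> (forall t, is_trig_mx (P *m A t *m invmx P)) ->
  exists2 B, similar_fam A B & upper B.
Proof.
move=> Pu PA; exists (fun t => \matrix_(i, j) (P *m A t *m invmx P) (rev_ord i) (rev_ord j)).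
  apply: similar_fam_trans (similar_conj A (mulVmx Pu)) _.
  exact: (similar_perm _ rev_ord_inj).
move=> t i j lji; rewrite mxE; apply/is_trig_mxP => //=.
by case: i j lji => [i ?] [j ?] /=; lia.
Qed.

End ComplexWeights.

Section Span.
Variable R : realType.
Local Notation CC := R[i]%C.
Local Notation cmx := (map_mx (real_complex R)).

(* Over the complex numbers, [J] and the matrices [A v] are simultaneously
   conjugate into one of the 3-dimensional Lie algebras plus scalars, so they
   are linearly dependent modulo scalars. *)
Lemma complex_structure_span (A : 'rV[R]_3 -> 'M[R]_4) (J : 'M[R]_4) :
  linear_fam A -> commuting A -> (forall v r, A v = r%:M -> v = 0) ->
  J != 0 -> J *m J *m J = - J -> (forall v, comm_mx (A v) J) ->
  exists v r, J = A v + r%:M.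
Proof.
move=> lA cA iA J0 J3 AJ.
pose G (t : 'I_(3 + 1)) : 'M[R]_4 := if fintype.split t is inl j then A (delta_mx 0 j) else J.
have cG : commuting G.
  move=> s t; rewrite /G; case: (fintype.split s) => i; case: (fintype.split t) => j //.
  - exact: AJ.
  - by apply/esym; exact: AJ.
have cCG : commuting (fun t => cmx (G t)) by move=> s t; rewrite -!map_mxM cG.
have [_ _ /mapP[s _ ->] /mapP[t _ ->]|P Pu PG] :=
    @cotrigonalization CC 4 [seq cmx (G t) | t <- enum 'I_(3 + 1)]; first exact: cCG.
have {}Pu := unitarymx_unit Pu.
have trG t : is_trig_mx (P *m cmx (G t) *m invmx P).
  have : is_trig_mx (conjmx P (cmx (G t))) by apply: (allP PG); apply: map_f; rewrite mem_enum.
  by rewrite conjumx.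
have [B0 GB0 uB0] := similar_trig_upper Pu trG.
have [B [B0B uB sB]] := weight_splitP (similar_commuting GB0 cCG) uB0.
have GB := similar_fam_trans GB0 B0B.
pose o : 'I_(3 + 1) := rshift 3 0.
have Go : G o = J by rewrite /G /o; case: splitP => // j /=; case: j => j; rewrite /= => lj E; move: lj; rewrite -E.
(* With a single weight, the diagonal of [J] would be a quarter of its trace, hence a real number r
   with r^3 = -r, that is 0. Then [J] would be nilpotent and vanish by [upper_cube]. *)
have nwB : ~ forall k l, same_weight B k l.
  move=> wB; have [Q Qu QG] := GB.
  have Bo : B o = Q *m cmx J *m invmx Q by rewrite -Go QG mulmxK.
  pose r := \tr J / 4.
  have B00 : B o i0 i0 = real_complex R r.
    have : \tr (B o) = real_complex R (\tr J).
      by rewrite Bo mxtrace_mulC mulmxA mulVmx // mul1mx -trace_map_mx.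
    rewrite [X in X = _]/mxtrace big_ord4 (wB i1 i0) (wB i2 i0) (wB i3 i0) => E.
    apply: (@mulfI _ 4); first by rewrite pnatr_eq0.
    have trJ : \tr J = 4 * r by rewrite /r mulrC divfK // pnatr_eq0.
    move: E; rewrite trJ rmorphM rmorph_nat => <-.
    by ring.
  have Bo3 : B o *m B o *m B o = - B o.
    rewrite Bo !(mulmx_conj _ _ (mulVmx Qu)).
    by rewrite -!map_mxM J3 map_mxN mulmxN mulNmx.
  have r0 : r = 0.
    have /matrixP/(_ i0 i0) := Bo3; rewrite !mxE !big_ord4 !mxE !big_ord4.
    rewrite (uB o i1 i0) // (uB o i2 i0) // (uB o i3 i0) // B00.
    rewrite !(mul0r, mulr0, addr0) -rmorphN -!rmorphM /= => /(congr1 (@complex.Re R)) /= E.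
    apply/eqP; have : r * (r ^+ 2 + 1) == 0.
      by apply/eqP/(@eq_trans _ _ (r * r * r + r)); [ring | rewrite E addNr].
    by rewrite mulf_eq0 [_ ^+ 2 + 1 == 0]gt_eqF ?orbF // ltr_wpDl ?sqr_ge0.
  have : B o = 0.
    apply: upper_cube Bo3 => i j; rewrite leq_eqVlt => /predU1P[/val_inj ->|]; last exact: uB.
    by rewrite (wB i i0) B00 r0.
  rewrite Bo => /(congr1 (fun M => invmx Q *m M *m Q)).
  rewrite mulmx0 mul0mx !mulmxA mulVmx // mul1mx mulmxKV // => J00.
  move: J0; rewrite (_ : J = 0) ?eqxx //; apply/matrixP => i j.
  by move/matrixP/(_ i j): J00; rewrite !mxE => /(congr1 (@complex.Re R)).
have [X [D BD LD]] := lie_conj_split (similar_commuting GB cCG) uB sB nwB.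
have [Q Qu QG] := similar_fam_trans GB BD.
have {LD} [d [x Dx]] : exists (d : 'I_(3 + 1) -> CC) (x : 'I_(3 + 1) -> 'rV[CC]_3),
    forall t, D t = (d t)%:M + liemx X (x t 0 0) (x t 0 1) (x t 0 (1 + 1)).
  have /choice[h hP] : forall t, exists h : CC * 'rV[CC]_3, D t = h.1%:M +
      liemx X (h.2 0 0) (h.2 0 1) (h.2 0 (1 + 1)).
    move=> t; have [d [x [y [z ->]]]] := LD t.
    by exists (d, \row_j [:: x; y; z]`_j); rewrite !mxE.
  by exists (fun t => (h t).1), (fun t => (h t).2).
pose N : 'M[CC]_(3 + 1, 3) := \matrix_t x t.
have [l l0 lN] : exists2 l : 'rV[CC]_(3 + 1), l != 0 & l *m N = 0.
  have : kermx N != 0.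
    by rewrite -mxrank_eq0 mxrank_ker subn_eq0 -ltnNge (leq_ltn_trans (rank_leq_col N)).
  by move=> /rowV0Pn[l /sub_kermxP lM l0]; exists l.
have liesum (s : seq 'I_(3 + 1)) : \sum_(t <- s) l 0 t *: D t = (\sum_(t <- s) l 0 t * d t)%:M +
    liemx X ((\sum_(t <- s) l 0 t *: x t) 0 0) ((\sum_(t <- s) l 0 t *: x t) 0 1)
      ((\sum_(t <- s) l 0 t *: x t) 0 (1 + 1)).
  elim: s => [|t s IHs].
    by rewrite !big_nil raddf0 !mxE add0r liemx0.
  rewrite !big_cons IHs Dx scalerDr scale_scalar_mx addrACA [in RHS]raddfD /=; congr (_ + _).
  by rewrite -liemx_linear !mxE.
have lD : exists c, \sum_t l 0 t *: D t = c%:M.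
  exists (\sum_t l 0 t * d t); rewrite liesum.
  have -> : \sum_t l 0 t *: x t = 0.
    by apply: etrans lN; rewrite mulmx_sum_row; under [RHS]eq_bigr do rewrite rowK.
  by rewrite !mxE liemx0 addr0.
have [c lG] : exists c, \sum_t l 0 t *: cmx (G t) = c%:M.
  have [c lc] := lD; exists c.
  apply: (can_inj (mulKmx Qu)); rewrite mulmx_sumr [RHS]scalar_mxC -lc mulmx_suml.
  by apply: eq_bigr => t _; rewrite -scalemxAr QG scalemxAl.
(* The matrices [G t] are real, so the real and the imaginary part of a complex relation are
   relations too. *)
have [m [r [m0 mG]]] : exists (m : 'rV[R]_(3 + 1)) r, m != 0 /\ \sum_t m 0 t *: G t = r%:M.
  have ReG : \sum_t complex.Re (l 0 t) *: G t = (complex.Re c)%:M.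
    apply/matrixP => i j; have /matrixP/(_ i j) := lG; rewrite !summxE.
    under eq_bigr do rewrite !mxE; under [in X in _ -> X = _]eq_bigr do rewrite !mxE.
    move/(congr1 (@complex.Re R)); rewrite (big_morph _ (@complex_ReD R) (erefl : complex.Re 0 = 0)).
    under eq_bigr do rewrite complex_ReMr.
    by move=> ->; rewrite !mxE; case: (i == j).
  have ImG : \sum_t complex.Im (l 0 t) *: G t = (complex.Im c)%:M.
    apply/matrixP => i j; have /matrixP/(_ i j) := lG; rewrite !summxE.
    under eq_bigr do rewrite !mxE; under [in X in _ -> X = _]eq_bigr do rewrite !mxE.
    move/(congr1 (@complex.Im R)); rewrite (big_morph _ (@complex_ImD R) (erefl : complex.Im 0 = 0)).
    under eq_bigr do rewrite complex_ImMr.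
    by move=> ->; rewrite !mxE; case: (i == j).
  have [re0|re0] := eqVneq (map_mx (@complex.Re R) l) 0; last first.
    exists (map_mx (@complex.Re R) l), (complex.Re c); split=> //.
    by under eq_bigr do rewrite mxE.
  exists (map_mx (@complex.Im R) l), (complex.Im c); split.
    by apply: contraNneq l0 => im0; apply/eqP/ReIm_mx_eq0.
  by under eq_bigr do rewrite mxE.
have Gl j : G (lshift 1 j) = A (delta_mx 0 j).
  by rewrite /G; have := unsplitK (inl j : 'I_3 + 'I_1)%type; rewrite /unsplit => ->.
have {}Go j : G (rshift 3 j) = J by rewrite ord1 -Go.
have Asum (k : 'I_3 -> R) : \sum_j k j *: A (delta_mx 0 j) = A (\sum_j k j *: delta_mx 0 j).
  apply: (big_rec2 (fun x y => x = A y)); last by move=> j M u _ ->; rewrite lA.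
  have := lA 1 0 0; rewrite !scale1r addr0 => /(congr1 (fun x => x - A 0)).
  by rewrite subrr addrK.
move: mG; rewrite big_split_ord /= big_ord1 Go.
under eq_bigr do rewrite Gl.
rewrite Asum; set v := \sum_j _; set k := m 0 _ => E.
(* The coefficient of [J] is nonzero, since [A] is injective modulo scalars. *)
have [k0|k0] := eqVneq k 0.
  move: E; rewrite k0 scale0r addr0 => /iA v0.
  case/negP: m0; apply/eqP/rowP => t; rewrite mxE.
  rewrite -(splitK t); case: (fintype.split t) => j /=; last by rewrite ord1; exact: k0.
  have /rowP/(_ j) := v0; rewrite /v summxE (bigD1 j) //= big1 ?addr0 => [|i ij].
    by rewrite !mxE !eqxx mulr1.
  by rewrite !mxE (eq_sym j) (negPf ij) andbF mulr0.
exists ((- k^-1) *: v), (k^-1 * r).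
have A0 : A 0 = 0.
  have := lA 1 0 0; rewrite !scale1r addr0 => /(congr1 (fun x => x - A 0)).
  by rewrite subrr addrK.
rewrite -[_ *: v]addr0 lA A0 addr0 -scale_scalar_mx -E scalerDr scaleNr addKr scalerA.
by rewrite mulVf // scale1r.
Qed.
End Span.

(** Triangularity in a given basis is a linear condition, so it suffices to triangularize the three
    matrices at the basis vectors. *)
Lemma lie_conj_or_complex (R : realType) (A : 'rV[R]_3 -> 'M[R]_4) :
  linear_fam A -> commuting A -> (forall v r, A v = r%:M -> v = 0) ->
  (exists X, lie_conj X A) \/
  exists J v r, [/\ J != 0, J *m J *m J = - J & J = A v + r%:M].
Proof.
move=> lA cA iA.
have [rA|/existsNP[j nrA]] := pselect (forall j, real_spectrum (A (delta_mx 0 j))); [left|right].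
  have [_ _ /mapP[s _ ->] /mapP[t _ ->]|_ /mapP[s _ ->]|P Pu PA] :=
    @real_cotrigonalization R 4 [seq A (delta_mx 0 j) | j <- enum 'I_3].
  - exact: cA.
  - exact: rA.
  have trA v : is_trig_mx (P *m A v *m invmx P).
    apply/is_trig_mxP => i j lij.
    move: v; apply: (@linear_rV_eq0 R 3 R^o (fun v => (P *m A v *m invmx P) i j)).
      by move=> k u v; rewrite lA mulmxDr -scalemxAr mulmxDl -scalemxAl !mxE.
    move=> k; apply: (is_trig_mxP _) => //; apply: PA.
    by apply: map_f; rewrite mem_enum.
  have [B AB uB] := similar_trig_upper Pu trA.
  have [X lX] := lie_conj_triangular (similar_linear AB lA) (similar_commuting AB cA) uB.
  by exists X; apply: similar_lie lX.
have [J [J0 J3 JZ]] := not_real_spectrum nrA.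
have AJ v : comm_mx (A v) J by apply: JZ; exact: cA.
have [v [r JE]] := complex_structure_span lA cA iA J0 J3 AJ.
by exists J, v, r.
Qed.

(** * Exponential maps of the fifteen groups *)

Section Exponential.
Variable R : realType.
Implicit Types (X : group_name) (x y z : R).

(* The element of the group [X] that is the exponential of [liemx X x y z]. *)
Definition gexp X x y z : 'M[R]_4 :=
  match X with
  | C => group_mx C (expR x) (expR y) (expR z)
  | E1 => group_mx E1 (expR x) (expR y) (z * expR y)
  | F0 => group_mx F0 (expR x) (y * expR x) (z * expR (- x))
  | F1 => group_mx F1 (expR x) (y * expR x) ((z + y ^+ 2 / 2) * expR x)
  | F2 => group_mx F2 (expR x) (y * expR x) (z * expR x)
  | F3 => group_mx F3 (expR x) (y * expR x) (z * expR x)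
  | N1 => group_mx N1 x (y + x ^+ 2 / 2) (z + x * y + x ^+ 3 / 6)
  | N2 => group_mx N2 x (y + x ^+ 2 / 2) z
  | N3 => group_mx N3 x (y + x ^+ 2 / 2) z
  | N4 => group_mx N4 x y (z + x * y)
  | N4' => group_mx N4' x y (z + (x ^+ 2 + y ^+ 2) / 2)
  | N5 => group_mx N5 x y z
  | N6 => group_mx N6 x y z
  | N7 => group_mx N7 x y z
  | N8 => group_mx N8 x y z
  end.

Lemma mx4E (rows : seq (seq R)) : mx4 rows = m4 rows.
Proof. by []. Qed.

Lemma gexpD X x y z x' y' z' :
  gexp X (x + x') (y + y') (z + z') = gexp X x y z *m gexp X x' y' z'.
Proof.
have e0 t : expR t != 0 :> R by rewrite gt_eqF ?expR_gt0.
case: X; rewrite /gexp /group_mx !mx4E m4_mul ?opprD ?expRD ?expRN;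
  apply: m4_eq; split; try ring; by field; rewrite ?e0.
Qed.

Lemma gexp0 X : gexp X 0 0 0 = 1%:M.
Proof.
by case: X; rewrite /gexp /group_mx !mx4E scalar_m4 ?oppr0 ?expR0;
  apply: m4_eq; split; field.
Qed.

Lemma gexp_unit X x y z : gexp X x y z \in unitmx.
Proof.
have /mulmx1_unit[] // : gexp X x y z *m gexp X (- x) (- y) (- z) = 1%:M.
by rewrite -gexpD !subrr gexp0.
Qed.

Definition GLexp X x y z : GL R 4 := MkGL (gexp_unit X x y z).

Lemma expR_fix n (x : R) : (0 < n)%N -> expR x ^+ n = 1 -> x = 0.
Proof.
move=> n0; rewrite -expRM_natl -[RHS]expR0 => /expR_inj /eqP.
by rewrite mulf_eq0 pnatr_eq0 eqn0Ngt n0 => /eqP.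
Qed.

Lemma mulr_expR_eq0 (x y : R) : x * expR y = 0 -> x = 0.
Proof. by move=> /eqP; rewrite mulf_eq0 (gt_eqF (expR_gt0 y)) orbF => /eqP. Qed.

Lemma expR_inv_fix n (x : R) : 1 / expR x ^+ n = expR x -> x = 0.
Proof.
move=> E; apply: (@expR_fix n.+1) => //; rewrite exprS -{1}E mul1r mulVf //.
by rewrite expf_neq0 // gt_eqF ?expR_gt0.
Qed.

Lemma gexp_scalar X x y z c : gexp X x y z = c%:M -> [/\ x = 0, y = 0 & z = 0].
Proof.
move=> /matrixP E.
move: (E i0 i0) (E i1 i1) (E i2 i2) (E i3 i3) (E i0 i1) (E i0 i2) (E i0 i3) (E i1 i2)
  (E i1 i3) (E i2 i3).
case: X {E}; rewrite !mxE /= ?mulr1n ?mulr0n.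
- move=> ex ey ez e3 *; have x0 : x = 0.
    by apply: (@expR_inv_fix 3); rewrite ex -[RHS]e3 ex ey ez !exprS expr0 mulr1 mulrA.
  by split=> //; apply: expR_inj; rewrite ?ey ?ez -ex x0.
- move=> ex ey _ e3 _ _ _ /mulr_expR_eq0 z0 *; have x0 : x = 0.
    by apply: (@expR_inv_fix 3); rewrite ex -[RHS]e3 ex ey exprS.
  by split=> //; apply: expR_inj; rewrite ?ey -ex x0.
- move=> ex _ e2 _ /mulr_expR_eq0 y0 _ _ _ _ /mulr_expR_eq0 z0; split=> //.
  by apply: (@expR_inv_fix 1); rewrite expr1 e2 ex.
- move=> ex _ _ e3 /mulr_expR_eq0 y0 /mulr_expR_eq0 z0 *; split=> //.
    by apply: (@expR_inv_fix 3); rewrite e3 ex.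
  by move: z0; rewrite y0 expr0n /= mul0r addr0.
- move=> ex _ _ e3 /mulr_expR_eq0 y0 /mulr_expR_eq0 z0 *; split=> //.
  by apply: (@expR_inv_fix 3); rewrite e3 ex.
- move=> ex _ _ e3 _ /mulr_expR_eq0 z0 _ /mulr_expR_eq0 y0 *; split=> //.
  by apply: (@expR_inv_fix 3); rewrite e3 ex.
- by move=> _ _ _ _ -> y0 z0 *; move: y0 z0; rewrite ?expr0n /= ?mul0r ?mulr0 ?addr0 => -> ->.
- by move=> _ _ _ _ -> y0 z0 *; move: y0 z0; rewrite ?expr0n /= ?mul0r ?mulr0 ?addr0 => -> ->.
- by move=> _ _ _ _ _ _ z0 -> y0 *; move: y0 z0; rewrite ?expr0n /= ?mul0r ?mulr0 ?addr0 => -> ->.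
- by move=> _ _ _ _ -> -> z0 *; move: z0; rewrite ?expr0n /= ?mul0r ?mulr0 ?addr0 => ->.
- by move=> _ _ _ _ -> -> z0 *; move: z0; rewrite ?expr0n /= ?mul0r ?mulr0 ?addr0 ?mul0r ?addr0 => ->.
- by move=> _ _ _ _ _ -> -> -> *.
- by move=> _ _ _ _ -> _ -> _ _ ->.
- by move=> _ _ _ _ _ _ -> _ -> ->.
- by move=> _ _ _ _ -> -> -> *.
Qed.

Lemma group_dom_gexp X x y z : exists a b c, group_dom X a b c /\ gexp X x y z = group_mx X a b c.
Proof. by case: X; do 3! eexists; (split; last by []); rewrite /= ?expR_gt0. Qed.

Lemma gexp_surj X a b c : group_dom X a b c -> exists x y z, gexp X x y z = group_mx X a b c.
Proof.
have lnE (t : R) : 0 < t -> expR (ln t) = t by move=> t0; rewrite lnK // posrE.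
have t0 (t : R) : 0 < t -> t != 0 by move=> ?; rewrite gt_eqF.
case: X => /=.
- by case=> a0 b0 c0; exists (ln a), (ln b), (ln c); rewrite !lnE.
- by case=> a0 b0; exists (ln a), (ln b), (c / b); rewrite !lnE // divfK // t0.
- move=> a0; exists (ln a), (b / a), (c * a); rewrite expRN lnE //.
  by rewrite divfK ?mulfK ?t0.
- move=> a0; exists (ln a), (b / a), (c / a - (b / a) ^+ 2 / 2); rewrite lnE //.
  by rewrite subrK !divfK ?t0.
- by move=> a0; exists (ln a), (b / a), (c / a); rewrite lnE // !divfK ?t0.
- by move=> a0; exists (ln a), (b / a), (c / a); rewrite lnE // !divfK ?t0.
- move=> _; exists a, (b - a ^+ 2 / 2), (c - a * (b - a ^+ 2 / 2) - a ^+ 3 / 6).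
  by congr (mx4 _); congr [:: [:: _; _; _; _]; [:: _; _; _; _]; _; _]; ring.
- by move=> _; exists a, (b - a ^+ 2 / 2), c; rewrite subrK.
- by move=> _; exists a, (b - a ^+ 2 / 2), c; rewrite subrK.
- by move=> _; exists a, b, (c - a * b); rewrite subrK.
- by move=> _; exists a, b, (c - (a ^+ 2 + b ^+ 2) / 2); rewrite subrK.
- by move=> _; exists a, b, c.
- by move=> _; exists a, b, c.
- by move=> _; exists a, b, c.
- by move=> _; exists a, b, c.
Qed.

Lemma std_groupE X : std_group R X =
  range (fun v : 'rV[R]_3 => \pi_(PGL R 4)%qT (GLexp X (v 0 0) (v 0 1) (v 0 (1 + 1)))).
Proof.
apply/seteqP; split=> [p [a [b [c [abc [g [gE ->]]]]]] | _ [v _ <-]].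
  have [x [y [z E]]] := gexp_surj abc.
  exists (\row_j [:: x; y; z]`_j) => //; congr (\pi_(PGL R 4)%qT _); apply: val_inj => /=.
  by rewrite !mxE /= gE.
have [a [b [c [abc E]]]] := group_dom_gexp X (v 0 0) (v 0 1) (v 0 (1 + 1)).
by exists a, b, c; split=> //; exists (GLexp X (v 0 0) (v 0 1) (v 0 (1 + 1))).
Qed.

End Exponential.

Section ExpSeries.
Variable R : realType.

Definition offdiag (M : 'M[R]_4) : 'M[R]_4 := \matrix_(i, j) if i == j then 0 else M i j.

(* [M] is the commuting sum of its diagonal part and of [N] whenever [M] is one of
   the matrices [liemx X x y z], and then [N ^ 4 = 0]. *)
Definition texp (M : 'M[R]_4) : 'M[R]_4 :=
  let N := offdiag M in
  \matrix_(i, j) (expR (M i i) *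
    (1%:M + N + 2^-1 *: (N *m N) + 6^-1 *: (N *m N *m N)) i j).

Lemma offdiag_m4 (a00 a01 a02 a03 a10 a11 a12 a13 a20 a21 a22 a23 a30 a31 a32 a33 : R) :
  offdiag (m4 [:: [:: a00; a01; a02; a03]; [:: a10; a11; a12; a13];
   [:: a20; a21; a22; a23]; [:: a30; a31; a32; a33]]) =
  m4 [:: [:: 0; a01; a02; a03]; [:: a10; 0; a12; a13];
   [:: a20; a21; 0; a23]; [:: a30; a31; a32; 0]].
Proof. by apply: matrix4P; rewrite !mxE. Qed.

Lemma diag_m4_mul (e : 'I_4 -> R) (a00 a01 a02 a03 a10 a11 a12 a13 a20 a21 a22 a23 a30 a31 a32 a33 : R) :
  (\matrix_(i, j) (e i * m4 [:: [:: a00; a01; a02; a03]; [:: a10; a11; a12; a13];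
   [:: a20; a21; a22; a23]; [:: a30; a31; a32; a33]] i j)) =
  m4 [:: [:: e i0 * a00; e i0 * a01; e i0 * a02; e i0 * a03];
         [:: e i1 * a10; e i1 * a11; e i1 * a12; e i1 * a13];
         [:: e i2 * a20; e i2 * a21; e i2 * a22; e i2 * a23];
         [:: e i3 * a30; e i3 * a31; e i3 * a32; e i3 * a33]].
Proof. by apply: matrix4P; rewrite !mxE. Qed.

(** One formula for all fifteen groups, through which smoothness and derivatives are proved without
    distinguishing them. *)
Lemma gexpE X x y z : gexp X x y z = texp (liemx X x y z).
Proof.
have e0 t : expR t != 0 :> R by rewrite gt_eqF ?expR_gt0.
have e2 t : expR (2 * t) = expR t ^+ 2 :> R by rewrite expRM_natl.
have e3 t : expR (3 * t) = expR t ^+ 3 :> R by rewrite expRM_natl.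
case: X; rewrite /gexp /group_mx !mx4E /texp [in RHS]/liemx offdiag_m4 !m4_mul !scalar_m4 !m4Z !m4_add
  diag_m4_mul !mxE /= ?expRN ?expRD ?e2 ?e3 ?expR0; apply: m4_eq; split; try ring;
  by field; rewrite ?e0.
Qed.

End ExpSeries.

(** * Stability properties of functions of class C^k *)

Section Ck.
Variables (R : realType) (U : normedModType R).
Implicit Types (W : normedModType R) (A : set U) (k : nat).

Lemma near_eq_differentiable W (f g : U -> W) (x : U) :
  (\near x, f x = g x) -> differentiable f x -> differentiable g x.
Proof.
move=> fg /diff_locallyP[dfc dxf].
have fgx : f x = g x by exact: nbhs_singleton fg.
have E : g \o shift x = cst (g x) + 'd f x +o_ 0 id.
  apply/eqaddoP => e e0; move/eqaddoP: dxf => /(_ e e0) H.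
  have {}fg : \forall y \near 0, f (y + x) = g (y + x).
    by move: fg; rewrite (near_shift 0) subr0.
  near=> y; rewrite -[(_ - _) y]/(g (y + x) - (g x + 'd f x y)) -fgx.
  rewrite -(_ : f (y + x) = g (y + x)); last by near: y.
  by near: y; exact: H.
have D := diff_unique dfc E.
by apply/diff_locallyP; split; rewrite D.
Unshelve. all: by end_near. Qed.

(** The rules of differentiation give equalities on [A] only; the inductions on the class pass
    through this transfer. *)
Lemma Ck_congr W A k (f g : U -> W) : open A -> {in A, f =1 g} ->
  Ck_on k A f -> Ck_on k A g.
Proof.
move=> oA; elim: k f g => [|k IHk] f g fg /=.
  move=> cf x Ax; have nA : \forall y \near x, f y = g y.
    have : nbhs x A by exact: open_nbhs_nbhs.
    by apply: filterS => y Ay; apply: fg; rewrite inE.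
  suff : g @ x --> g x by [].
  rewrite -(nbhs_singleton nA : f x = g x); apply: cvg_trans (cf x Ax).
  exact: near_eq_cvg.
move=> [df Df]; split.
  move=> x Ax; apply: near_eq_differentiable (df x Ax).
  have : nbhs x A by exact: open_nbhs_nbhs.
  by apply: filterS => y Ay; apply: fg; rewrite inE.
move=> v; apply: IHk (Df v) => x; rewrite inE => Ax; apply: near_eq_derive.
have : nbhs x A by exact: open_nbhs_nbhs.
by apply: filterS => y Ay; apply: fg; rewrite inE.
Qed.

Lemma CkW W A k (f : U -> W) : Ck_on k.+1 A f -> Ck_on k A f.
Proof.
elim: k f => [|k IHk] f [df Df]; first by move=> x Ax; exact: differentiable_continuous (df x Ax).
by split=> // v; apply: IHk; exact: Df.
Qed.

Lemma Ck_cst W A k (w : W) : Ck_on k A (cst w).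
Proof.
elim: k w => [|k IHk] w /=; first by move=> x _; exact: cvg_cst.
split=> [x _|v]; first exact: differentiable_cst.
rewrite (_ : 'D_v (cst w) = cst 0); first exact: IHk.
by apply: funext => x; rewrite derive_cst.
Qed.

Variable A : set U.
Hypothesis oA : open A.

Lemma CkD W k (f g : U -> W) : Ck_on k A f -> Ck_on k A g -> Ck_on k A (f + g).
Proof.
elim: k f g => [|k IHk] f g.
  by move=> cf cg x Ax; apply: continuousD; [exact: cf | exact: cg].
move=> [df Df] [dg Dg]; split=> [x Ax|v].
  by apply: differentiableD; [exact: df | exact: dg].
apply: Ck_congr (IHk _ _ (Df v) (Dg v)) => // x; rewrite inE => Ax.
by rewrite deriveD //; apply: diff_derivable; [exact: df | exact: dg].
Qed.

Lemma CkM k (f g : U -> R) : Ck_on k A f -> Ck_on k A g -> Ck_on k A (f * g).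
Proof.
elim: k f g => [|k IHk] f g.
  by move=> cf cg x Ax; apply: continuousM; [exact: cf | exact: cg].
move=> Cf Cg; have [df Df] := Cf; have [dg Dg] := Cg; split=> [x Ax|v].
  by apply: differentiableM; [exact: df | exact: dg].
have C1 := IHk _ _ (CkW Cf) (Dg v); have C2 := IHk _ _ (CkW Cg) (Df v).
apply: Ck_congr (CkD C1 C2) => // x; rewrite inE => Ax.
by rewrite deriveM //; apply: diff_derivable; [exact: df | exact: dg].
Qed.

Lemma CkZl W k (f : U -> R) (w : W) : Ck_on k A f -> Ck_on k A (fun x => f x *: w).
Proof.
elim: k f => [|k IHk] f.
  by move=> cf x Ax; apply: cvgZr_tmp; exact: cf.
move=> [df Df]; split=> [x Ax|v]; first exact: differentiableZl (df x Ax).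
apply: Ck_congr (IHk _ (Df v)) => // x; rewrite inE => Ax.
rewrite !deriveE ?diffZl //; [exact: df | exact: differentiableZl (df x Ax)|exact: df].
Qed.

Lemma CkV k (f : U -> R) : (forall x, A x -> f x != 0) -> Ck_on k A f ->
  Ck_on k A (fun x => (f x)^-1).
Proof.
move=> f0; elim: k f f0 => [|k IHk] f f0.
  by move=> cf x Ax; apply: cvgV; [exact: f0 | exact: cf].
move=> Cf; have [df Df] := Cf; split=> [x Ax|v].
  by apply: differentiableV; [exact: df | exact: f0].
have C1 := IHk f f0 (CkW Cf).
apply: Ck_congr (CkM (Ck_cst A k (-1 : R)) (CkM (CkM C1 C1) (Df v))) => // x; rewrite inE => Ax.
rewrite (deriveV (f0 x Ax)); last by apply: diff_derivable; exact: df.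
by rewrite !fctE -exprVn expr2 mulN1r scaleNr.
Qed.

Lemma Ck_expR k (f : U -> R) : (forall k, Ck_on k A f) -> Ck_on k A (fun x => expR (f x)).
Proof.
move=> Cf; elim: k => [|k IHk].
  move=> x Ax; apply: (@continuous_comp _ _ _ f expR); first exact: (Cf 0 x Ax).
  exact: continuous_expR.
have [df Df] := Cf k.+1.
have de y : differentiable (@expR R) y by apply/derivable1_diffP; exact: derivable_expR.
have dfe x : A x -> differentiable (fun x => expR (f x)) x.
  by move=> Ax; apply: (@differentiable_comp _ _ _ _ f expR) => //; exact: df.
split=> [x Ax|v]; first exact: dfe.
apply: Ck_congr (CkM IHk (Df v)) => // x; rewrite inE => Ax.
rewrite (deriveE _ (dfe x Ax)) -[fun x => _]/(expR \o f).
rewrite (diff_comp (df x Ax) (de (f x))) /comp -(deriveE v (df x Ax)).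
rewrite -[X in 'd expR _ X]mulr1 -[X in 'd expR _ X]/(_ *: 1) linearZ /= -deriveE // derive_val.
by rewrite fctE [RHS]mulrC.
Qed.

Lemma Ck_matrix m n k (f : U -> 'M[R]_(m.+1, n.+1)) :
  (forall i j, Ck_on k A (fun x => f x i j)) -> Ck_on k A f.
Proof.
move=> Cf; have -> : f = \sum_i \sum_j (fun x => f x i j *: delta_mx i j).
  apply: funext => x; rewrite [LHS]matrix_sum_delta fct_sumE.
  by apply: eq_bigr => i _; rewrite fct_sumE.
have C0 : Ck_on k A (0 : U -> 'M[R]_(m.+1, n.+1)) by exact: Ck_cst.
have CD := @CkD 'M[R]_(m.+1, n.+1) k.
apply: big_ind => // i _; apply: big_ind => // j _.
exact: CkZl.
Qed.

End Ck.

Lemma is_derive_line (R : realType) (V W : normedModType R) (f : V -> W) (x v : V) (d : W) :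
  is_derive (0 : R) 1 (fun t => f (t *: v + x)) d <-> is_derive x v f d.
Proof.
have E : (fun h : R => h^-1 *: (((fun t => f (t *: v + x)) \o shift 0) (h *: 1) -
    (fun t => f (t *: v + x)) 0)) = (fun h : R => h^-1 *: ((f \o shift x) (h *: v) - f x)).
  by apply: funext => h; rewrite /= addr0 scale0r add0r [h *: 1]mulr1.
split=> -[dl dE].
  by split; [move: dl; rewrite /derivable E | move: dE; rewrite /derive E].
by split; [rewrite /derivable E | rewrite /derive E].
Qed.

Section TexpDerive.
Variable R : realType.
Implicit Type M : 'M[R]_4.

Lemma texpZ (t : R) M i j : texp (t *: M) i j = expR (t * M i i) *
  ((i == j)%:R + t * offdiag M i j + t ^+ 2 * (2^-1 * (offdiag M *m offdiag M) i j) +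
   t ^+ 3 * (6^-1 * (offdiag M *m offdiag M *m offdiag M) i j)).
Proof.
rewrite /texp mxE [(t *: M) i i]mxE.
have -> : offdiag (t *: M) = t *: offdiag M.
  by apply/matrixP => k l; rewrite !mxE; case: ifP => // _; rewrite mulr0.
set N := offdiag M; clearbody N; rewrite -!scalemxAl -!scalemxAr -!scalemxAl !scalerA.
congr (_ * _); move: (N *m N *m N) (N *m N) => N3 N2; rewrite !mxE.
by ring.
Qed.

(** This holds even when [texp M] is not the exponential of [M]: at 0 only the terms of first order
    count. *)
Lemma is_derive_texp M i j : is_derive (0 : R) 1 (fun t => texp (t *: M) i j) (M i j).
Proof.
rewrite (_ : (fun t => _) = (fun t => expR (t * M i i) *
  ((i == j)%:R + t * offdiag M i j + t ^+ 2 * (2^-1 * (offdiag M *m offdiag M) i j) +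
   t ^+ 3 * (6^-1 * (offdiag M *m offdiag M *m offdiag M) i j)))); last first.
  by apply: funext => t; rewrite texpZ.
set p := 2^-1 * _; set q := 6^-1 * _; set n := offdiag M i j; set m := M i i.
clearbody p q.
pose P : {poly R} := (i == j)%:R%:P + n *: 'X + p *: 'X^2 + q *: 'X^3.
have D1 : is_derive (0 : R) 1 (fun t => expR (t * m)) (m * 1).
  have D0 : is_derive (0 : R) 1 (fun t => t * m) m.
    apply: is_derive_eq (is_deriveM (is_derive_id (0 : R) 1) (is_derive_cst m (0 : R) 1)) _.
    by rewrite /GRing.scale /= mul0r add0r mulr1.
  have De : is_derive (0 * m : R) 1 expR 1
    by have := is_derive_expR (0 * m); rewrite {2}mul0r expR0.
  by have := @is_derive1_comp R expR (fun t => t * m) 0 1 m De D0; rewrite mulr1 mul1r.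
have D2 := is_derive_poly P 0.
rewrite (_ : (fun t => _) = (fun t => expR (t * m)) * horner P); last first.
  by apply: funext => t; rewrite fctE /P !(hornerD, hornerZ, hornerC, hornerX, hornerXn); congr (_ * _); ring.
apply: is_derive_eq (is_deriveM D1 D2) _.
rewrite mul0r expR0 /P !(derivD, derivZ, derivC, derivX, derivXn, hornerD, hornerZ, hornerC, hornerX,
  hornerXn, hornerMn) /GRing.scale /= ?expr0n /=.
by rewrite /n /m mxE; have [->|_] := eqVneq i j; rewrite ?mulr1n ?mulr0n; ring.
Qed.
End TexpDerive.

(** * The fifteen groups are Lie subgroups *)

Section StdGroups.
Variables (R : realType) (X : group_name).

Definition lie_vec (v : 'rV[R]_3) : 'M[R]_4 := liemx X (v 0 0) (v 0 1) (v 0 (1 + 1)).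

Definition exp_vec (v : 'rV[R]_3) : 'M[R]_4 := gexp X (v 0 0) (v 0 1) (v 0 (1 + 1)).

Lemma lie_vec_linear : linear_fam lie_vec.
Proof. by move=> k u v; rewrite /lie_vec !mxE liemx_linear. Qed.

Lemma exp_vecE v : exp_vec v = texp (lie_vec v).
Proof. exact: gexpE. Qed.

Lemma exp_vecD u v : exp_vec (u + v) = exp_vec u *m exp_vec v.
Proof. by rewrite /exp_vec !mxE gexpD. Qed.

Lemma exp_vec0 : exp_vec 0 = 1%:M.
Proof. by rewrite /exp_vec !mxE gexp0. Qed.

Lemma lie_vecZ k v : lie_vec (k *: v) = k *: lie_vec v.
Proof.
have l0 : lie_vec 0 = 0 by rewrite /lie_vec !mxE liemx0.
by rewrite -[k *: v]addr0 lie_vec_linear l0 addr0.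
Qed.

Lemma rV3_eq0 (v : 'rV[R]_3) : v 0 0 = 0 -> v 0 1 = 0 -> v 0 (1 + 1) = 0 -> v = 0.
Proof.
move=> v0 v1 v2; apply/rowP => -[[|[|[|m]]] lm] //; rewrite mxE.
- by rewrite (_ : Ordinal lm = 0) //; exact: val_inj.
- by rewrite (_ : Ordinal lm = 1) //; exact: val_inj.
- by rewrite (_ : Ordinal lm = 1 + 1) //; exact: val_inj.
Qed.

Lemma lie_vec_scalar v c : lie_vec v = c%:M -> v = 0.
Proof.
move=> /matrixP E; suff [x0 y0 z0] : [/\ v 0 0 = 0, v 0 1 = 0 & v 0 (1 + 1) = 0].
  exact: rV3_eq0.
move: E; rewrite /lie_vec; move: (v 0 0) (v 0 1) (v 0 (1 + 1)) => x y z E.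
move: (E i0 i0) (E i1 i1) (E i2 i2) (E i3 i3) (E i0 i1) (E i0 i2) (E i0 i3) (E i1 i2)
  (E i1 i3) (E i2 i3).
by case: X {E}; rewrite !mxE /= ?mulr1n ?mulr0n => *; split; lra.
Qed.

Lemma exp_vec_scalar v c : exp_vec v = c%:M -> v = 0.
Proof. by move=> /gexp_scalar[? ? ?]; apply: rV3_eq0. Qed.

(** The morphism property [exp_vecD] moves the derivative at [x] to the derivative at 0. *)
Lemma is_derive_exp_vec (x v : 'rV[R]_3) i j :
  is_derive x v (fun u => exp_vec u i j) ((lie_vec v *m exp_vec x) i j).
Proof.
apply/is_derive_line.
rewrite (_ : (fun t => _) = \sum_k (fun t => exp_vec x k j *: texp (t *: lie_vec v) i k)); last first.
  apply: funext => t; rewrite exp_vecD mxE fct_sumE; apply: eq_bigr => k _.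
  by rewrite exp_vecE lie_vecZ mulrC.
have -> : (lie_vec v *m exp_vec x) i j = \sum_k exp_vec x k j *: lie_vec v i k.
  by rewrite mxE; apply: eq_bigr => k _; rewrite mulrC.
apply: is_derive_sum => k; apply: is_deriveZ; exact: is_derive_texp.
Qed.

Lemma Ck_coord (A : set 'rV[R]_3) k j : Ck_on k A (fun v : 'rV[R]_3 => v 0 j).
Proof.
case: k => [|k] /=; first by move=> x _; exact: coord_continuous.
split=> [x _|v]; first exact: differentiable_coord.
rewrite (_ : 'D_v _ = cst (v 0 j)); first exact: Ck_cst.
apply: funext => x; have := derive_mx (@derivable_id _ _ x v).
by rewrite derive_id => /matrixP/(_ 0 j); rewrite mxE.
Qed.

Variable A : set 'rV[R]_3.
Hypothesis oA : open A.

Lemma Ck_sum I (s : seq I) k (f : I -> 'rV[R]_3 -> R) : (forall i, Ck_on k A (f i)) ->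
  Ck_on k A (fun x => \sum_(i <- s) f i x).
Proof.
move=> Cf; rewrite (_ : (fun x => _) = \sum_(i <- s) f i).
  apply: big_ind => //; first exact: (Ck_cst A k (0 : R)).
  by move=> g h Cg Ch; exact: CkD.
by apply: funext => x; rewrite fct_sumE.
Qed.

Lemma Ck_lie_vec i j k : Ck_on k A (fun v => lie_vec v i j).
Proof.
have lE (v : 'rV[R]_3) : lie_vec v i j =
    v 0 0 * liemx X 1 0 0 i j + v 0 1 * liemx X 0 1 0 i j + v 0 (1 + 1) * liemx X 0 0 1 i j.
  rewrite /lie_vec; move: (v 0 0) (v 0 1) (v 0 (1 + 1)) => x y z.
  have -> : liemx X x y z = x *: liemx X 1 0 0 + (y *: liemx X 0 1 0 + (z *: liemx X 0 0 1 + liemx X 0 0 0)).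
    by rewrite -!liemx_linear; congr liemx; ring.
  by rewrite liemx0 addr0 !mxE addrA.
rewrite (_ : (fun v => _) = (fun v : 'rV[R]_3 => v 0 0) * cst (liemx X 1 0 0 i j) +
  (fun v : 'rV[R]_3 => v 0 1) * cst (liemx X 0 1 0 i j) +
  (fun v : 'rV[R]_3 => v 0 (1 + 1)) * cst (liemx X 0 0 1 i j)); last first.
  by apply: funext => v; rewrite lE.
by do 2?[apply: CkD => //]; apply: CkM => //; (exact: Ck_coord || exact: Ck_cst).
Qed.

Lemma Ck_mulmx (M N : 'rV[R]_3 -> 'M[R]_4) k : (forall i j, Ck_on k A (fun v => M v i j)) ->
  (forall i j, Ck_on k A (fun v => N v i j)) -> forall i j, Ck_on k A (fun v => (M v *m N v) i j).
Proof.
move=> CM CN i j; rewrite (_ : (fun v => _) = (fun v => \sum_l (fun v => M v i l) v * (fun v => N v l j) v)).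
  by apply: Ck_sum => l; apply: CkM.
by apply: funext => v; rewrite mxE.
Qed.

Lemma Ck_exp_vec i j k : Ck_on k A (fun v => exp_vec v i j).
Proof.
have Cl l m k' := Ck_lie_vec l m k'.
pose N v := offdiag (lie_vec v).
have CN l m : Ck_on k A (fun v => N v l m).
  have [->|lm] := eqVneq l m.
    rewrite (_ : (fun v => _) = cst 0); first exact: Ck_cst.
    by apply: funext => v; rewrite mxE eqxx.
  rewrite (_ : (fun v => _) = (fun v => lie_vec v l m)); first exact: Cl.
  by apply: funext => v; rewrite mxE (negPf lm).
have CNN := Ck_mulmx CN CN; have CNNN := Ck_mulmx CNN CN.
rewrite (_ : (fun v => _) = (fun v => expR (lie_vec v i i)) * (cst ((i == j)%:R) + (fun v => N v i j) +
   cst 2^-1 * (fun v => (N v *m N v) i j) + cst 6^-1 * (fun v => (N v *m N v *m N v) i j))); last first.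
  apply: funext => v; rewrite exp_vecE /texp -/(N v) mxE !fctE; congr (_ * _).
  by move: (N v *m N v *m N v) (N v *m N v) => N3 N2; rewrite !mxE.
apply: CkM => //; first by apply: Ck_expR.
by apply: CkD => //; [apply: CkD => //; [apply: CkD => //; exact: Ck_cst|]|];
  apply: CkM => //; exact: Ck_cst.
Qed.

End StdGroups.

Section StdLie.
Local Open Scope quotient_scope.
Variables (R : realType) (X : group_name).

Definition exp_GL (v : 'rV[R]_3) : GL R 4 := GLexp X (v 0 0) (v 0 1) (v 0 (1 + 1)).

Definition exp_PGL v : PGL R 4 := \pi_(PGL R 4) (exp_GL v).

Lemma exp_vec_unit (v : 'rV[R]_3) : exp_vec X v \in unitmx.
Proof. exact: gexp_unit. Qed.

Lemma exp_PGLD : {morph exp_PGL : u v / u + v >-> (u * v)%g}.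
Proof.
move=> u v; apply: etrans (esym (PGL_piM (exp_GL u) (exp_GL v))).
congr (\pi_(PGL R 4) _); by apply: val_inj; exact: (exp_vecD X u v).
Qed.

Lemma exp_PGL_inj : injective exp_PGL.
Proof.
move=> u v /eqP/PGL_piP[c c0 E]; apply/esym/eqP; rewrite -subr_eq0; apply/eqP.
apply: (@exp_vec_scalar R X _ c); apply: (can_inj (mulmxK (exp_vec_unit u))).
by rewrite -exp_vecD subrK mul_scalar_mx -[LHS]/(GLmx (exp_GL v)) E.
Qed.

Lemma chart_exp_PGL i j : chart i j \o exp_PGL = fun v => (exp_vec X v i j)^-1 *: exp_vec X v.
Proof. by apply: funext => v; rewrite /= chartE. Qed.

Lemma chart_dom_exp_PGL i j : exp_PGL @^-1` chart_dom i j = [set v : 'rV[R]_3 | exp_vec X v i j != 0].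
Proof.
apply/seteqP; split => v /=; first by move=> /chart_domE.
by move=> nz; apply/chart_domE.
Qed.

Lemma open_exp_nz i j : open [set v : 'rV[R]_3 | exp_vec X v i j != 0].
Proof.
have cE : continuous (fun v : 'rV[R]_3 => exp_vec X v i j).
  by move=> v; exact: (@Ck_exp_vec R X setT openT i j 0).
rewrite (_ : [set v | _] = (fun v => exp_vec X v i j) @^-1` [set x | x != 0]) //.
by apply: open_comp => [v _|]; [exact: cE | exact: open_neq].
Qed.

Lemma smooth_chart_exp i j k : Ck_on k [set v : 'rV[R]_3 | exp_vec X v i j != 0] (chart i j \o exp_PGL).
Proof.
have oA := @open_exp_nz i j; rewrite chart_exp_PGL; apply: Ck_matrix => // l m.
rewrite (_ : (fun v => _) = (fun v => (exp_vec X v i j)^-1) * (fun v => exp_vec X v l m)); last first.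
  by apply: funext => v; rewrite mxE.
apply: CkM => //; last exact: Ck_exp_vec.
by apply: CkV => //; exact: Ck_exp_vec.
Qed.

Lemma immersion_exp_PGL : immersion exp_PGL.
Proof.
split=> [i j|x i j].
  rewrite chart_dom_exp_PGL; split; first exact: open_exp_nz.
  by move=> k; exact: smooth_chart_exp.
rewrite -[chart_dom _ _ _]/((exp_PGL @^-1` chart_dom i j) x) chart_dom_exp_PGL /= => nz.
have [dF _] := @smooth_chart_exp i j 1; have {}dF := dF x nz.
move=> u w uw; apply/eqP; rewrite -subr_eq0; apply/eqP.
have : 'd (chart i j \o exp_PGL) x (u - w) = 0 by rewrite linearB /= uw subrr.
move: (u - w) => v; rewrite -(deriveE _ dF) => Dv.
set F := chart i j \o exp_PGL in dF Dv *.
have dF' l m : is_derive x v (fun y => F y l m) 0.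
  have := derive_mx (@diff_derivable _ _ _ _ x v dF); rewrite Dv => /matrixP/(_ l m).
  rewrite !mxE => D0; apply: DeriveDef => //.
  by move/derivable_mxP: (@diff_derivable _ _ _ _ x v dF) => /(_ l m).
have Dij := is_derive_exp_vec X x v i j.
(* By the quotient rule, a vanishing derivative of the chart makes the derivative of [exp_vec X]
   proportional to its value. Cancelling the invertible factor [exp_vec X x] leaves [lie_vec X v]
   scalar, hence [v = 0]. *)
have LG l m : (lie_vec X v *m exp_vec X x) l m =
    (lie_vec X v *m exp_vec X x) i j / exp_vec X x i j * exp_vec X x l m.
  have Dlm := is_derive_exp_vec X x v l m; have [_] := dF' l m.
  rewrite /F chart_exp_PGL.
  rewrite (_ : (fun y => _) = (fun y => (exp_vec X y i j)^-1) * (fun y => exp_vec X y l m)); last first.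
    by apply: funext => y; rewrite mxE.
  have dV : derivable (fun y => (exp_vec X y i j)^-1) x v by apply: derivableV => //; case: Dij.
  have dl : derivable (fun y => exp_vec X y l m) x v by case: Dlm.
  have dj : derivable (fun y => exp_vec X y i j) x v by case: Dij.
  rewrite (deriveM dV dl) (deriveV nz dj).
  rewrite !derive_val /GRing.scale /= => E.
  apply: (mulfI (invr_neq0 nz)); apply/eqP; rewrite -subr_eq0; apply/eqP; rewrite -[RHS]E.
  by field.
apply: (@lie_vec_scalar R X _ ((lie_vec X v *m exp_vec X x) i j / exp_vec X x i j)).
apply: (can_inj (mulmxK (exp_vec_unit x))); apply/matrixP => l m.
by rewrite mul_scalar_mx [RHS]mxE; exact: LG.
Qed.

Lemma std_group_lie : lie_subgroup_iso 'rV[R]_3 (std_group R X).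
Proof.
exists exp_PGL; split; [exact: exp_PGLD | exact: exp_PGL_inj | exact: immersion_exp_PGL |].
exact: std_groupE.
Qed.
End StdLie.

(** * Tangent spaces of Lie subgroups *)

Lemma is_derive_mulmx (R : realType) (V : normedModType R) m n p (M : V -> 'M[R]_(m, n))
    (N : V -> 'M[R]_(n, p)) (x v : V)
    (dM : 'M[R]_(m, n)) (dN : 'M[R]_(n, p)) :
  (forall i j, is_derive x v (fun y => M y i j) (dM i j)) ->
  (forall i j, is_derive x v (fun y => N y i j) (dN i j)) ->
  forall i j, is_derive x v (fun y => (M y *m N y) i j) ((dM *m N x + M x *m dN) i j).
Proof.
move=> DM DN i j.
rewrite (_ : (fun y => _) = \sum_k (fun y => M y i k) * (fun y => N y k j)); last first.
  by apply: funext => y; rewrite mxE fct_sumE.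
have -> : (dM *m N x + M x *m dN) i j = \sum_k (M x i k *: dN k j + N x k j *: dM i k).
  rewrite !mxE -big_split; apply: eq_bigr => k _ /=.
  by rewrite addrC /GRing.scale /= [N x k j * _]mulrC.
by apply: is_derive_sum => k; apply: is_deriveM.
Qed.

Section OneParameter.
Local Open Scope quotient_scope.
Variables (R : realType) (f : 'rV[R]_3 -> PGL R 4).
Hypothesis fM : {morph f : x y / x + y >-> (x * y)%g}.
Hypothesis fI : injective f.
Hypothesis fS : immersion f.

(** An arbitrary lift: it is multiplicative up to factors, but carries no continuity. *)
Definition repr_mx v : 'M[R]_4 := GLmx (repr (f v)).

Lemma repr_mx_unit v : repr_mx v \in unitmx.
Proof. exact: GLmxP. Qed.

Lemma repr_mxP v (g : GL R 4) : f v = \pi_(PGL R 4) g <-> exists2 c, c != 0 & repr_mx v = c *: GLmx g.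
Proof.
split=> [fv|[c c0 E]]; first by rewrite /repr_mx fv; exact: PGL_repr.
rewrite -[LHS]reprK; apply/esym/eqP/PGL_piP; by exists c.
Qed.

Lemma repr_mxM u v : exists2 c, c != 0 & repr_mx (u + v) = c *: (repr_mx u *m repr_mx v).
Proof. by apply/(repr_mxP (u + v) (repr (f u) * repr (f v))%g); rewrite fM. Qed.

Lemma repr_mx0 : exists2 c, c != 0 & repr_mx 0 = c%:M.
Proof.
have [c c0 E] := repr_mxM 0 0; exists c^-1; first by rewrite invr_eq0.
have E1 : 1%:M = c *: repr_mx 0.
  apply: (can_inj (mulmxK (repr_mx_unit 0))); rewrite mul1mx -scalemxAl.
  by rewrite addr0 in E.
by rewrite -[LHS]scale1r -(mulVf c0) -scalerA -E1 scalemx1.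
Qed.

(* The lifts commute up to a factor [e] with [e ^ 4 = 1], that is [e = +-1], and
   the sign disappears because [f u] is the square of [f (u / 2)]. *)
Lemma repr_mx_commute u v : repr_mx u *m repr_mx v = repr_mx v *m repr_mx u.
Proof.
have comm_sign a b : exists2 c, c ^+ 2 = 1 & repr_mx a *m repr_mx b = c *: (repr_mx b *m repr_mx a).
  have [c c0 Ec] := repr_mxM a b; have [d d0 Ed] := repr_mxM b a.
  pose e := d / c; have E : repr_mx a *m repr_mx b = e *: (repr_mx b *m repr_mx a).
    by rewrite /e mulrC -scalerA -Ed addrC Ec scalerA mulVf ?scale1r.
  exists e => //; have D0 : \det (repr_mx b *m repr_mx a) != 0.
    by rewrite -unitfE -unitmxE unitmx_mul !repr_mx_unit.
  have : \det (repr_mx b *m repr_mx a) = e ^+ 4 * \det (repr_mx b *m repr_mx a).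
    by rewrite -detZ -E !det_mulmx mulrC.
  rewrite -{1}[\det _]mul1r => /(mulIf D0)/esym/eqP.
  rewrite (_ : 4%N = (2 * 2)%N) // exprM sqrf_eq1 => /orP[/eqP//|].
  by move=> /eqP e2; have := sqr_ge0 e; rewrite e2 oppr_ge0 ler10.
have [d d0 Ed] := repr_mxM (2^-1 *: u) (2^-1 *: u).
have uE : 2^-1 *: u + 2^-1 *: u = u.
  by rewrite -scalerDl -[RHS]scale1r; congr (_ *: _); field.
rewrite uE in Ed; have [c c1 E] := comm_sign (2^-1 *: u) v.
rewrite Ed -!scalemxAl -!scalemxAr; congr (_ *: _).
rewrite -mulmxA E -scalemxAr mulmxA E -scalemxAl scalerA -expr2 c1 scale1r.
by rewrite mulmxA.
Qed.

(** A lift that is smooth near 0 and equals 1 at 0, normalized by its entry (0, 0). *)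
Definition chart00 v : 'M[R]_4 := chart ord0 ord0 (f v).

Lemma chart00E v : chart00 v = (repr_mx v i0 i0)^-1 *: repr_mx v.
Proof. by rewrite /chart00 /chart /repr_mx; congr ((_)^-1 *: _); congr (GLmx _ _ _); apply: val_inj. Qed.

Definition dom00 : set 'rV[R]_3 := f @^-1` chart_dom ord0 ord0.

Lemma dom00P v : dom00 v <-> repr_mx v i0 i0 != 0.
Proof.
rewrite /dom00 /chart_dom /= /repr_mx (_ : ord0 = i0 :> 'I_4) //; exact: val_inj.
Qed.

Lemma open_dom00 : open dom00.
Proof. by have [/(_ ord0 ord0)[]] := fS. Qed.

Lemma dom00_0 : dom00 0.
Proof. by apply/dom00P; have [c c0 ->] := repr_mx0; rewrite mxE eqxx mulr1n. Qed.

Lemma chart00_0 : chart00 0 = 1%:M.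
Proof.
have [c c0 E] := repr_mx0; rewrite chart00E E mxE eqxx mulr1n.
by rewrite scale_scalar_mx mulVf.
Qed.

Lemma differentiable_chart00 v : dom00 v -> differentiable chart00 v.
Proof. by move=> dv; have [/(_ ord0 ord0)[_ /(_ 1)[]]] := fS; move/(_ v dv). Qed.

Definition tangent v : 'M[R]_4 := 'd chart00 0 v.

Lemma tangent_linear : linear_fam tangent.
Proof. by move=> k u v; rewrite /tangent linearP. Qed.

Lemma is_derive_chart00 v i j : is_derive 0 v (fun y => chart00 y i j) (tangent v i j).
Proof.
have dh := differentiable_chart00 dom00_0; have dl := @diff_derivable _ _ _ _ 0 v dh.
rewrite /tangent -deriveE // (derive_mx dl) mxE; apply: DeriveDef => //.
by move/derivable_mxP: dl => /(_ i j).
Qed.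

Lemma chart00_commute u v : chart00 u *m chart00 v = chart00 v *m chart00 u.
Proof. by rewrite !chart00E -!scalemxAl -!scalemxAr repr_mx_commute !scalerA mulrC. Qed.

(** Differentiates a commutation at 0 in one variable; [tangent_commute] uses it once for each of
    the two. *)
Lemma tangent_commute_of (M : 'M[R]_4) v : (forall u, chart00 u *m M = M *m chart00 u) ->
  tangent v *m M = M *m tangent v.
Proof.
move=> hM; apply/matrixP => i j.
have dM k l : is_derive (0 : 'rV[R]_3) v (fun=> M k l) ((0 : 'M[R]_4) k l).
  by rewrite mxE; exact: is_derive_cst.
have := is_derive_mulmx (is_derive_chart00 v) dM i j; have := is_derive_mulmx dM (is_derive_chart00 v) i j.
rewrite (_ : (fun y => (chart00 y *m M) i j) = fun y => (M *m chart00 y) i j); last first.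
  by apply: funext => y; rewrite hM.
by rewrite mulmx0 mul0mx addr0 add0r => -[_ <-] [_ <-].
Qed.

Lemma tangent_commute : commuting tangent.
Proof.
move=> u v; apply: tangent_commute_of => w; apply/esym.
by apply: tangent_commute_of => u'; exact: chart00_commute.
Qed.

(** The entry (0, 0) of [chart00] is constantly 1 near 0, so a scalar tangent matrix is 0, and [f]
    is an immersion. *)
Lemma tangent_scalar v r : tangent v = r%:M -> v = 0.
Proof.
move=> tv; have r0 : r = 0.
  have := is_derive_chart00 v i0 i0; rewrite tv mxE eqxx mulr1n => -[_ <-].
  rewrite (_ : 'D_v _ 0 = 'D_v (cst (1 : R)) 0); first by rewrite derive_cst.
  apply: near_eq_derive.
  have : nbhs (0 : 'rV[R]_3) dom00 by apply: open_nbhs_nbhs; split; [exact: open_dom00 | exact: dom00_0].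
  by apply: filterS => y /dom00P y0; rewrite chart00E mxE mulVf.
have [_ /(_ 0 ord0 ord0 dom00_0) dI] := fS.
apply: dI; rewrite linear0 -[LHS]/(tangent v) tv r0.
by rewrite raddf0.
Qed.

End OneParameter.

(** * A morphism is determined on a line by its derivative at 0 *)

Section Flow.
Local Open Scope quotient_scope.
Variables (R : realType) (f : 'rV[R]_3 -> PGL R 4).
Hypothesis fM : {morph f : x y / x + y >-> (x * y)%g}.
Hypothesis fS : immersion f.

Variables (v : 'rV[R]_3) (E : R -> 'M[R]_4) (c : R).
Hypothesis ED : forall s t, E (s + t) = E s *m E t.
Hypothesis E0 : E 0 = 1%:M.
Hypothesis dE : forall i j, is_derive (0 : R) 1 (fun t => E t i j) ((tangent f v + c%:M) i j).

(** To be proved scalar. [P] is its smooth counterpart near 0, where [chart00] replaces the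
    arbitrary lift. *)
Let K t : 'M[R]_4 := repr_mx f (t *: v) *m E (- t).

Let P s : 'M[R]_4 := chart00 f (s *: v) *m E (- s).

Let dP i j : is_derive (0 : R) 1 (fun s => P s i j) ((- c)%:M i j).
Proof.
have dh k l : is_derive (0 : R) 1 (fun s => chart00 f (s *: v) k l) (tangent f v k l).
  have := is_derive_chart00 fM fS v k l; move/is_derive_line.
  by rewrite (_ : (fun t => chart00 f (t *: v + 0) k l) = fun t => chart00 f (t *: v) k l) //;
    apply: funext => t; rewrite addr0.
have dE' k l : is_derive (0 : R) 1 (fun s => E (- s) k l) ((- (tangent f v + c%:M)) k l).
  have d1 : is_derive (- 0 : R) 1 (fun t => E t k l) ((tangent f v + c%:M) k l) by rewrite oppr0.
  have d2 : is_derive (0 : R) 1 -%R (- 1 : R) by exact: is_deriveNid.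
  have := @is_derive1_comp R (fun t => E t k l) -%R 0 _ _ d1 d2.
  by rewrite mulrN1 [in X in _ -> X]mxE.
have := is_derive_mulmx dh dE' i j.
rewrite oppr0 scale0r E0 (chart00_0 fM) mulmx1 mul1mx opprD addNKr.
by rewrite [in X in _ -> X]mxE [in X in X -> _]mxE !mxE mulNrn.
Qed.

Let near_dom : \forall s \near (0 : R), dom00 f (s *: v).
Proof.
have cv : {for (0 : R), continuous (fun s : R => s *: v)} by exact: scalel_continuous.
apply: cv; rewrite scale0r; apply: open_nbhs_nbhs; split; [exact: (open_dom00 fS) | exact: (dom00_0 fM)].
Qed.

Let K_shift t s : dom00 f (s *: v) -> exists2 k, k != 0 &
  K (s + t) = k *: (repr_mx f (t *: v) *m P s *m E (- t)).
Proof.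
move=> /dom00P ds; have [k k0 Ek] := repr_mxM fM (t *: v) (s *: v).
have [r r0 sE] : exists2 r, r != 0 & repr_mx f (s *: v) = r *: chart00 f (s *: v).
  by exists (repr_mx f (s *: v) i0 i0); rewrite // chart00E scalerA mulfV ?scale1r.
exists (k * r); first by rewrite mulf_neq0.
rewrite /K /P scalerDl addrC Ek opprD ED sE -scalemxAr scalerA -scalemxAl.
by rewrite !mulmxA.
Qed.

Let dN t i j : is_derive (0 : R) 1 (fun s => (repr_mx f (t *: v) *m P s *m E (- t)) i j)
  (- c * K t i j).
Proof.
have dcst (M : 'M[R]_4) k l : is_derive (0 : R) 1 (fun=> M k l) ((0 : 'M[R]_4) k l).
  by rewrite mxE; exact: is_derive_cst.
have := is_derive_mulmx (is_derive_mulmx (dcst (repr_mx f (t *: v))) dP) (dcst (E (- t))) i j.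
have -> : P 0 = 1%:M by rewrite /P oppr0 scale0r E0 (chart00_0 fM) mulmx1.
by rewrite mul0mx add0r mulmx0 addr0 mul_mx_scalar -scalemxAl [in X in X -> _]mxE.
Qed.

(* The projective coordinates of the curve [K], which have zero derivative. *)
Let rho i j t := K t i j / K t i0 i0.

Let d_rho t i j : K t i0 i0 != 0 -> is_derive (t : R) 1 (rho i j) 0.
Proof.
move=> Kt; apply/is_derive_line.
pose N s := repr_mx f (t *: v) *m P s *m E (- t).
have N0 : N 0 = K t by rewrite /N /K /P oppr0 scale0r E0 (chart00_0 fM) !mulmx1.
apply: (@near_eq_is_derive _ _ _ (fun s => N s i j * (N s i0 i0)^-1)).
  near=> s; have ds : dom00 f (s *: v) by near: s; exact: near_dom.
  have [k k0 kE] := K_shift t ds; rewrite /rho [s *: 1]mulr1 kE -/(N s) !mxE.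
  by rewrite invfM mulrACA mulfV ?mul1r.
have nz : N 0 i0 i0 != 0 by rewrite N0.
have D := is_deriveM (dN t i j) (is_deriveV nz (dN t i0 i0)).
apply: is_derive_eq D _; rewrite -/(N 0) N0 /GRing.scale /=.
by field.
Unshelve. all: by end_near. Qed.

Let K0 : exists2 k, k != 0 & K 0 = k%:M.
Proof.
have [k k0 kE] := repr_mx0 fM; exists k => //.
by rewrite /K scale0r oppr0 E0 mulmx1.
Qed.

Let K_neq0 : \forall s \near (0 : R), K s i0 i0 != 0.
Proof.
have Pc : {for 0, continuous (fun s => P s i0 i0)}.
  apply: differentiable_continuous; apply/derivable1_diffP.
  by case: (dP i0 i0).
have P0 : P 0 i0 i0 != 0.
  by rewrite /P oppr0 scale0r E0 (chart00_0 fM) mulmx1 mxE eqxx oner_neq0.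
have nP : \forall s \near (0 : R), P s i0 i0 != 0.
  have /Pc : nbhs (P 0 i0 i0) [set x : R | x != 0].
    by apply: open_nbhs_nbhs; split => //; exact: open_neq.
  by [].
near=> s.
have ds : dom00 f (s *: v) by near: s; exact: near_dom.
have [k k0] := K_shift 0 ds; have [r r0 rE] := repr_mx0 fM.
rewrite addr0 scale0r oppr0 E0 mulmx1 rE mul_scalar_mx scalerA => ->.
rewrite mxE !mulf_neq0 //.
by near: s.
Unshelve. all: by end_near. Qed.

(** The entry [K s i0 i0] is known to be nonzero only near 0, so the mean value theorem settles
    small times only. An arbitrary [t] is a multiple of a small one, and both sides are
    multiplicative up to factors. *)
Lemma one_parameter t : 0 <= t -> exists2 k, k != 0 & repr_mx f (t *: v) = k *: E t.
Proof.
have [e e0 eK] : exists2 e : R, 0 < e & forall s, 0 <= s < e -> K s i0 i0 != 0.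
  have [e /= e0 He] := (nbhs_ballP _ _).1 K_neq0.
  exists e => // s /andP[s0 se]; apply: He.
  by rewrite /ball /= sub0r normrN ger0_norm.
have small s : 0 <= s < e -> exists2 k, k != 0 & repr_mx f (s *: v) = k *: E s.
  move=> se; have /andP[s0 s1] := se.
  have rhoE i j : rho i j s = (i == j)%:R.
    have dr x : x \in `[0, s]%R -> is_derive x 1 (rho i j) 0.
      rewrite in_itv /= => /andP[x0 xs]; apply: d_rho; apply: eK.
      by rewrite x0 (le_lt_trans xs).
    have H1 x : x \in `]0, s[%R -> is_derive x 1 (rho i j) ((fun=> 0) x).
      by move=> xs; apply: dr; apply: subset_itv_oo_cc xs.
    have H2 : {within `[0, s], continuous (rho i j)}.
      by apply: derivable_within_continuous => x xs; case: (dr x xs).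
    have [x _] := MVT_segment s0 H1 H2.
    rewrite mul0r => /eqP; rewrite subr_eq0 => /eqP ->.
    have [k k0 kE] := K0; rewrite /rho kE !mxE eqxx mulr1n.
    by case: eqVneq => _; rewrite ?mulr1n ?mulr0n ?mul0r // mulfV.
  exists (K s i0 i0); first exact: eK.
  have KE : K s = (K s i0 i0)%:M.
    apply/matrixP => i j; rewrite [in RHS]mxE -[LHS](divfK (eK s se)) -/(rho i j s) rhoE.
    by case: eqVneq => _; rewrite ?mulr1n ?mulr0n ?mul0r ?mul1r.
  rewrite -[RHS]mul_scalar_mx -KE /K -mulmxA -ED addNr E0 mulmx1 //.
have mult n s : (exists2 k, k != 0 & repr_mx f (s *: v) = k *: E s) ->
    exists2 k, k != 0 & repr_mx f ((s *+ n) *: v) = k *: E (s *+ n).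
  move=> [k k0 kE]; elim: n => [|n [l l0 lE]].
    by have [r r0 rE] := repr_mx0 fM; exists r; rewrite // mulr0n scale0r E0 scalemx1.
  rewrite mulrS scalerDl ED; have [r r0 ->] := repr_mxM fM (s *: v) ((s *+ n) *: v).
  exists (r * k * l); first by rewrite !mulf_neq0.
  by rewrite kE lE -scalemxAl -scalemxAr !scalerA mulrAC.
move=> t0; have te : 0 <= t / e by rewrite divr_ge0 // ltW.
pose n := (Num.bound (t / e)).+1.
have -> : t = (t / n%:R) *+ n by rewrite -mulr_natr divfK // pnatr_eq0.
apply: mult; apply: small; rewrite divr_ge0 //= ltr_pdivrMr ?ltr0n //.
rewrite -ltr_pdivrMl // mulrC (lt_le_trans (archi_boundP te)) // ler_nat.
exact: leqnSn.
Qed.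

End Flow.

(** * The periodic one-parameter group generated by J *)

Section Rotation.
Local Open Scope quotient_scope.
Variables (R : realType) (J : 'M[R]_4).
Hypothesis J3 : J *m J *m J = - J.

(* The exponential of [t *: J], thanks to [J ^ 3 = - J]. *)
Definition rotation (t : R) : 'M[R]_4 := 1%:M + sin t *: J + (1 - cos t) *: (J *m J).

Lemma rotationD s t : rotation (s + t) = rotation s *m rotation t.
Proof.
rewrite /rotation; have JK : J *m (J *m J) = - J by rewrite mulmxA.
have KK : J *m J *m (J *m J) = - (J *m J) by rewrite mulmxA J3 mulNmx.
have KJ := J3; have [K JJ] : exists K, J *m J = K by exists (J *m J).
rewrite !JJ in JK KK KJ *.
rewrite !mulmxDl !mulmxDr !mul1mx !mulmx1 -!scalemxAl -!scalemxAr JJ JK KJ KK sinD cosD.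
by apply/matrixP => i j; rewrite !mxE; ring.
Qed.

Lemma rotation0 : rotation 0 = 1%:M.
Proof. by rewrite /rotation sin0 cos0 scale0r subrr scale0r !addr0. Qed.

Lemma rotation_2pi : rotation (pi *+ 2) = 1%:M.
Proof.
by rewrite /rotation sin2pi cos2pi scale0r subrr scale0r !addr0.
Qed.

Lemma is_derive_rotation i j : is_derive (0 : R) 1 (fun t => rotation t i j) (J i j).
Proof.
rewrite (_ : (fun t => _) = cst ((1%:M : 'M[R]_4) i j) + (J i j) *: (@sin R) +
   ((J *m J) i j) *: (cst 1 - (@cos R))); last first.
  apply: funext => t; rewrite /rotation; move: (J *m J) => K; rewrite !fctE !mxE /GRing.scale /=.
  by ring.
have dcst (x : R) : is_derive (0 : R) 1 (cst x) 0 by exact: is_derive_cst.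
have D := is_deriveD (is_deriveD (dcst ((1%:M : 'M[R]_4) i j)) (is_deriveZ (J i j) (is_derive_sin (0 : R))))
  (is_deriveZ ((J *m J) i j) (is_deriveB (dcst 1) (is_derive_cos (0 : R)))).
apply: is_derive_eq D _.
by rewrite cos0 sin0 /GRing.scale /=; ring.
Qed.

End Rotation.

(** * Every Lie subgroup isomorphic to R^3 is conjugate to one of the fifteen *)

Section Classification.
Local Open Scope quotient_scope.
Variables (R : realType) (f : 'rV[R]_3 -> PGL R 4).
Hypothesis fM : {morph f : x y / x + y >-> (x * y)%g}.
Hypothesis fI : injective f.
Hypothesis fS : immersion f.

Lemma no_complex_structure (J : 'M[R]_4) v r : J != 0 -> J *m J *m J = - J ->
  J = tangent f v + r%:M -> False.
Proof.
move=> J0 J3 JE.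
have dE i j : is_derive (0 : R) 1 (fun t => rotation J t i j) ((tangent f v + r%:M) i j).
  by rewrite -JE; exact: is_derive_rotation.
have p0 : 0 <= pi *+ 2 :> R by rewrite mulrn_wge0 // pi_ge0.
have [k k0] := one_parameter fM fS (rotationD J3) (rotation0 J) dE p0.
rewrite rotation_2pi => kE.
have v0 : (pi *+ 2) *: v = 0.
  apply: fI; have [l l0 lE] := repr_mx0 fM.
  apply/eqP; rewrite -[X in X == _]reprK -[X in _ == X]reprK; apply/PGL_piP.
  exists (l / k); first by rewrite mulf_neq0 ?invr_eq0.
  by rewrite -/(repr_mx f _) -/(repr_mx f _) lE kE scalerA divfK // scalemx1.
move/eqP: v0; rewrite scaler_eq0 mulrn_eq0 /= gt_eqF ?pi_gt0 //= => /eqP v0.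
have t0 : tangent f 0 = 0 by rewrite /tangent linear0.
(* With [v = 0], [J] is a real scalar r with r^3 = -r, hence 0. *)
move: J0 J3; rewrite JE v0 t0 add0r => r0 /matrixP/(_ i0 i0).
rewrite -!scalar_mxM !mxE eqxx !mulr1n => E.
case/negP: r0; suff -> : r = 0 by rewrite raddf0.
apply/eqP; have : r * (r ^+ 2 + 1) == 0.
  by apply/eqP/(@eq_trans _ _ (r * r * r + r)); [ring | rewrite E addNr].
by rewrite mulf_eq0 [_ ^+ 2 + 1 == 0]gt_eqF ?orbF // ltr_wpDl ?sqr_ge0.
Qed.

(** The map [phi] sends [v] to the parameters of its tangent matrix in the algebra [X]. It is well
    defined and linear because [lie_vec] is injective modulo scalars, and [f v] is the class of a
    conjugate of [exp_vec X (phi v)], by [one_parameter] at time 1. *)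
Lemma range_conjugate : exists X, conjugate (range f) (std_group R X).
Proof.
have [[X [B [P Pu PB] LB]]|[J [v [r [J0 J3 JE]]]]] :=
  lie_conj_or_complex (tangent_linear f) (tangent_commute fM fS) (@tangent_scalar _ _ fM fS);
  last by case: (no_complex_structure J0 J3 JE).
exists X.
have /choice[phi phiP] : forall v, exists w : 'rV[R]_3, exists d, B v = d%:M + lie_vec X w.
  move=> v; have [d [x [y [z ->]]]] := LB v.
  by exists (\row_j [:: x; y; z]`_j), d; rewrite /lie_vec !mxE.
pose Q := invmx P.
have QP : Q *m P = 1%:M by rewrite mulVmx.
have QdP d : Q *m d%:M *m P = d%:M by rewrite scalar_mxC -mulmxA QP mulmx1.
have tE v : tangent f v = Q *m B v *m P by rewrite -mulmxA -PB mulKmx.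
have dexp v i j : is_derive (0 : R) 1 (fun t => (Q *m exp_vec X (t *: phi v) *m P) i j)
    ((Q *m lie_vec X (phi v) *m P) i j).
  have dcst (M : 'M[R]_4) k l : is_derive (0 : R) 1 (fun=> M k l) ((0 : 'M[R]_4) k l).
    by rewrite mxE; exact: is_derive_cst.
  have d1 k l : is_derive (0 : R) 1 (fun t => exp_vec X (t *: phi v) k l) (lie_vec X (phi v) k l).
    have /is_derive_line := is_derive_exp_vec X 0 (phi v) k l.
    rewrite exp_vec0 mulmx1 (_ : (fun t => exp_vec X (t *: phi v + 0) k l) = fun t => exp_vec X (t *: phi v) k l) //.
    by apply: funext => t; rewrite addr0.
  have := is_derive_mulmx (is_derive_mulmx (dcst Q) d1) (dcst P) i j.
  by rewrite mul0mx add0r mulmx0 addr0.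
have fE v : exists2 k, k != 0 & repr_mx f v = k *: (Q *m exp_vec X (phi v) *m P).
  have [d Bd] := phiP v.
  have ED s t : Q *m exp_vec X ((s + t) *: phi v) *m P =
      (Q *m exp_vec X (s *: phi v) *m P) *m (Q *m exp_vec X (t *: phi v) *m P).
    by rewrite scalerDl exp_vecD !mulmxA mulmxK.
  have E0 : Q *m exp_vec X (0 *: phi v) *m P = 1%:M by rewrite scale0r exp_vec0 mulmx1 mulVmx.
  have dE i j : is_derive (0 : R) 1 (fun t => (Q *m exp_vec X (t *: phi v) *m P) i j)
      ((tangent f v + (- d)%:M) i j).
    rewrite (_ : tangent f v + _ = Q *m lie_vec X (phi v) *m P); first exact: dexp.
    by rewrite tE Bd mulmxDr mulmxDl QdP raddfN /= addrC addKr.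
  have [k k0] := one_parameter fM fS ED E0 dE (@ler01 R).
  by rewrite !scale1r => kE; exists k.
have phi_lin k u v : phi (k *: u + v) = k *: phi u + phi v.
  have [d1 B1] := phiP (k *: u + v); have [d2 B2] := phiP u; have [d3 B3] := phiP v.
  have BL : B (k *: u + v) = k *: B u + B v.
    apply: (can_inj (mulmxK Pu)); rewrite mulmxDl -scalemxAl -!PB.
    by rewrite tangent_linear mulmxDr -scalemxAr.
  have L : lie_vec X ((-1) *: (k *: phi u + phi v) + phi (k *: u + v)) = (k * d2 + d3 - d1)%:M.
    rewrite !lie_vec_linear scaleN1r.
    have -> : lie_vec X (phi (k *: u + v)) = k *: (d2%:M + lie_vec X (phi u)) + (d3%:M + lie_vec X (phi v)) - d1%:M.
      by rewrite -B2 -B3 -BL B1 [RHS]addrC addKr.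
    move: (lie_vec X (phi u)) (lie_vec X (phi v)) => Lu Lv.
    by apply/matrixP => i j; rewrite !mxE; case: (i == j); rewrite ?mulr1n ?mulr0n; ring.
  have /eqP := lie_vec_scalar L; rewrite scaleN1r addrC subr_eq0 => /eqP //.
have phi_inj v : phi v = 0 -> v = 0.
  move=> v0; have [d Bd] := phiP v; apply: (@tangent_scalar _ _ fM fS _ d).
  rewrite tE Bd v0.
  have -> : @lie_vec R X 0 = 0 by have := @lie_vecZ R X 0 0; rewrite !scale0r.
  by rewrite addr0 QdP.
(* An injective linear endomorphism of R^3 is onto: here containment in the group [X] becomes
   equality. *)
have phi_surj w : exists v, phi v = w.
  pose M : 'M[R]_3 := \matrix_j phi (delta_mx 0 j).
  have phiM v : phi v = v *m M.
    apply/eqP; rewrite -subr_eq0; apply/eqP; move: v; apply: linear_rV_eq0.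
      by move=> k u v; rewrite phi_lin mulmxDl -scalemxAl scalerBr opprD addrACA.
    by move=> j; rewrite -rowE rowK subrr.
  have Mu : M \in unitmx.
    rewrite -row_free_unit -kermx_eq0; apply/rowV0P => u /sub_kermxP uM.
    by apply: phi_inj; rewrite phiM.
  by exists (w *m invmx M); rewrite phiM mulmxKV.
pose g := MkGL Pu.
have fX v : f v = \pi_(PGL R 4) (exp_GL X (phi v) ^ g)%g.
  apply/repr_mxP; have [k k0 kE] := fE v; exists k => //.
  by rewrite kE /Q conjgE /= mulmxA.
exists (PGL_inv (\pi_(PGL R 4) g)); rewrite std_groupE.
have piJ (a b : GL R 4) : \pi_(PGL R 4) (a ^ b)%g = (\pi_(PGL R 4) a ^ \pi_(PGL R 4) b)%g.
  by rewrite !conjgE -!PGL_piM -PGL_piV.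
apply/seteqP; split=> [_ [w _ <-]|_ [_ [v _ <-] <-]].
  have [v vw] := phi_surj w; exists (f v); first by exists v.
  by rewrite fX vw piJ conjgK.
exists (phi v) => //; rewrite fX piJ conjgK //.
Qed.

End Classification.

(** * Conjugation invariants *)

Section Invariants.
Local Open Scope quotient_scope.
Variable R : realType.
Implicit Types (S : set 'M[R]_4) (M N P Q : 'M[R]_4).

Definition conj_sets S S' := exists P Q, [/\ P *m Q = 1%:M, Q *m P = 1%:M,
  forall N, S N -> S' (Q *m N *m P) & forall N, S' N -> S (P *m N *m Q)].

Lemma conj_sets_sym S S' : conj_sets S S' -> conj_sets S' S.
Proof. by move=> [P [Q [PQ QP SS' S'S]]]; exists Q, P. Qed.

(** Numbered, so that separating the groups is a computation in a table. Transposition exchanges 4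
    and 5; invariant 4 tells [F2], [N2], [N8] from [F3], [N3], [N7]. Invariant 6 detects nonzero
    isotropic vectors of the form attached to [N4] or [N4'], and 7 is there for [N5] against
    [N6]. *)
Definition conj_invariant (k : nat) S : Prop :=
  match k with
  | 0 => exists2 N, S N & N != 0
  | 1 => forall M N, S M -> S N -> N != 0 -> exists a, M = a *: N
  | 2 => exists2 N, S N & N *m N != 0
  | 3 => exists2 N, S N & N *m N *m N != 0
  | 4 => exists u : 'rV[R]_4, forall N, S N -> N != 0 -> u *m N != 0
  | 5 => exists w : 'cV[R]_4, forall N, S N -> N != 0 -> N *m w != 0
  | 6 => exists M N, [/\ S M, S N, M *m M = 0 & M *m N != 0]
  | _ => exists (u : 'rV[R]_4) M, [/\ S M, u *m M != 0 &
           forall N, S N -> exists a, u *m N = a *: (u *m M)]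
  end.

Lemma conj_invariant_conj k S S' : conj_sets S S' -> conj_invariant k S -> conj_invariant k S'.
Proof.
move=> [P [Q [PQ QP SS' S'S]]].
have conjK N : P *m (Q *m N *m P) *m Q = N by rewrite !mulmxA PQ mul1mx -mulmxA PQ mulmx1.
have conjK' N : Q *m (P *m N *m Q) *m P = N by rewrite !mulmxA QP mul1mx -mulmxA QP mulmx1.
have conjM M N := mulmx_conj (P := Q) M N PQ.
have nz N : N != 0 -> Q *m N *m P != 0.
  by apply: contra_neq => E; rewrite -[N]conjK E mulmx0 mul0mx.
have nz' N : N != 0 -> P *m N *m Q != 0.
  by apply: contra_neq => E; rewrite -[N]conjK' E mulmx0 mul0mx.
case: k => [|[|[|[|[|[|[|k]]]]]]] /=.
- by case=> N SN N0; exists (Q *m N *m P); [exact: SS' | exact: nz].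
- move=> H M N SM SN N0; have [a E] := H _ _ (S'S _ SM) (S'S _ SN) (nz' _ N0).
  by exists a; rewrite -[M]conjK' E -scalemxAr -scalemxAl conjK'.
- by case=> N SN N0; exists (Q *m N *m P); [exact: SS' | rewrite conjM nz].
- by case=> N SN N0; exists (Q *m N *m P); [exact: SS' | rewrite !conjM nz].
- case=> u Hu; exists (u *m P) => N SN N0.
  have := Hu _ (S'S _ SN) (nz' _ N0); apply: contra_neq => E.
  by rewrite !mulmxA E mul0mx.
- case=> w Hw; exists (Q *m w) => N SN N0.
  have := Hw _ (S'S _ SN) (nz' _ N0); apply: contra_neq => E.
  by rewrite -!mulmxA E mulmx0.
- case=> M [N [SM SN MM MN]]; exists (Q *m M *m P), (Q *m N *m P).
  by split; [exact: SS' | exact: SS' | rewrite conjM MM mulmx0 mul0mx | rewrite conjM nz].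
- case=> u [M [SM uM H]]; exists (u *m P), (Q *m M *m P); split; first exact: SS'.
    apply: contra_neq uM => E.
    by rewrite -[M]conjK !mulmxA -(mulmxA (u *m P)) -(mulmxA (u *m P)) E mul0mx.
  move=> N SN; have [a E] := H _ (S'S _ SN); exists a.
  have -> : u *m P *m N = u *m (P *m N *m Q) *m P by rewrite !mulmxA -(mulmxA _ Q P) QP mulmx1.
  by rewrite E -scalemxAl !mulmxA -(mulmxA u P Q) PQ mulmx1.
Qed.

(* The nilpotent matrices [N] such that [1 + N] lies in the group [X]. *)
Definition nilmx X (x y z : R) : 'M[R]_4 :=
  match X with
  | C => 0
  | E1 => liemx E1 0 0 z
  | F0 | F1 | F2 | F3 => liemx X 0 y z
  | _ => liemx X x y z
  end.

Definition nilset X : set 'M[R]_4 := [set N | exists x y z, N = nilmx X x y z].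

(* Truth value of the invariant [k] on [nilset X]; [None] where it is not needed
   to tell the groups apart. *)
Definition conj_invariant_value (k : nat) X : option bool :=
  match k, X with
  | 0, C => Some false
  | 0, _ => Some true
  | 1, C => None
  | 1, E1 => Some true
  | 1, _ => Some false
  | 2, (F0 | F2 | F3 | N5 | N6 | N7 | N8) => Some false
  | 2, (F1 | N2 | N3 | N4 | N4') => Some true
  | 3, N1 => Some true
  | 3, (N2 | N3 | N4 | N4' | N5 | N6 | N7 | N8) => Some false
  | 4, (F0 | F2 | N2 | N4 | N4' | N8) => Some true
  | 4, (F3 | N3 | N5 | N6 | N7) => Some false
  | 5, (F0 | N4 | N4' | N7) => Some true
  | 5, (F2 | N2 | N5 | N6) => Some false
  | 6, N4 => Some true
  | 6, N4' => Some false
  | 7, N6 => Some true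
  | 7, N5 => Some false
  | _, _ => None
  end.

Lemma entry_neq0 m n (A : 'M[R]_(m, n)) i j : A i j != 0 -> A != 0.
Proof. by apply: contra_neq => ->; rewrite mxE. Qed.

Lemma zero_m4 : 0 = m4 [:: [:: 0; 0; 0; 0]; [:: 0; 0; 0; 0];
                           [:: 0; 0; 0; 0]; [:: 0; 0; 0; 0]] :> 'M[R]_4.
Proof. by apply: matrix4P; rewrite !mxE. Qed.

Lemma conj_invariant0P X : conj_invariant 0 (nilset X) <-> X <> C.
Proof.
split=> [[N [x [y [z ->]]] + XC]|XC]; first by rewrite XC eqxx.
exists (nilmx X 1 1 1); first by exists 1, 1, 1.
case: X XC => [[]|_|_|_|_|_|_|_|_|_|_|_|_|_|_] //.
- by apply: (@entry_neq0 _ _ _ i1 i2); rewrite !mxE /= oner_eq0.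
all: try by apply: (@entry_neq0 _ _ _ i0 i1); rewrite !mxE /= oner_eq0.
all: try by apply: (@entry_neq0 _ _ _ i1 i2); rewrite !mxE /= oner_eq0.
all: by apply: (@entry_neq0 _ _ _ i0 i3); rewrite !mxE /= oner_eq0.
Qed.

Lemma conj_invariant1_E1 : conj_invariant 1 (nilset E1).
Proof.
move=> _ _ [x [y [z ->]]] [x' [y' [z' ->]]] nz.
have z0 : z' != 0.
  apply: contra_neq nz => ->; exact: liemx0.
by exists (z / z'); rewrite /nilmx /liemx m4Z; apply: m4_eq; split; field.
Qed.

Lemma conj_invariant1_false X : X <> C -> X <> E1 -> ~ conj_invariant 1 (nilset X).
Proof.
move=> XC XE H.
have SM : nilset X (nilmx X 0 1 0) by exists 0, 1, 0.
have SN : nilset X (nilmx X 0 0 1) by exists 0, 0, 1.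
have nz : nilmx X 0 0 1 != 0.
  case: X XC XE {H SM SN} => [[]|_ []|_ _|_ _|_ _|_ _|_ _|_ _|_ _|_ _|_ _|_ _|_ _|_ _|_ _] //.
  all: try by apply: (@entry_neq0 _ _ _ i0 i3); rewrite !mxE /= oner_eq0.
  all: try by apply: (@entry_neq0 _ _ _ i0 i2); rewrite !mxE /= oner_eq0.
  by apply: (@entry_neq0 _ _ _ i2 i3); rewrite !mxE /= oner_eq0.
have contr : 1 = 0 :> R -> False by move/eqP; rewrite oner_eq0.
have [a /matrixP E] := H _ _ SM SN nz.
move: (E i0 i1) (E i0 i2) (E i1 i2) (E i1 i3) (E i2 i3).
by case: X XC XE {H SM SN nz E} => [[]|_ []|_ _|_ _|_ _|_ _|_ _|_ _|_ _|_ _|_ _|_ _|_ _|_ _|_ _] //;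
  rewrite !mxE /= ?mulr0 => *; apply: contr.
Qed.

Lemma nilset_mx X x y z : nilset X (nilmx X x y z).
Proof. by exists x, y, z. Qed.

Lemma entry_eq m n (A : 'M[R]_(m, n)) i j a : A i j = a -> a != 0 -> A != 0.
Proof. by move=> <-; exact: entry_neq0. Qed.

Lemma null_pair (a b : R) : exists y z, ((y != 0) || (z != 0)) /\ a * z + b * y = 0.
Proof.
have [/andP[/eqP -> /eqP ->]|n0] := boolP ((a == 0) && (b == 0)).
  by exists 1, 0; rewrite oner_eq0 !mul0r addr0.
by exists a, (- b); split; [rewrite oppr_eq0 -negb_and | ring].
Qed.

(** For [N5]: the matrix with rows (y, z) and (x, y) must have (a, b) in its left kernel, and (a^2,
    -ab, b^2) makes it the product of (-b, a) and (a, -b). *)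
Lemma null_triple (a b : R) : exists x y z,
  [/\ (x != 0) || (z != 0), a * y + b * x = 0 & a * z + b * y = 0].
Proof.
have [/andP[/eqP -> /eqP ->]|n0] := boolP ((a == 0) && (b == 0)).
  by exists 1, 0, 0; rewrite oner_eq0 !mul0r addr0.
exists (a ^+ 2), (- (a * b)), (b ^+ 2); split; try ring.
by rewrite !sqrf_eq0 -negb_and.
Qed.

Lemma conj_invariant2_false X : conj_invariant_value 2 X = Some false -> ~ conj_invariant 2 (nilset X).
Proof.
case: X => // _ [_ [x [y [z ->]]] /eqP[]].
all: rewrite /nilmx /liemx m4_mul zero_m4; apply: m4_eq; split; ring.
Qed.

Lemma conj_invariant2_true X : conj_invariant_value 2 X = Some true -> conj_invariant 2 (nilset X).
Proof.
case: X => // _; [exists (nilmx F1 0 1 0)|exists (nilmx N2 1 0 0)|exists (nilmx N3 1 0 0)|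
  exists (nilmx N4 1 0 1 + nilmx N4 0 1 0)|exists (nilmx N4' 1 0 0)]; try exact: nilset_mx;
  rewrite /nilmx /liemx ?m4_add ?m4_mul.
- by apply: (@entry_eq _ _ _ i0 i2 1); [rewrite !mxE /=; ring | rewrite oner_eq0].
- by apply: (@entry_eq _ _ _ i0 i2 1); [rewrite !mxE /=; ring | rewrite oner_eq0].
- by apply: (@entry_eq _ _ _ i1 i3 1); [rewrite !mxE /=; ring | rewrite oner_eq0].
- by exists 1, 1, 1; rewrite /nilmx /liemx; apply: m4_eq; split; ring.
- by apply: (@entry_eq _ _ _ i0 i3 2); [rewrite !mxE /=; ring | rewrite pnatr_eq0].
- by apply: (@entry_eq _ _ _ i0 i3 1); [rewrite !mxE /=; ring | rewrite oner_eq0].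
Qed.

Lemma conj_invariant3_false X : conj_invariant_value 3 X = Some false -> ~ conj_invariant 3 (nilset X).
Proof.
case: X => // _ [_ [x [y [z ->]]] /eqP[]].
all: rewrite /nilmx /liemx !m4_mul zero_m4; apply: m4_eq; split; ring.
Qed.

Lemma conj_invariant3_true : conj_invariant 3 (nilset N1).
Proof.
exists (nilmx N1 1 0 0); first exact: nilset_mx.
rewrite /nilmx /liemx !m4_mul.
by apply: (@entry_eq _ _ _ i0 i3 1); [rewrite !mxE /=; ring | rewrite oner_eq0].
Qed.

Lemma row_mul4 (u : 'rV[R]_4) (M : 'M[R]_4) j :
  (u *m M) 0 j = u 0 i0 * M i0 j + u 0 i1 * M i1 j + u 0 i2 * M i2 j + u 0 i3 * M i3 j.
Proof. by rewrite mxE big_ord4. Qed.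

Lemma col_mul4 (w : 'cV[R]_4) (M : 'M[R]_4) i :
  (M *m w) i 0 = M i i0 * w i0 0 + M i i1 * w i1 0 + M i i2 * w i2 0 + M i i3 * w i3 0.
Proof. by rewrite mxE big_ord4. Qed.

Let simp := (oppr0, mul0r, mul1r, mulr0, mulr1, addr0, add0r).

Lemma conj_invariant4_true X : conj_invariant_value 4 X = Some true -> conj_invariant 4 (nilset X).
Proof.
case: X => // _.
  (* For [F0] the vector must meet both Jordan blocks; in the other cases the first row shows all
     the parameters. *)
  exists (\row_k [:: 1; 0; 1; 0]`_k) => _ [x [y [z ->]]]; apply: contra_neq => /rowP E.
  have /eqP := E i1; have /eqP := E i3; rewrite !row_mul4 !mxE /= ?simp => /eqP -> /eqP ->.
  by rewrite zero_m4 ?oppr0.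
all: exists (\row_k [:: 1; 0; 0; 0]`_k) => _ [x [y [z ->]]]; apply: contra_neq => /rowP E.
all: move: (E i1) (E i2) (E i3); rewrite !row_mul4 !mxE /= ?simp.
all: first [move=> -> -> _; by rewrite zero_m4 ?oppr0 | move=> -> -> ->; by rewrite zero_m4 ?oppr0].
Qed.

Lemma conj_invariant5_true X : conj_invariant_value 5 X = Some true -> conj_invariant 5 (nilset X).
Proof.
case: X => // _.
  exists (\col_k [:: 0; 1; 0; 1]`_k) => _ [x [y [z ->]]]; apply: contra_neq => /colP E.
  have /eqP := E i0; have /eqP := E i2; rewrite !col_mul4 !mxE /= ?simp => /eqP -> /eqP ->.
  by rewrite zero_m4 ?oppr0.
all: exists (\col_k [:: 0; 0; 0; 1]`_k) => _ [x [y [z ->]]]; apply: contra_neq => /colP E.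
all: move: (E i0) (E i1) (E i2); rewrite !col_mul4 !mxE /= ?simp.
all: by move=> -> -> ->; rewrite zero_m4 ?oppr0.
Qed.

Lemma conj_invariant4_false X : conj_invariant_value 4 X = Some false -> ~ conj_invariant 4 (nilset X).
Proof.
have H2 (N : 'M[R]_4) (u : 'rV[R]_4) : nilset X N -> N != 0 -> u *m N = 0 ->
    ~ forall N, nilset X N -> N != 0 -> u *m N != 0.
  by move=> SN N0 uN /(_ N SN N0); rewrite uN eqxx.
case: X H2 => // H2 _ [u]; [have [y [z [yz E]]] := null_pair (u 0 i0) (u 0 i1)|
  have [y [z [yz E]]] := null_pair (u 0 i0) (u 0 i1)| have [x [y [z [yz E1 E2]]]] := null_triple (u 0 i0) (u 0 i1)|
  have [y [z [yz E]]] := null_pair (u 0 i0) (u 0 i2)| have [y [z [yz E]]] := null_pair (u 0 i0) (u 0 i1)];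
  [apply: (H2 (nilmx F3 0 y z))|apply: (H2 (nilmx N3 0 y z))|apply: (H2 (nilmx N5 x y z))|
   apply: (H2 (nilmx N6 0 y z))|apply: (H2 (nilmx N7 0 y z))]; try exact: nilset_mx.
all: try (by apply/rowP; apply: ord4P; rewrite row_mul4 !mxE /= ?simp ?E ?E1 ?E2).
- by case/orP: yz => [y0|z0]; [apply: (@entry_neq0 _ _ _ i1 i2)|apply: (@entry_neq0 _ _ _ i0 i2)]; rewrite !mxE.
- by case/orP: yz => [y0|z0]; [apply: (@entry_neq0 _ _ _ i1 i3)|apply: (@entry_neq0 _ _ _ i0 i3)]; rewrite !mxE.
- by case/orP: yz => [y0|z0]; [apply: (@entry_neq0 _ _ _ i1 i2)|apply: (@entry_neq0 _ _ _ i0 i3)]; rewrite !mxE.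
- by case/orP: yz => [y0|z0]; [apply: (@entry_neq0 _ _ _ i2 i3)|apply: (@entry_neq0 _ _ _ i0 i3)]; rewrite !mxE.
- by case/orP: yz => [y0|z0]; [apply: (@entry_neq0 _ _ _ i1 i3)|apply: (@entry_neq0 _ _ _ i0 i3)]; rewrite !mxE.
Qed.

Lemma conj_invariant5_false X : conj_invariant_value 5 X = Some false -> ~ conj_invariant 5 (nilset X).
Proof.
have H2 (N : 'M[R]_4) (w : 'cV[R]_4) : nilset X N -> N != 0 -> N *m w = 0 ->
    ~ forall N, nilset X N -> N != 0 -> N *m w != 0.
  by move=> SN N0 uN /(_ N SN N0); rewrite uN eqxx.
case: X H2 => // H2 _ [w]; [have [y [z [yz E]]] := null_pair (w i2 0) (w i1 0)|
  have [y [z [yz E]]] := null_pair (w i3 0) (w i2 0)| have [x [y [z [yz E1 E2]]]] := null_triple (w i3 0) (w i2 0)|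
  have [y [z [yz E]]] := null_pair (w i3 0) (w i1 0)];
  [apply: (H2 (nilmx F2 0 y z))|apply: (H2 (nilmx N2 0 y z))|apply: (H2 (nilmx N5 x y z))|
   apply: (H2 (nilmx N6 y 0 z))]; try exact: nilset_mx.
all: try (by apply/colP; apply: ord4P; rewrite col_mul4 !mxE /= ?simp //; lra).
- by case/orP: yz => [y0|z0]; [apply: (@entry_neq0 _ _ _ i0 i1)|apply: (@entry_neq0 _ _ _ i0 i2)]; rewrite !mxE.
- by case/orP: yz => [y0|z0]; [apply: (@entry_neq0 _ _ _ i0 i2)|apply: (@entry_neq0 _ _ _ i0 i3)]; rewrite !mxE.
- by case/orP: yz => [y0|z0]; [apply: (@entry_neq0 _ _ _ i1 i2)|apply: (@entry_neq0 _ _ _ i0 i3)]; rewrite !mxE.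
- by case/orP: yz => [y0|z0]; [apply: (@entry_neq0 _ _ _ i0 i1)|apply: (@entry_neq0 _ _ _ i0 i3)]; rewrite !mxE.
Qed.

Lemma conj_invariant6_N4 : conj_invariant 6 (nilset N4).
Proof.
exists (nilmx N4 1 0 0), (nilmx N4 0 1 0); split; try exact: nilset_mx.
  by rewrite /nilmx /liemx m4_mul zero_m4; apply: m4_eq; split; ring.
rewrite /nilmx /liemx m4_mul.
by apply: (@entry_eq _ _ _ i0 i3 1); [rewrite !mxE /=; ring | rewrite oner_eq0].
Qed.

(** The corner of the square is x^2 + y^2. If it vanishes, only the corner entry of the matrix is
    left, and this annihilates the whole family. *)
Lemma conj_invariant6_N4' : ~ conj_invariant 6 (nilset N4').
Proof.
move=> [_ [_ [[x [y [z ->]]] [x' [y' [z' ->]]] /matrixP/(_ i0 i3) E /eqP[]]]].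
move: E; rewrite /nilmx /liemx !m4_mul !mxE /= ?simp -!expr2 => /eqP.
rewrite paddr_eq0 ?sqr_ge0 // !sqrf_eq0 => /andP[/eqP -> /eqP ->].
by rewrite zero_m4; apply: m4_eq; split; ring.
Qed.

Lemma conj_invariant7_N6 : conj_invariant 7 (nilset N6).
Proof.
exists (\row_k [:: 0; 0; 1; 0]`_k), (nilmx N6 0 1 0); split; first exact: nilset_mx.
  by apply: (@entry_neq0 _ _ _ 0 i3); rewrite row_mul4 !mxE /= ?simp oner_eq0.
move=> _ [x [y [z ->]]]; exists y.
by apply/rowP; apply: ord4P; rewrite row_mul4 [RHS]mxE row_mul4 !mxE /= ?simp.
Qed.

(** The images of [u] fill a plane if one of its first two coordinates is nonzero, and are all 0
    otherwise; they never form a line. *)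
Lemma conj_invariant7_N5 : ~ conj_invariant 7 (nilset N5).
Proof.
move=> [u [_ [[x [y [z ->]]] uM H]]].
set m := u *m _ in uM H.
have uE a b c : u *m nilmx N5 a b c = \row_k [:: 0; 0; u 0 i0 * b + u 0 i1 * a; u 0 i0 * c + u 0 i1 * b]`_k.
  by apply/rowP; apply: ord4P; rewrite row_mul4 !mxE /= ?simp.
have [a1 Ex] := H _ (nilset_mx N5 1 0 0).
have [a2 Ey] := H _ (nilset_mx N5 0 1 0).
have [a3 Ez] := H _ (nilset_mx N5 0 0 1).
have m_eq k : m 0 k = [:: 0; 0; u 0 i0 * y + u 0 i1 * x; u 0 i0 * z + u 0 i1 * y]`_k.
  by rewrite /m uE mxE.
have coef k a b c l : u *m nilmx N5 a b c = l *: m ->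
    (\row_k [:: 0; 0; u 0 i0 * b + u 0 i1 * a; u 0 i0 * c + u 0 i1 * b]`_k : 'rV[R]_4) 0 k = l * m 0 k.
  by rewrite uE => ->; rewrite mxE.
have x2 := coef i2 _ _ _ _ Ex; have x3 := coef i3 _ _ _ _ Ex.
have y2 := coef i2 _ _ _ _ Ey; have y3 := coef i3 _ _ _ _ Ey.
have z2 := coef i2 _ _ _ _ Ez; have z3 := coef i3 _ _ _ _ Ez.
move: x2 x3 y2 y3 z2 z3; rewrite ![(\row__ _) _ _]mxE /= ?simp => x2 x3 y2 y3 z2 z3.
have [u0|u0] := eqVneq (u 0 i0) 0.
  have [u1|u1] := eqVneq (u 0 i1) 0.
    by case/eqP: uM; apply/rowP; apply: ord4P; rewrite m_eq mxE /= ?u0 ?u1 ?simp.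
  have a1m : a1 * m 0 i2 != 0 by rewrite -x2.
  have m3 : m 0 i3 = 0.
    by move: a1m; rewrite mulf_eq0 => /norP[/negPf a10 _]; move/esym/eqP: x3; rewrite mulf_eq0 a10 => /eqP.
  by case/eqP: u1; rewrite y3 m3 mulr0.
have a3m : a3 * m 0 i3 != 0 by rewrite -z3.
have m2 : m 0 i2 = 0.
  by move: a3m; rewrite mulf_eq0 => /norP[/negPf a30 _]; move/esym/eqP: z2; rewrite mulf_eq0 a30 => /eqP.
by case/eqP: u0; rewrite y2 m2 mulr0.
Qed.

Lemma conj_invariant_valueP k X b : conj_invariant_value k X = Some b -> conj_invariant k (nilset X) <-> b.
Proof.
have TB (Q : Prop) : (b -> Q) -> (~~ b -> ~ Q) -> (Q <-> b).
  by case: b => t f; split=> // q; first [exact: t | case: (f isT q)].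
move=> E; apply: TB => [bt|bf].
- rewrite bt {bt} in E.
  move: E; case: k => [|[|[|[|[|[|[|[|k]]]]]]]].
  + by move=> E; apply/conj_invariant0P => XC; rewrite XC in E.
  + by case: X => // _; exact: conj_invariant1_E1.
  + exact: conj_invariant2_true.
  + by case: X => // _; exact: conj_invariant3_true.
  + exact: conj_invariant4_true.
  + exact: conj_invariant5_true.
  + by case: X => // _; exact: conj_invariant6_N4.
  + by case: X => // _; exact: conj_invariant7_N6.
  + by case: X.
- rewrite (negbTE bf) {bf} in E.
  move: E; case: k => [|[|[|[|[|[|[|[|k]]]]]]]].
  + by case: X => // _ /conj_invariant0P.
  + by move=> E; apply: conj_invariant1_false => XC; rewrite XC in E.
  + exact: conj_invariant2_false.
  + exact: conj_invariant3_false.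
  + exact: conj_invariant4_false.
  + exact: conj_invariant5_false.
  + by case: X => // _; exact: conj_invariant6_N4'.
  + by case: X => // _; exact: conj_invariant7_N5.
  + by case: X.
Qed.

End Invariants.

(** * Transfer of the invariants to PGL_4 and separation of the groups *)

Section NonConjugacy.
Local Open Scope quotient_scope.
Variable R : realType.
Implicit Types (S : set 'M[R]_4) (M N P Q : 'M[R]_4) (x y z c : R).

(** The preimage of the group in GL_4, as a set of matrices. *)
Definition scaled_group X : set 'M[R]_4 :=
  [set M | exists k x y z, k != 0 /\ M = k *: gexp X x y z].

Lemma conj_scaled_group X Y :
  conjugate (std_group R X) (std_group R Y) -> conj_sets (scaled_group X) (scaled_group Y).
Proof.
move=> [g]; rewrite !std_groupE => /seteqP[YX XY].
have [PQ QP] : GLmx (repr g) *m invmx (GLmx (repr g)) = 1%:M /\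
    invmx (GLmx (repr g)) *m GLmx (repr g) = 1%:M.
  by rewrite mulmxV ?mulVmx ?GLmxP.
set P := GLmx (repr g) in PQ QP *; set Q := invmx P in PQ QP *.
have conjE (h : GL R 4) (k : GL R 4) : (\pi_(PGL R 4) h ^ g)%g = \pi_(PGL R 4) k ->
    exists2 c : R, c != 0 & GLmx k = c *: (Q *m GLmx h *m P).
  move=> E; have : \pi_(PGL R 4) ((repr g)^-1 * h * repr g)%g == \pi_(PGL R 4) k.
    apply/eqP; rewrite -E conjgE -{3 4}(reprK g).
    by rewrite -[(\pi_(PGL R 4) (repr g))^-1%g]/(PGL_inv _) PGL_piV /= mulgA; rewrite -!PGL_piM.
  by move/PGL_piP => [c c0 ->]; exists c.
exists P, Q; split=> // N [k [x [y [z [k0 ->]]]]].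
- have : range (fun v : 'rV[R]_3 => \pi_(PGL R 4) (GLexp Y (v 0 0) (v 0 1) (v 0 (1 + 1)))) (\pi_(PGL R 4) (GLexp X x y z) ^ g)%g.
    by apply: XY; exists (\pi_(PGL R 4) (GLexp X x y z)) => //; exists (\row_j [:: x; y; z]`_j) => //; rewrite !mxE.
  case=> v _ /esym /conjE[c c0 /= E].
  exists (k / c), (v 0 0), (v 0 1), (v 0 (1 + 1)); split; first by rewrite mulf_neq0 ?invr_eq0.
  by rewrite E scalerA divfK // -scalemxAr -scalemxAl.
- have : range (fun v : 'rV[R]_3 => \pi_(PGL R 4) (GLexp Y (v 0 0) (v 0 1) (v 0 (1 + 1)))) (\pi_(PGL R 4) (GLexp Y x y z)).
    by exists (\row_j [:: x; y; z]`_j) => //; rewrite !mxE.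
  move=> /YX [_ [v _ <-]] /conjE[c c0 /= E].
  exists (k * c), (v 0 0), (v 0 1), (v 0 (1 + 1)); split; first by rewrite mulf_neq0.
  by rewrite E scalerA -scalemxAr -scalemxAl !mulmxA PQ mul1mx -mulmxA PQ mulmx1.
Qed.

Definition nil4 N := N *m N *m N *m N = 0.

Lemma nil4_conj P Q N : P *m Q = 1%:M -> nil4 N -> nil4 (Q *m N *m P).
Proof.
move=> PQ N0; rewrite /nil4.
by rewrite !(mulmx_conj _ _ PQ) N0 mulmx0 mul0mx.
Qed.

Lemma nil4_strict N : (forall i j : 'I_4, (j <= i)%N -> N i j = 0) -> nil4 N.
Proof.
move=> H; have -> : N = m4 [:: [:: 0; N i0 i1; N i0 i2; N i0 i3]; [:: 0; 0; N i1 i2; N i1 i3];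
    [:: 0; 0; 0; N i2 i3]; [:: 0; 0; 0; 0]].
  by apply: matrix4P; split; rewrite mxE //= H.
by rewrite /nil4 !m4_mul zero_m4; apply: m4_eq; split; ring.
Qed.

Lemma nil4_diag N : (forall i j : 'I_4, (j < i)%N -> N i j = 0) -> nil4 N ->
  forall i, N i i = 0.
Proof.
move=> H; have E : N = m4 [:: [:: N i0 i0; N i0 i1; N i0 i2; N i0 i3];
    [:: 0; N i1 i1; N i1 i2; N i1 i3]; [:: 0; 0; N i2 i2; N i2 i3]; [:: 0; 0; 0; N i3 i3]].
  by apply: matrix4P; split; rewrite mxE //= H.
rewrite /nil4 {1 2 3 4}E !m4_mul => /matrixP N0 i.
apply/eqP; rewrite -[_ == _](expf_eq0 _ 4) //; apply/eqP.
have := N0 i i; rewrite [RHS]mxE => {}N0; rewrite -[RHS]N0.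
by clear N0; apply: (ord4P (P := fun i => _ = _)) i; rewrite mxE /=; ring.
Qed.

Lemma gexp_upper X x y z (i j : 'I_4) : (j < i)%N -> gexp X x y z i j = 0.
Proof.
by move: i j; case: X => i j; rewrite mxE; case: i j => [[|[|[|[|i]]]] ?] [[|[|[|[|j]]]] ?].
Qed.

(** The diagonal entries are positive with product 1, so equal entries are 1. *)
Lemma gexp_diag_const X x y z c :
  (forall i, gexp X x y z i i = c) -> c = 1 /\ nilset X (gexp X x y z - 1%:M).
Proof.
move=> E; move: (E i0) (E i1) (E i2) (E i3).
case: X {E}; rewrite !mxE /=.
- move=> ex ey ez e3; have x0 : x = 0.
    by apply: (@expR_inv_fix R 3); rewrite ex -[RHS]e3 ex ey ez !exprS expr0 mulr1 mulrA.
  have [c1 y0 z0] : [/\ c = 1, y = 0 & z = 0].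
    by split; [rewrite -ex x0 expR0 | apply: expR_inj; rewrite ey -ex x0 | apply: expR_inj; rewrite ez -ex x0].
  split=> //; exists 0, 0, 0; rewrite x0 y0 z0; apply: matrix4P; split; rewrite !mxE /= ?expR0; by field.
- move=> ex ey _ e3; have x0 : x = 0.
    by apply: (@expR_inv_fix R 3); rewrite ex -[RHS]e3 ex ey exprS.
  have y0 : y = 0 by apply: expR_inj; rewrite ey -ex x0.
  split; first by rewrite -ex x0 expR0.
  exists 0, 0, z; rewrite x0 y0; apply: matrix4P; split; rewrite !mxE /= ?expR0; by field.
- move=> ex _ e2 _; have x0 : x = 0 by apply: (@expR_inv_fix R 1); rewrite expr1 e2 ex.
  split; first by rewrite -ex x0 expR0.
  exists 0, y, z; rewrite x0; apply: matrix4P; split; rewrite !mxE /= ?oppr0 ?expR0; by field.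
- move=> ex _ _ e3; have x0 : x = 0 by apply: (@expR_inv_fix R 3); rewrite e3 ex.
  split; first by rewrite -ex x0 expR0.
  exists 0, y, (z + y ^+ 2 / 2); rewrite x0; apply: matrix4P; split; rewrite !mxE /= ?expR0; by field.
- move=> ex _ _ e3; have x0 : x = 0 by apply: (@expR_inv_fix R 3); rewrite e3 ex.
  split; first by rewrite -ex x0 expR0.
  exists 0, y, z; rewrite x0; apply: matrix4P; split; rewrite !mxE /= ?expR0; by field.
- move=> ex _ _ e3; have x0 : x = 0 by apply: (@expR_inv_fix R 3); rewrite e3 ex.
  split; first by rewrite -ex x0 expR0.
  exists 0, y, z; rewrite x0; apply: matrix4P; split; rewrite !mxE /= ?expR0; by field.
- move=> <- *; split=> //; exists x, (y + x ^+ 2 / 2), (z + x * y + x ^+ 3 / 6).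
  apply: matrix4P; split; rewrite !mxE /=; ring.
- move=> <- *; split=> //; exists x, (y + x ^+ 2 / 2), z.
  apply: matrix4P; split; rewrite !mxE /=; ring.
- move=> <- *; split=> //; exists x, (y + x ^+ 2 / 2), z.
  apply: matrix4P; split; rewrite !mxE /=; ring.
- move=> <- *; split=> //; exists x, y, (z + x * y).
  apply: matrix4P; split; rewrite !mxE /=; ring.
- move=> <- *; split=> //; exists x, y, (z + (x ^+ 2 + y ^+ 2) / 2).
  apply: matrix4P; split; rewrite !mxE /=; ring.
all: move=> <- *; split=> //; exists x, y, z.
all: apply: matrix4P; split; rewrite !mxE /=; ring.
Qed.

(** Nilpotence fixes the scalar: an upper triangular nilpotent matrix has zero diagonal, so the
    diagonal of the group element is constant, hence 1, and the factor is 1. Together with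
    [nilset_nil4], this describes [nilset X] in terms of [scaled_group X] alone, which makes it
    compatible with conjugation. *)
Lemma nil4_scaled_group X N : nil4 N -> scaled_group X (1%:M + N) -> nilset X N.
Proof.
move=> N0 [k [x [y [z [k0 E]]]]].
have {}E : N = k *: gexp X x y z - 1%:M by rewrite -E addrAC subrr add0r.
have D i : gexp X x y z i i = k^-1.
  have := nil4_diag _ N0 i; rewrite E !mxE eqxx mulr1n => /(_ _)/eqP.
  rewrite subr_eq0 => H; apply: (mulfI k0); rewrite mulfV //; apply/eqP/H => {H} i' j' ij.
  by rewrite !mxE gexp_upper // mulr0 gt_eqF ?subr0.
have [/eqP] := gexp_diag_const D; rewrite invr_eq1 => /eqP k1.
by rewrite E k1 scale1r.
Qed.

Lemma nilset_nil4 X N : nilset X N -> nil4 N /\ scaled_group X (1%:M + N).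
Proof.
move=> [x [y [z ->]]]; split.
  apply: nil4_strict => i j.
  case: X; rewrite mxE //; case: i j => [[|[|[|[|i]]]] ?] [[|[|[|[|j]]]] ?] //= _;
    by rewrite ?mulr0 ?addr0 ?oppr0.
have : exists a b c, group_dom X a b c /\ 1%:M + nilmx X x y z = group_mx X a b c.
  case: X; [exists 1, 1, 1|exists 1, 1, z|exists 1, y, z|exists 1, y, z|exists 1, y, z|exists 1, y, z
    |exists x, y, z|exists x, y, z|exists x, y, z|exists x, y, z|exists x, y, z|exists x, y, z
    |exists x, y, z|exists x, y, z|exists x, y, z]; split; rewrite /= ?ltr01 //;
    apply: matrix4P; split; rewrite !mxE /=; by field.
move=> [a [b [c [abc ->]]]]; have [x' [y' [z' <-]]] := gexp_surj abc.
by exists 1, x', y', z'; rewrite oner_eq0 scale1r.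
Qed.

Lemma conj_nilset X Y : conj_sets (scaled_group X) (scaled_group Y) -> conj_sets (nilset (R := R) X) (nilset Y).
Proof.
move=> [P [Q [PQ QP XY YX]]]; exists P, Q; split=> // N /nilset_nil4[N0 cN].
- apply: nil4_scaled_group; first exact: nil4_conj.
  by have := XY _ cN; rewrite mulmxDr mulmxDl mulmx1 QP.
- apply: nil4_scaled_group; first exact: nil4_conj.
  by have := YX _ cN; rewrite mulmxDr mulmxDl mulmx1 PQ.
Qed.

Definition scalar_plus_nil S := forall M, S M -> exists k, nil4 (M - k%:M).

Lemma scalar_plus_nil_conj S S' : conj_sets S S' -> scalar_plus_nil S -> scalar_plus_nil S'.
Proof.
move=> [P [Q [PQ QP SS' S'S]]] H M /S'S/H[k N0]; exists k.
have := nil4_conj PQ N0; rewrite mulmxBr mulmxBl !mulmxA QP mul1mx -mulmxA QP mulmx1.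
by rewrite mul_mx_scalar -scalemxAl QP scalemx1.
Qed.

Definition unipotent X :=
  match X with
  | C | E1 | F0 | F1 | F2 | F3 => false
  | _ => true
  end.

Lemma unipotent_scaled_group X : unipotent X -> scalar_plus_nil (scaled_group X).
Proof.
move=> uX _ [k [x [y [z [_ ->]]]]]; exists k; apply: nil4_strict => i j ji.
have [{}ji|ij] := ltnP j i.
  by rewrite !mxE gexp_upper // mulr0 gt_eqF ?subr0.
have -> : j = i by apply/val_inj/eqP; rewrite eqn_leq ji.
rewrite !mxE eqxx mulr1n; case: X uX => // _; rewrite mxE.
all: by move: i {ji ij}; apply: ord4P; rewrite /= mulr1 subrr.
Qed.

Lemma not_unipotent_scaled_group X : ~~ unipotent X -> ~ scalar_plus_nil (scaled_group X).
Proof.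
move=> uX /(_ (gexp X 1 0 0)) [|k].
  by exists 1, 1, 0, 0; rewrite oner_eq0 scale1r.
have up (i j : 'I_4) : (j < i)%N -> (gexp X 1 0 0 - k%:M) i j = 0.
  by move=> ji; rewrite !mxE gexp_upper // gt_eqF ?subr0.
move=> /(nil4_diag up) D.
have {}D i : gexp X 1 0 0 i i = k by apply/eqP; rewrite -subr_eq0; have := D i; rewrite !mxE eqxx mulr1n => ->.
have contr m : 1 / expR 1 ^+ m = expR 1 :> R -> False by move=> /expR_inv_fix/eqP; rewrite oner_eq0.
move: (D i0) (D i1) (D i2) (D i3); case: X uX {up D} => // _; rewrite !mxE /= => <-.
- by move=> /expR_inj/esym/eqP; rewrite oner_eq0.
- by move=> /expR_inj/esym/eqP; rewrite oner_eq0.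
- by move=> _ + _; rewrite -[expR 1 in X in X -> _]expr1 => /contr.
all: by move=> _ _ /contr.
Qed.

Definition separated X Y : bool :=
  (unipotent X != unipotent Y) ||
  has (fun k => match conj_invariant_value k X, conj_invariant_value k Y with
                | Some a, Some b => a != b
                | _, _ => false
                end) (iota 0 8).

(** Evaluation of the table on all 225 pairs. *)
Lemma separatedP X Y : ~~ separated X Y -> X = Y.
Proof. by case: X; case: Y. Qed.

Lemma std_group_inj X Y : conjugate (std_group R X) (std_group R Y) -> X = Y.
Proof.
move=> /conj_scaled_group XY; apply: separatedP; apply/negP => /orP[uXY|].
  case uX: (unipotent X) uXY; case uY: (unipotent Y) => // _.
    exact: not_unipotent_scaled_group (negbT uY) (scalar_plus_nil_conj XY (unipotent_scaled_group uX)).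
  exact: not_unipotent_scaled_group (negbT uX) (scalar_plus_nil_conj (conj_sets_sym XY) (unipotent_scaled_group uY)).
move=> /hasP[k _]; case EX: conj_invariant_value => [a|] //; case EY: conj_invariant_value => [b|] // ab.
have nXY := conj_nilset XY.
have iXY : conj_invariant k (nilset (R := R) X) <-> conj_invariant k (nilset (R := R) Y).
  by split; apply: conj_invariant_conj => //; exact: conj_sets_sym.
have [Xa aX] := conj_invariant_valueP R EX; have [Yb bY] := conj_invariant_valueP R EY.
have [ab1 ab2] : (a -> b) /\ (b -> a) by split=> [/aX/iXY/Yb | /bY/iXY/Xa].
by case/eqP: ab; apply/idP/idP.
Qed.

End NonConjugacy.

(** * Conjugacy classes and their number *)

Section Conjugacy.
Variable G : groupType.
Implicit Types H K L : set G.
Local Open Scope group_scope.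

Lemma conjugate_refl H : conjugate H H.
Proof.
exists 1; apply/seteqP; split=> [h Hh|_ [h Hh <-]]; last by rewrite conjg1.
by exists h => //; rewrite conjg1.
Qed.

Lemma conjugate_sym H K : conjugate H K -> conjugate K H.
Proof.
move=> [g ->]; exists g^-1; apply/seteqP; split=> [h Hh|_ [_ [h Hh <-] <-]].
  by exists (h ^ g); [exists h | rewrite conjgK].
by rewrite conjgK.
Qed.

Lemma conjugate_trans H K L : conjugate H K -> conjugate K L -> conjugate H L.
Proof.
move=> [g ->] [k ->]; exists (g * k); apply/seteqP; split=> [_ [_ [h Hh <-] <-]|_ [h Hh <-]].
  by exists h => //; rewrite conjgM.
by exists (h ^ g); [exists h | rewrite conjgM].
Qed.

Lemma conjugacy_classP H K : conjugacy_class H = conjugacy_class K <-> conjugate H K.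
Proof.
split=> [E|HK].
  have : conjugacy_class K K by exact: conjugate_refl.
  by rewrite -E.
apply/seteqP; split=> L; apply: conjugate_trans => //; exact: conjugate_sym.
Qed.

End Conjugacy.

Definition group_names := [:: C; E1; F0; F1; F2; F3; N1; N2; N3; N4; N4'; N5; N6; N7; N8].

Lemma group_names_surj X : exists2 k, (k < 15)%N & nth C group_names k = X.
Proof.
by case: X; [exists 0%N|exists 1%N|exists 2%N|exists 3%N|exists 4%N|exists 5%N|exists 6%N|
  exists 7%N|exists 8%N|exists 9%N|exists 10%N|exists 11%N|exists 12%N|exists 13%N|exists 14%N].
Qed.

Lemma group_names_inj : {in `I_15 &, injective (nth C group_names)}.
Proof.
move=> k l; rewrite !inE /=.
by do 15 (case: k => [|k]; first by do 15 (case: l => [|l] //)).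
Qed.

Unset Implicit Arguments.

Theorem theorem1p1 (R : realType) :
  [/\ ([set conjugacy_class H |
         H in [set H : set (PGL R 4) | lie_subgroup_iso 'rV[R]_3 H]] #= `I_15)%card,
      (forall X : group_name, lie_subgroup_iso 'rV[R]_3 (std_group R X)),
      (forall H : set (PGL R 4), lie_subgroup_iso 'rV[R]_3 H ->
         exists X : group_name, conjugate H (std_group R X)) &
      (forall X Y : group_name,
         conjugate (std_group R X) (std_group R Y) -> X = Y)].
Proof.
have classify (H : set (PGL R 4)) : lie_subgroup_iso 'rV[R]_3 H ->
    exists X, conjugate H (std_group R X).
  by move=> [f [fM fI fS ->]]; exact: range_conjugate.
split; [|exact: std_group_lie|exact: classify|exact: std_group_inj].
set classes := (X in (X #= _)%card).
have -> : classes = [set conjugacy_class (std_group R (nth C group_names k)) | k in `I_15].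
  apply/seteqP; split=> [_ [H /classify[X HX] <-]|_ [k _ <-]].
    have [k k15 Xk] := group_names_surj X; exists k => //.
    by rewrite Xk; apply/esym/conjugacy_classP.
  by exists (std_group R (nth C group_names k)) => //; exact: std_group_lie.
apply: inj_card_eq => k l k15 l15 /conjugacy_classP/std_group_inj.
exact: group_names_inj.
Qed.
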